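(* Assume that $H$ is an integer multiple of $\varepsilon$, that $\eta=\tau$, that $0<\delta\le\omega$ and $\omega\ge 1$, and that $\frac{|\bar a-\alpha|}{\bar a}\le\frac12$. Let $\mathbf b\in\mathbb R^{M_x}$, let $\bar{\mathbf u}_h\in\mathbb R^{M_x}$ be the solution of $\bar a D^2\bar{\mathbf u}_h+\omega^2\bar{\mathbf u}_h=\mathbf b$, and let $\mathbf v_h\in\mathbb R^{M_x}$ be the fixed point of the WaveHoltz heterogeneous multiscale method (WHMM) for the same $\mathbf b$. Then there are constants $C_1,C_2,C_3$ depending only on $a$ and $q$ such that $$\|\bar{\mathbf u}_h-\mathbf v_h\|_H\le\frac{C_1}{\delta^2}\Bigl(\frac{\varepsilon}{\eta}\Bigr)^q\|\mathbf b\|_H,\qquad \|\bar{\mathbf u}_h-\mathbf v_h\|_H\le\frac{C_2}{\omega^2\delta^2}\Bigl(\frac{\varepsilon}{\eta}\Bigr)^q\|D^2\mathbf b\|_H,$$ and (for $\mathbf b\ne 0$) $$\frac{\|\bar{\mathbf u}_h-\mathbf v_h\|_H}{\|\bar{\mathbf u}_h\|_H}\le C_3\,\frac{\omega}{\delta}\Bigl(\frac{\varepsilon}{\eta}\Bigr)^q .$$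
   Context: **Coefficients and grid.** $L>0$ is fixed. $a:\mathbb R\to\mathbb R$ is a fixed 1-periodic function with $0<\inf a\le\sup a<\infty$; $\varepsilon>0$ and $a_\varepsilon(x)=a(x/\varepsilon)$. The homogenized coefficient is the constant $\bar a=\bigl(\int_0^1 a(y)^{-1}\,dy\bigr)^{-1}$. For an integer $M_x\ge1$ put $H=L/(M_x+1)$ and $X_j=jH$, $j=0,\dots,M_x+1$. $D^2\in\mathbb R^{M_x\times M_x}$ is the standard three-point finite difference Laplacian with homogeneous Dirichlet conditions: $(D^2\mathbf f)_j=(f_{j+1}-2f_j+f_{j-1})/H^2$ with $f_0=f_{M_x+1}=0$. The norm is $\|\mathbf f\|_H=\bigl(\sum_{j=1}^{M_x}H f_j^2\bigr)^{1/2}$. **Averaging kernel.** $\mathcal K:[-1,1]\to\mathbb R$ is a fixed kernel in the class $\mathbb K^{p,q}$, i.e. $\mathcal K$ has $q$ continuous derivatives, $\int_{-1}^1\mathcal K=1$, $\int_{-1}^1\mathcal K(x)x^k\,dx=0$ for $k=1,\dots,p$, and $\mathcal K^{(\ell)}(\pm1)=0$ for $\ell=0,\dots,q$. Constants said to depend on $q$ depend on it via $\mathcal K$. **HMM coefficient $\alpha$.** Let $\eta,\tau>0$ and let $H$ be an integer multiple of $\varepsilon$. The micro-problem is solved exactly: $w$ is the solution of $w_{tt}=(a_\varepsilon(X_{j+1/2}+x)w_x)_x$, $w(x,0)=x$, $w_t(x,0)=0$, where $X_{j+1/2}=X_j+H/2$ (considered for $x\in\mathbb R$; by finite speed of propagation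 only a bounded interval around $[-\eta,\eta]$ matters for $|t|\le\tau$). Then $$\alpha=\frac1{\eta\tau}\int_{-\tau}^{\tau}\int_{-\eta}^{\eta}\mathcal K(x/\eta)\,\mathcal K(t/\tau)\,a_\varepsilon(X_{j+1/2}+x)\,w_x(x,t)\,dx\,dt,$$ which is independent of $j$ since $H$ is an integer multiple of $\varepsilon$. **WHMM fixed point.** Let $\omega>0$, $M_t$ a positive integer such that the time step $\Delta t=\frac{2\pi}{\omega M_t}$ is stable, and $\theta=\frac{\sin(\omega\Delta t/2)}{\omega/2}$. For $\mathbf v,\mathbf b\in\mathbb R^{M_x}$ set $\mathbf w^0=\mathbf v$, $\mathbf w^1=\mathbf w^0+\frac12\theta^2(\alpha D^2\mathbf w^0-\mathbf b)$, $\mathbf w^{n+1}-2\mathbf w^n+\mathbf w^{n-1}=\theta^2(\alpha D^2\mathbf w^n-\mathbf b\cos(n\omega\Delta t))$, and $$\Pi_h\mathbf v=\frac{2}{M_t}\sum_{n=0}^{M_t-1}\Bigl(\cos\frac{2\pi n}{M_t}-\rho_0\Bigr)\mathbf w^n,\qquad \rho_0=\tfrac14-\tfrac14\tan^2\tfrac{\omega\Delta t}{2}.$$ The fixed point of WHMM for $\mathbf b$ is the vector $\mathbf v_h$ satisfying $\mathbf v_h=\Pi_h\mathbf v_h$ and $\alpha D^2\mathbf v_h+\omega^2\mathbf v_h=\mathbf b$ (the second relation determines it uniquely when $\alpha D^2+\omega^2I$ is invertible). **Eigenvalue gaps.** Let $-\lambda_j^2$ ($\lambda_j>0$, $j=1,\dots,M_x$)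 be the eigenvalues of $D^2$, and $$\delta_a=\min_j|\omega-\sqrt{\bar a}\lambda_j|,\quad \delta_\alpha=\min_j|\omega-\sqrt{\alpha}\lambda_j|,\quad \delta_0=\min_{k\in\mathbb N}\bigl|\omega-\sqrt{\bar a}\tfrac{\pi k}{L}\bigr|,\quad \delta=\min\{\delta_a,\delta_\alpha,\delta_0\},$$ where $\mathbb N=\{1,2,\dots\}$. *)

(* Defs.v *)
From HB Require Import structures.
From mathcomp Require Import all_boot all_order all_algebra.
From mathcomp Require Import all_classical all_reals all_analysis.
Set Implicit Arguments.
Unset Strict Implicit.
Unset Printing Implicit Defensive.
Import Order.TTheory GRing.Theory Num.Theory.
Import numFieldNormedType.Exports.
Local Open Scope classical_set_scope.
Local Open Scope ring_scope.

Definition homogenized_coef (R : realType) (a : R -> R) : R :=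
  (\int[@lebesgue_measure R]_(y in `[0, 1]) (a y)^-1)^-1.

(* K is a function on [-1, 1]; its values elsewhere are irrelevant. [dK l] is
   the l-th derivative, which at the end points is the one-sided one: this is
   what differentiability in the interior together with continuity up to the
   boundary of [dK l] and [dK l.+1] amounts to. *)
Record avg_kernel (R : realType) (p q : nat) (K : R -> R) : Prop := AvgKernel {
  avg_kernel_Cq : exists dK : nat -> R -> R,
    [/\ {in `[-1, 1], dK 0%N =1 K},
        forall l, (l < q)%N -> {in `]-1, 1[, forall x,
          is_derive x (1 : R) (dK l) (dK l.+1 x)},
        forall l, (l <= q)%N -> {within `[-1, 1], continuous (dK l)} &
        forall l, (l <= q)%N -> dK l (-1) = 0 /\ dK l 1 = 0];
  avg_kernel_mass : \int[@lebesgue_measure R]_(x in `[-1, 1]) K x = 1;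
  avg_kernel_moments : forall k, (1 <= k <= p)%N ->
    \int[@lebesgue_measure R]_(x in `[-1, 1]) (K x * x ^+ k) = 0 }.

Definition L2loc (R : realType) (f : R -> R) : Prop :=
  measurable_fun [set: R] f /\
  forall r, (@lebesgue_measure R).-integrable `[- r, r] (fun x => (f x ^+ 2)%:E).

(* f is the (absolutely) continuous representative of an element of
   H^1_loc(R), and df represents its weak derivative. *)
Definition H1loc (R : realType) (f df : R -> R) : Prop :=
  L2loc df /\
  forall x y, x <= y -> f y - f x = \int[@lebesgue_measure R]_(z in `[x, y]) df z.

(* The functions [F s] converge to f in L^2_loc(R) along the filter G on s. *)
Definition L2loc_cvg (R : realType) (F : R -> R -> R) (G : set_system R)
    (f : R -> R) : Prop :=
  forall r, \int[@lebesgue_measure R]_(x in `[- r, r]) ((F s x - f x) ^+ 2)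
    @[s --> G] --> (0 : R).

(* Since A is only bounded and measurable, w_tt = (A w_x)_x on R x R is meant in
   the weak (energy) sense: w is in C(R; H^1_loc) and in C^1(R; L^2_loc), with
   w_x = wx and w_t = wt, and
     d/dt \int w_t(., t) phi = - \int A w_x(., t) phi'
   for all t and all phi in H^1 with compact support. The space variable comes
   first: [w x t]. The initial data are w(x, 0) = x and w_t(x, 0) = 0. *)
Record micro_solution (R : realType) (A : R -> R) (w wx wt : R -> R -> R) : Prop :=
  MicroSolution {
  micro_H1 : forall t, H1loc (w ^~ t) (wx ^~ t);
  micro_wt_L2 : forall t, L2loc (wt ^~ t);
  micro_wx_continuous : forall t, L2loc_cvg (fun s x => wx x s) (nbhs t) (wx ^~ t);
  micro_wt_derivative : forall t,
    L2loc_cvg (fun h x => (w x (t + h) - w x t) / h) (0 : R)^' (wt ^~ t);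
  micro_wt_continuous : forall t, L2loc_cvg (fun s x => wt x s) (nbhs t) (wt ^~ t);
  micro_weak_equation : forall (phi dphi : R -> R) (r : R),
    H1loc phi dphi -> (forall x, r < `|x| -> phi x = 0) ->
    forall t, is_derive t (1 : R)
      (fun s => \int[@lebesgue_measure R]_(x in `[- r, r]) (wt x s * phi x))
      (- \int[@lebesgue_measure R]_(x in `[- r, r]) (A x * wx x t * dphi x));
  micro_init_w : forall x, w x 0 = x;
  micro_init_wt : {ae @lebesgue_measure R, forall x, wt x 0 = 0} }.

Definition mesh_size (R : realType) (L : R) (Mx : nat) : R := L / (Mx.+1)%:R.

(* x |-> a_eps(X_{j+1/2} + x), where X_{j+1/2} = j H + H / 2. *)
Definition micro_coef (R : realType) (a : R -> R) (eps H : R) (j : nat) (x : R) : R :=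
  a ((j%:R * H + H / 2 + x) / eps).

Definition hmm_flux (R : realType) (K : R -> R) (eta tau : R) (A : R -> R)
    (wx : R -> R -> R) : R :=
  (eta * tau)^-1 *
  \int[@lebesgue_measure R]_(t in `[- tau, tau])
    (\int[@lebesgue_measure R]_(x in `[- eta, eta])
       (K (x / eta) * K (t / tau) * A x * wx x t)).

Definition D2 (R : realType) (Mx : nat) (H : R) : 'M[R]_Mx :=
  \matrix_(i < Mx, j < Mx)
    (((j == i.+1 :> nat)%:R - 2 * (j == i)%:R + (j.+1 == i :> nat)%:R) / H ^+ 2).

Definition normH (R : realType) (Mx : nat) (H : R) (f : 'cV[R]_Mx) : R :=
  Num.sqrt (\sum_(i < Mx) H * f i 0 ^+ 2).

Definition time_step (R : realType) (omega : R) (Mt : nat) : R :=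
  2 * pi / (omega * Mt%:R).

Definition theta (R : realType) (omega : R) (Mt : nat) : R :=
  sin (omega * time_step omega Mt / 2) / (omega / 2).

Fixpoint whmm_wave (R : realType) (Mx : nat) (H omega : R) (Mt : nat) (alpha : R)
    (b v : 'cV[R]_Mx) (n : nat) {struct n} : 'cV[R]_Mx :=
  match n with
  | 0 => v
  | n1.+1 =>
    match n1 with
    | 0 => v + (2^-1 * theta omega Mt ^+ 2) *: (alpha *: (D2 Mx H *m v) - b)
    | n2.+1 =>
      let w1 := whmm_wave H omega Mt alpha b v n1 in
      let w0 := whmm_wave H omega Mt alpha b v n2 in
      2 *: w1 - w0 + theta omega Mt ^+ 2 *:
        (alpha *: (D2 Mx H *m w1) - cos (n1%:R * omega * time_step omega Mt) *: b)
    end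
  end.

Definition rho0 (R : realType) (omega : R) (Mt : nat) : R :=
  4^-1 - 4^-1 * tan (omega * time_step omega Mt / 2) ^+ 2.

Definition Pi_h (R : realType) (Mx : nat) (H omega : R) (Mt : nat) (alpha : R)
    (b v : 'cV[R]_Mx) : 'cV[R]_Mx :=
  (2 / Mt%:R) *: \sum_(0 <= n < Mt)
    (cos (2 * pi * n%:R / Mt%:R) - rho0 omega Mt) *:
      whmm_wave H omega Mt alpha b v n.

(* All solutions of the unforced scheme stay bounded. *)
Definition stable_time_step (R : realType) (Mx : nat) (H omega : R) (Mt : nat)
    (alpha : R) : Prop :=
  forall w : nat -> 'cV[R]_Mx,
    (forall n, w n.+2 - 2 *: w n.+1 + w n =
       theta omega Mt ^+ 2 *: (alpha *: (D2 Mx H *m w n.+1))) ->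
    exists B : R, forall n, normH H (w n) <= B.

Definition discrete_helmholtz (R : realType) (Mx : nat) (H omega c : R)
    (b u : 'cV[R]_Mx) : Prop :=
  c *: (D2 Mx H *m u) + omega ^+ 2 *: u = b.

Definition whmm_fixed_point (R : realType) (Mx : nat) (H omega : R) (Mt : nat)
    (alpha : R) (b v : 'cV[R]_Mx) : Prop :=
  v = Pi_h H omega Mt alpha b v /\ discrete_helmholtz H omega alpha b v.

(* The infima below are minima: the spectrum of D2 is finite and nonempty (for
   0 < Mx), and the distances in [gap_continuous] tend to infinity with k. *)
Definition discrete_frequencies (R : realType) (Mx : nat) (H : R) : set R :=
  [set l | 0 < l /\ eigenvalue (D2 Mx H) (- l ^+ 2)].

Definition gap_discrete (R : realType) (Mx : nat) (H omega c : R) : R :=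
  inf [set `|omega - Num.sqrt c * l| | l in discrete_frequencies Mx H].

Definition gap_continuous (R : realType) (L omega c : R) : R :=
  inf [set `|omega - Num.sqrt c * (pi * k%:R / L)| | k in [set k : nat | (1 <= k)%N]].

Definition gap (R : realType) (Mx : nat) (L omega abar alpha : R) : R :=
  let H := mesh_size L Mx in
  Num.min (gap_discrete Mx H omega abar)
    (Num.min (gap_discrete Mx H omega alpha) (gap_continuous L omega abar)).

(* Main.v *)
(* The flux error is an average, against the kernel in x and in t, of
   sigma = A w_x - abar. Together with w_t, sigma solves a first-order wave
   system whose initial data (0, a_eps - abar) are eps-periodic with zero
   (1/a_eps-weighted) mean. Hence the data are n-th space-time derivatives of
   eps-periodic functions of size eps^n, and sigma is the q-th time derivative
   of a solution whose initial data have size eps^q. Integrating by parts q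
   times in t moves these derivatives onto the kernel, at the price of eta^-q,
   and the remaining moment is bounded by the energy in a backward cone of
   dependence; this gives |abar - alpha| <= C (eps / eta)^q. For q = 0 the
   hypothesis |abar - alpha| <= abar / 2 is already such a bound.

   The two Helmholtz problems are diagonal in the sine basis. On a mode with
   frequency l, u - v = (abar - alpha) l^2 u / (omega^2 - alpha l^2), and
   |omega^2 - c l^2| >= delta (omega + sqrt c l) yields the three estimates
   mode by mode. *)
Require Import Defs.
From mathcomp Require Import all_boot all_order all_algebra.
From mathcomp Require Import all_classical all_reals all_analysis.
From mathcomp Require Import measurable_realfun ring lra.
Set Implicit Arguments.
Unset Strict Implicit.
Unset Printing Implicit Defensive.
Import Order.TTheory GRing.Theory Num.Theory.
Import numFieldNormedType.Exports.
Local Open Scope classical_set_scope.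
Local Open Scope ring_scope.

(** * The oriented integral *)

(** The obstacle is regularity. The flux sigma is only L^2 in space, continuous in time with values
    in L^2_loc, so neither it nor the first primitives, which are merely continuous, admit an energy
    identity as they stand. The proof therefore works with primitives throughout.
    [micro_displacement] and [micro_momentum] are jointly continuous and satisfy the system in
    integrated form; each further time primitive gains a classical time derivative, so from the
    second level on the energy argument is elementary calculus. A time primitive is also a space
    primitive of the other component, up to a function of x, which the periodic primitives of the
    data supply. This exchange is what makes the initial values of level n of size eps^n. With a
    single kernel derivative the last moment involves only the first primitives, which the energy
    argument does not reach. Hence the last moment is always bounded through small time differences
    of the next level. *)

Section oriented_integral.
Context {R : realType}.
Notation mu := (@lebesgue_measure R).
Implicit Types (f g : R -> R) (x y z t : R).

Definition locint f := forall x y, mu.-integrable `[x, y] (EFin \o f).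

(** At most one of the two terms is nonzero, so this is the signed integral from [x] to [y].
    Increment identities such as [F y - F x = oint f x y] then hold for end points in any order. *)
Definition oint f x y : R :=
  \int[mu]_(z in `[x, y]) f z - \int[mu]_(z in `[y, x]) f z.

Lemma Rintegral_ge f x y : y <= x -> \int[mu]_(z in `[x, y]) f z = 0.
Proof.
rewrite le_eqVlt => /predU1P[->|yx]; first by rewrite set_itv1 Rintegral_set1.
by rewrite set_itv_ge ?Rintegral_set0// bnd_simp -ltNge.
Qed.

Lemma oint_le f x y : x <= y -> oint f x y = \int[mu]_(z in `[x, y]) f z.
Proof. by move=> xy; rewrite /oint (Rintegral_ge f xy) subr0. Qed.

Lemma ointC f x y : oint f y x = - oint f x y.
Proof. by rewrite /oint opprB. Qed.

Lemma oint_xx f x : oint f x x = 0.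
Proof. by rewrite /oint subrr. Qed.

Lemma eq_oint f g x y : f =1 g -> oint f x y = oint g x y.
Proof. by move=> /funext ->. Qed.

Lemma eq_oint_in f g x y : x <= y -> (forall z, x <= z <= y -> f z = g z) ->
  oint f x y = oint g x y.
Proof.
move=> xy fg; rewrite !oint_le//; apply: eq_Rintegral => z.
by rewrite inE/= in_itv/= => /fg.
Qed.

Let oint_cat_le f x y z : locint f -> x <= y -> y <= z ->
  oint f x z = oint f x y + oint f y z.
Proof.
move=> lf xy yz; rewrite !oint_le ?(le_trans xy)//.
have /= := @Rintegral_itvB R f (BLeft x) (BRight z) y (lf x z).
rewrite !bnd_simp => /(_ xy yz) h.
rewrite -[X in _ = _ + X]Rintegral_itv_obnd_cbnd; last first.
  by apply: integrableS (lf y z) => //; apply: subset_itvr; rewrite bnd_simp.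
by rewrite -h addrC subrK.
Qed.

Lemma oint_cat f x y z : locint f -> oint f x y + oint f y z = oint f x z.
Proof.
move=> lf.
have H a b c : a <= b -> b <= c -> oint f a c = oint f a b + oint f b c.
  exact: oint_cat_le.
have [xy|/ltW yx] := leP x y; have [yz|/ltW zy] := leP y z;
  have [xz|/ltW zx] := leP x z.
- by rewrite (H x y z).
- have -> : z = x by apply/eqP; rewrite eq_le zx (le_trans xy yz).
  by rewrite oint_xx (ointC f x y) subrr.
- by rewrite (H x z y)// (ointC f z y) addrK.
- by rewrite (ointC f z y) (H z x y)// opprD addrCA subrr addr0 -ointC.
- by rewrite (H y x z)// (ointC f y x) addKr.
- rewrite (ointC f z x) (ointC f y x); have := H y z x yz zx; lra.
- have -> : z = x by apply/eqP; rewrite eq_le (le_trans zy yx).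
  by rewrite oint_xx (ointC f x y) subrr.
- rewrite (ointC f z x) (ointC f y x) (ointC f z y); have := H z y x zy yx; lra.
Qed.

Lemma locintD f g : locint f -> locint g -> locint (fun z => f z + g z).
Proof. by move=> lf lg x y; exact: (integrableD _ (lf x y) (lg x y)). Qed.

Lemma locintB f g : locint f -> locint g -> locint (fun z => f z - g z).
Proof. by move=> lf lg x y; exact: (integrableB _ (lf x y) (lg x y)). Qed.

Lemma locintZ (c : R) f : locint f -> locint (fun z => c * f z).
Proof. by move=> lf x y; exact: (integrableZl _ c (lf x y)). Qed.

Lemma ointD f g x y : locint f -> locint g ->
  oint (fun z => f z + g z) x y = oint f x y + oint g x y.
Proof. by move=> lf lg; rewrite /oint !RintegralD//; [ring|exact: lf..]. Qed.

Lemma ointB f g x y : locint f -> locint g ->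
  oint (fun z => f z - g z) x y = oint f x y - oint g x y.
Proof. by move=> lf lg; rewrite /oint !RintegralB//; [ring|exact: lf..]. Qed.

Lemma ointZ (c : R) f x y : locint f ->
  oint (fun z => c * f z) x y = c * oint f x y.
Proof. by move=> lf; rewrite /oint !RintegralZl//; [ring|exact: lf..]. Qed.

Lemma locint_measurable f : locint f -> measurable_fun [set: R] f.
Proof.
move=> lf; rewrite -(bigcup_itvT true false).
apply/measurable_fun_bigcup => // n.
by have /measurable_int/measurable_EFinP := lf (- n%:R) n%:R.
Qed.

Lemma continuous_locint f : continuous f -> locint f.
Proof.
move=> cf x y; apply: continuous_compact_integrable; first exact: segment_compact.
exact: continuous_subspaceT.
Qed.

Lemma locint_cst (c : R) : locint (fun=> c).
Proof. by apply: continuous_locint => x; exact: cvg_cst. Qed.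

Lemma oint_cst (c : R) x y : oint (fun=> c) x y = c * (y - x).
Proof.
have H a b : a <= b -> oint (fun=> c) a b = c * (b - a).
  move=> ab; rewrite oint_le// Rintegral_cst//= lebesgue_measure_itv/= lte_fin.
  by move: ab; rewrite le_eqVlt => /predU1P[->|->]//=; rewrite ltxx subrr.
have [/H//|/ltW/H h] := leP x y.
by rewrite ointC h -mulrN opprB.
Qed.

Lemma locintM f g (M : R) : locint f -> measurable_fun [set: R] g ->
  (forall z, `|g z| <= M) -> locint (fun z => g z * f z).
Proof.
move=> lf mg gM x y.
have M0 : 0 <= M by apply: le_trans (gM 0).
apply: (@le_integrable _ _ _ mu _ _ _ (fun z => (M * `|f z|)%:E)) => //.
- apply/measurable_EFinP/measurable_funM; first exact: measurable_funS mg.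
  exact: (measurable_funS _ _ (locint_measurable lf)).
- move=> z _ /=; rewrite lee_fin normrM (ger0_norm (mulr_ge0 _ _))//.
  by rewrite ler_wpM2r.
- exact: (integrableZl _ M (integrable_norm (lf x y))).
Qed.

Lemma bounded_locint g (M : R) : measurable_fun [set: R] g ->
  (forall z, `|g z| <= M) -> locint g.
Proof.
move=> mg gM; have := locintM (locint_cst 1) mg gM.
by under eq_fun do rewrite mulr1.
Qed.

Lemma locint_norm f : locint f -> locint (fun z => `|f z|).
Proof. by move=> lf x y; exact: (integrable_norm (lf x y)). Qed.

Lemma le_oint f g x y : locint f -> locint g -> x <= y ->
  (forall z, x <= z <= y -> f z <= g z) -> oint f x y <= oint g x y.
Proof.
move=> lf lg xy fg; rewrite !oint_le//; exact: le_Rintegral.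
Qed.

Lemma oint_ge0 f x y : x <= y -> (forall z, x <= z <= y -> 0 <= f z) ->
  0 <= oint f x y.
Proof.
move=> xy f0; rewrite oint_le//; apply: Rintegral_ge0 => z.
by rewrite /= in_itv/= => /f0.
Qed.

Lemma norm_oint f x y : locint f -> x <= y ->
  `|oint f x y| <= oint (fun z => `|f z|) x y.
Proof. by move=> lf xy; rewrite !oint_le//; apply: le_normr_Rintegral => //; exact: lf. Qed.

Lemma norm_oint_bound f x y (M : R) : locint f ->
  (forall z, (x <= z <= y) || (y <= z <= x) -> `|f z| <= M) ->
  `|oint f x y| <= M * `|y - x|.
Proof.
move=> lf.
have H a b : a <= b -> (forall z, a <= z <= b -> `|f z| <= M) ->
    `|oint f a b| <= M * `|b - a|.
  move=> ab fM; rewrite (le_trans (norm_oint lf ab))//.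
  rewrite (ger0_norm (_ : 0 <= b - a)) ?subr_ge0// -oint_cst.
  by apply: le_oint => //; [exact: locint_norm|exact: locint_cst].
move=> fM; have [xy|/ltW yx] := leP x y.
  by apply: H => // z h; apply: fM; rewrite h.
by rewrite (distrC y x) ointC normrN; apply: H => // z h; apply: fM; rewrite h orbT.
Qed.

(** Additivity moves the base point to [y - 1], left of every point near [y], where the signed
    integral is an ordinary one. *)
Lemma oint_continuous f x : locint f -> continuous (oint f x).
Proof.
move=> lf y.
pose a := y - 1; pose b := y + 1.
have ay : a < y by rewrite /a; lra.
have yb : y < b by rewrite /b; lra.
have /(continuous_within_itvP _ (lt_trans ay yb)) [+ _ _] :
    {within `[a, b], continuous (fun x => parameterized_integral mu a x f)}.
  by apply: parameterized_integral_continuous; [exact/ltW/(lt_trans ay)|exact: lf].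
move=> /(_ y); rewrite in_itv/= ay yb => /(_ isT) cy.
have -> : oint f x = fun z => oint f x a + oint f a z.
  by apply/funext => z; rewrite oint_cat.
apply: cvgD; first exact: cvg_cst.
rewrite (oint_le _ (ltW ay)).
apply: cvg_trans cy; apply: near_eq_cvg; near=> z.
by rewrite oint_le// ltW//; near: z; exact: (cvgr_gt y cvg_id _ ay).
Unshelve. all: by end_near. Qed.

Lemma oint_is_derive f x y : continuous f ->
  is_derive y (1 : R) (oint f x) (f y).
Proof.
move=> cf; have lf := continuous_locint cf.
pose a := y - 1; pose b := y + 1.
have ay : a < y by rewrite /a; lra.
have yb : y < b by rewrite /b; lra.
have [dF F'] := continuous_FTC1_closed yb (lf a b) ay (cf y).
have h : is_derive y (1 : R) (fun z => \int[mu]_(t in `[a, z]) f t) (f y).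
  by apply: DeriveDef; [exact: dF|rewrite -derive1E].
have -> : oint f x = cst (oint f x a) + oint f a.
  by apply/funext => z; rewrite !fctE/= (oint_cat x a z lf).
rewrite -[f y]add0r; apply: is_deriveD.
apply: (near_eq_is_derive _ h).
by near=> z; rewrite oint_le// ltW//; near: z; exact: (cvgr_gt y cvg_id _ ay).
Unshelve. all: by end_near. Qed.

Lemma oint_FTC2 (F f : R -> R) x y : continuous f ->
  (forall z, is_derive z (1 : R) F (f z)) -> F y - F x = oint f x y.
Proof.
move=> cf dF.
have h z : is_derive z (1 : R) (F - oint f x) 0.
  rewrite -(subrr (f z)); apply: is_deriveB; exact: oint_is_derive.
have := is_derive_0_is_cst x y h.
rewrite /= !fctE oint_xx subr0 => ->; ring.
Qed.

End oriented_integral.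

Section epsilon_delta.
Context {R : realType}.
Implicit Types (f : R -> R) (x t l : R).

Lemma continuous_atE f x : {for x, continuous f} <->
  forall e : R, 0 < e -> exists2 d : R, 0 < d & forall y, `|y - x| < d -> `|f y - f x| < e.
Proof.
split=> [/cvgrPdist_lt h e /h|h].
  case=> d /= d0 H; exists d => // y yx; rewrite distrC; apply: H.
  by rewrite /ball_/= distrC.
apply/cvgrPdist_lt => e /h[d d0 H]; exists d => //= y /=.
by rewrite distrC => /H; rewrite distrC.
Qed.

(** The increment form has no division and admits [s = t], so a claim about a derivative becomes an
    estimate of integrals. *)
Lemma is_deriveP f t l : is_derive t (1 : R) f l <->
  forall e : R, 0 < e -> exists2 d : R, 0 < d &
    forall s, `|s - t| < d -> `|f s - f t - (s - t) * l| <= e * `|s - t|.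
Proof.
split=> [[df dl] e e0|H].
  have : (fun h => h^-1 *: (f (h *: (1:R) + t) - f t)) @ (0:R)^' --> l.
    by rewrite -dl; exact: df.
  move=> /cvgrPdist_le/(_ e e0)[d /= d0 h]; exists d => // s sd.
  have [->|st] := eqVneq s t; first by rewrite !subrr mul0r subrr normr0 mulr0.
  have st0 : s - t != 0 by rewrite subr_eq0.
  have := h (s - t); rewrite /= sub0r normrN => /(_ sd st0).
  rewrite /= /GRing.scale/= mulr1 subrK => H.
  have -> : f s - f t - (s - t) * l = - ((s - t) * (l - (s - t)^-1 * (f s - f t))).
    by rewrite mulrBr mulrA divff// mul1r; ring.
  by rewrite normrN normrM mulrC ler_wpM2r.
have lim : (fun h => h^-1 *: (f (h *: (1:R) + t) - f t)) @ (0:R)^' --> l.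
  apply/cvgrPdist_le => e e0; have [d d0 h] := H e e0.
  exists d => //= u /=; rewrite sub0r normrN => ud u0.
  have := h (u + t); rewrite addrK => /(_ ud) {}h.
  rewrite /GRing.scale/= mulr1 -(ler_pM2l (_ : 0 < `|u|)) ?normr_gt0//.
  rewrite -normrM mulrBr mulrA divff// mul1r distrC (mulrC _ e).
  by move: h; congr (_ <= _); congr (`| _ |); ring.
apply: DeriveDef; first by apply/cvg_ex; exists l.
exact: cvg_lim lim.
Qed.

End epsilon_delta.

(** * Integrals depending on a parameter *)

Section joint_continuity.
Context {R : realType}.
Implicit Types (f g w : R -> R) (F G Phi : R -> R -> R) (x y z t s e d M : R).

Definition jcont F := continuous (fun p : R * R => F p.1 p.2).

Lemma jcontP F : jcont F <-> forall x t e, 0 < e ->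
  exists2 d : R, 0 < d & forall y s, `|y - x| < d -> `|s - t| < d ->
    `|F y s - F x t| < e.
Proof.
split=> [cF x t e e0|H [x t]].
  have /cvgrPdist_lt/(_ e e0)[[U V]/= [[d1 /= d10 H1] [d2 /= d20 H2]] UV] := cF (x, t).
  exists (Num.min d1 d2); first by rewrite lt_min d10.
  move=> y s; rewrite !lt_min => /andP[yx _] /andP[_ st].
  rewrite distrC; apply: (UV (y, s)); split => /=.
  - by apply: H1; rewrite /ball_/= distrC.
  - by apply: H2; rewrite /ball_/= distrC.
apply/cvgrPdist_lt => e /(H x t)[d d0 h].
exists (ball x d, ball t d); first by split; exact: nbhsx_ballx.
move=> [y s] /= [yx st]; rewrite distrC; apply: h.
- by rewrite distrC.
- by rewrite distrC.
Qed.

Lemma jcont_r F x : jcont F -> continuous (F x).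
Proof.
move=> /jcontP cF t; apply/continuous_atE => e /(cF x t)[d d0 h].
by exists d => // s st; apply: h => //; rewrite subrr normr0.
Qed.

Lemma jcont_swap F : jcont F -> jcont (fun x t => F t x).
Proof.
move=> /jcontP cF; apply/jcontP => x t e /(cF t x)[d d0 h].
by exists d => // y s *; exact: h.
Qed.

Lemma jcont_l F t : jcont F -> continuous (F^~ t).
Proof. by move=> /jcont_swap /jcont_r; exact. Qed.

Lemma jcontD F G : jcont F -> jcont G -> jcont (fun x t => F x t + G x t).
Proof. by move=> cF cG p; apply: cvgD; [exact: cF|exact: cG]. Qed.

Lemma jcontB F G : jcont F -> jcont G -> jcont (fun x t => F x t - G x t).
Proof. by move=> cF cG p; apply: cvgB; [exact: cF|exact: cG]. Qed.

Lemma jcontM F G : jcont F -> jcont G -> jcont (fun x t => F x t * G x t).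
Proof. by move=> cF cG p; apply: cvgM; [exact: cF|exact: cG]. Qed.

Lemma jcont_fst f : continuous f -> jcont (fun x _ => f x).
Proof. by move=> cf p; apply: continuous_comp; [exact: cvg_fst|exact: cf]. Qed.

Lemma jcont_snd f : continuous f -> jcont (fun _ t => f t).
Proof. by move=> /jcont_fst/jcont_swap. Qed.

Lemma jcont_comp F f g : continuous f -> continuous g -> jcont F ->
  jcont (fun x t => F (f x) (g t)).
Proof.
move=> cf cg /jcontP cF; apply/jcontP => x t e /(cF (f x) (g t))[d d0 h].
have /continuous_atE/(_ d d0)[d1 d10 h1] := cf x.
have /continuous_atE/(_ d d0)[d2 d20 h2] := cg t.
exists (Num.min d1 d2); first by rewrite lt_min d10.
move=> y s; rewrite !lt_min => /andP[yx _] /andP[_ st].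
by apply: h; [exact: h1|exact: h2].
Qed.

(** Compactness of [[x, y]], in its near-covering form, makes continuity in time uniform in
    space. *)
Lemma tube F x y t e : jcont F -> 0 < e -> exists2 d : R, 0 < d &
  forall z s, x <= z <= y -> `|s - t| < d -> `|F z s - F z t| <= e.
Proof.
move=> /jcontP cF e0.
have := @segment_compact R x y; rewrite compact_near_coveringP.
move=> /(_ R (nbhs t) (fun s z => `|F z s - F z t| <= e) _).
have loc (z : R) : `[x, y]%classic z ->
    \forall z' \near z & s \near nbhs t, `|F z' s - F z' t| <= e.
  move=> zxy.
  have e2 : 0 < e / 2 by rewrite divr_gt0.
  have [d d0 h] := cF z t _ e2.
  exists (ball z d, ball t d); first by split; exact: nbhsx_ballx.
  move=> [z' s] /= [zz' ts].
  have h1 : `|F z' s - F z t| < e / 2 by apply: h; rewrite distrC.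
  have h2 : `|F z' t - F z t| < e / 2.
    by apply: h; [rewrite distrC|rewrite subrr normr0].
  rewrite (_ : F z' s - F z' t = (F z' s - F z t) - (F z' t - F z t)); last by ring.
  by rewrite (le_trans (ler_normB _ _))//; lra.
move=> /(_ loc)[d /= d0 H].
exists d => // z s zxy st; apply: (H s); last by rewrite /= in_itv.
by rewrite /ball_/= distrC.
Qed.

Lemma continuous_bounded f x y : continuous f ->
  exists2 M : R, 0 <= M & forall z, x <= z <= y -> `|f z| <= M.
Proof.
move=> cf; have [xy|yx] := leP x y; last first.
  by exists 0 => // z /andP[xz zy]; have := le_lt_trans (le_trans xz zy) yx; rewrite ltxx.
have cn : {within `[x, y], continuous (fun z => `|f z|)}.
  apply: continuous_subspaceT => z; apply: cvg_norm; exact: cf.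
have [c _ H] := EVT_max xy cn.
by exists `|f c| => // z zxy; apply: H; rewrite in_itv.
Qed.

Lemma between_dist t u s : (t <= u <= s) || (s <= u <= t) -> `|u - t| <= `|s - t|.
Proof.
case/orP => /andP[h1 h2].
  by rewrite !ger0_norm ?subr_ge0 ?(le_trans h1)// lerD2r.
by rewrite !ler0_norm ?subr_le0 ?(le_trans h1)// lerN2 lerD2r.
Qed.

Lemma locint_continuousM f g : locint f -> continuous g -> locint (fun z => f z * g z).
Proof.
move=> lf cg x y; have [M M0 gM] := continuous_bounded x y cg.
apply: (@le_integrable _ _ _ lebesgue_measure _ _ _ (fun z => (M * `|f z|)%:E)) => //.
- apply/measurable_EFinP/measurable_funM.
    exact: (measurable_funS _ _ (locint_measurable lf)).
  apply: measurable_funTS; exact: continuous_measurable_fun.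
- move=> z zxy /=; rewrite lee_fin normrM (ger0_norm (mulr_ge0 _ _))// mulrC.
  by rewrite ler_wpM2r// gM//; move: zxy; rewrite /= in_itv.
- exact: (integrableZl _ M (integrable_norm (lf x y))).
Qed.

Lemma oint_near w f g x y M : locint w -> continuous f -> continuous g -> x <= y ->
  (forall z, x <= z <= y -> `|f z - g z| <= M) ->
  `|oint (fun z => w z * f z) x y - oint (fun z => w z * g z) x y|
    <= M * oint (fun z => `|w z|) x y.
Proof.
move=> lw cf cg xy fg.
have lf := locint_continuousM lw cf; have lg := locint_continuousM lw cg.
rewrite -ointB// (le_trans (norm_oint (locintB lf lg) xy))//.
have lN := locint_norm lw.
rewrite -ointZ//; apply: le_oint => //.
- exact/locint_norm/locintB.
- exact: locintZ.
- move=> z zxy; rewrite -mulrBr normrM mulrC ler_wpM2r//; exact: fg.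
Qed.

Let oint_continuous_le w F x y : locint w -> jcont F -> x <= y ->
  continuous (fun t => oint (fun z => w z * F z t) x y).
Proof.
move=> lw cF xy t; apply/continuous_atE => e e0.
set W := oint (fun z => `|w z|) x y.
have W0 : 0 <= W by apply: oint_ge0.
have W1 : 0 < W + 1 by rewrite ltr_wpDl.
have [d d0 h] := tube x y t cF (divr_gt0 e0 W1).
exists d => // s st.
have := @oint_near w (F^~ s) (F^~ t) x y _ lw (jcont_l cF) (jcont_l cF) xy
  (fun z zxy => h z s zxy st).
move=> /le_lt_trans; apply; rewrite -/W -mulrA gtr_pMr// mulrC.
by rewrite ltr_pdivrMr// mul1r ltrDl.
Qed.

Lemma oint_jcont w F x y : locint w -> jcont F ->
  continuous (fun t => oint (fun z => w z * F z t) x y).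
Proof.
move=> lw cF; have [xy|/ltW yx] := leP x y; first exact: oint_continuous_le.
under eq_fun do rewrite ointC.
by move=> t; apply: cvgN; exact: oint_continuous_le.
Qed.

(** The remainder [Phi z s - Phi z t - (s - t) * F z t] is the integral of [F z u - F z t] for [u]
    between [t] and [s]; [tube] makes it small uniformly in [z]. *)
Lemma is_derive_oint_jcont w Phi F x y t : locint w -> jcont Phi -> jcont F ->
  (forall z s, is_derive s (1 : R) (Phi z) (F z s)) ->
  is_derive t (1 : R) (fun t => oint (fun z => w z * Phi z t) x y)
    (oint (fun z => w z * F z t) x y).
Proof.
move=> lw cP cF dP.
wlog xy : x y / x <= y.
  move=> H; have [xy|/ltW yx] := leP x y; first exact: H.
  rewrite (ointC _ y x); under eq_fun do rewrite (ointC _ y x).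
  by apply: is_deriveN; exact: H.
apply/is_deriveP => e e0.
set W := oint (fun z => `|w z|) x y.
have W0 : 0 <= W by apply: oint_ge0.
have W1 : 0 < W + 1 by rewrite ltr_wpDl.
have [d d0 h] := tube x y t cF (divr_gt0 e0 W1).
exists d => // s st.
have cPs r : continuous (Phi^~ r) := jcont_l cP.
have cFs r : continuous (F^~ r) := jcont_l cF.
have lP r : locint (fun z => w z * Phi z r) by exact: locint_continuousM.
have lF r : locint (fun z => w z * F z r) by exact: locint_continuousM.
have key : forall z, x <= z <= y ->
    `|(Phi z s - Phi z t) - (s - t) * F z t| <= e / (W + 1) * `|s - t|.
  move=> z zxy.
  have cFz : continuous (F z) := jcont_r cF.
  rewrite (oint_FTC2 t s cFz (dP z)) mulrC -(oint_cst (F z t) t s).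
  have lFz := continuous_locint cFz.
  rewrite -ointB//; last exact: locint_cst.
  apply: norm_oint_bound; first by apply: locintB => //; exact: locint_cst.
  move=> u u_; apply: h => //; apply: le_lt_trans st.
  exact: between_dist.
rewrite -ointB// -ointZ//.
have -> : oint (fun z => w z * Phi z s - w z * Phi z t) x y =
    oint (fun z => w z * (Phi z s - Phi z t)) x y.
  by apply: eq_oint => z; rewrite mulrBr.
have -> : oint (fun z => (s - t) * (w z * F z t)) x y =
    oint (fun z => w z * ((s - t) * F z t)) x y.
  by apply: eq_oint => z; rewrite mulrCA.
apply: le_trans (oint_near lw _ _ xy key) _.
- by move=> z; apply: cvgB; exact: cPs.
- by move=> z; apply: cvgM; [exact: cvg_cst|exact: cFs].
rewrite -/W mulrAC ler_wpM2r// -mulrA ler_piMr//; first exact: ltW.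
by rewrite mulrC ler_pdivrMr// mul1r lerDl.
Qed.

Lemma jcont_oint F : jcont F -> jcont (fun x t => oint (F x) 0 t).
Proof.
move=> cF; apply/jcontP => x t e e0.
have e2 : 0 < e / 2 by rewrite divr_gt0.
have cFl z : continuous (F z) := jcont_r cF.
have lF z : locint (F z) := continuous_locint (cFl z).
have /continuous_atE/(_ _ e2)[d1 d10 h1] :
    {for x, continuous (fun x => oint (fun z => 1 * F x z) 0 t)}.
  by have := @oint_jcont (fun=> 1) (fun x t => F t x) 0 t (locint_cst 1) (jcont_swap cF); exact.
have /jcontP/(_ x t 1 ltr01)[d2 d20 h2] := cF.
pose M : R := `|F x t| + 1.
have M0 : 0 < M by rewrite ltr_wpDl.
exists (Num.min d1 (Num.min d2 (e / 2 / M))).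
  by rewrite !lt_min d10 d20 !divr_gt0.
move=> y s; rewrite !lt_min => /and3P[yx1 yx2 _] /and3P[_ st2 st3].
rewrite -(oint_cat 0 t s (lF y)).
have h3 : `|oint (F y) t s| <= M * `|s - t|.
  apply: norm_oint_bound => // u u_.
  have ut : `|u - t| < d2.
    apply: le_lt_trans st2.
    exact: between_dist.
  have := h2 y u yx2 ut => /ltW hh.
  by rewrite -(subrK (F x t) (F y u)) (le_trans (ler_normD _ _))// addrC lerD2l.
have h4 : M * `|s - t| < e / 2 by rewrite mulrC -ltr_pdivlMr.
have := h1 y yx1.
have e1 z : oint (fun u => 1 * F z u) 0 t = oint (F z) 0 t.
  by apply: eq_oint => u; rewrite mul1r.
rewrite !e1.
move=> h5.
rewrite addrAC (le_lt_trans (ler_normD _ _))//; lra.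
Qed.

(* Fubini without product measures: both sides vanish at [t = 0] and have the
   same derivative in [t]. *)
Lemma oint_swap w F x y t : locint w -> jcont F ->
  oint (fun s => oint (fun z => w z * F z s) x y) 0 t =
  oint (fun z => w z * oint (F z) 0 t) x y.
Proof.
move=> lw cF.
have c1 : continuous (fun s => oint (fun z => w z * F z s) x y) by exact: oint_jcont.
have d1 s : is_derive s (1 : R) (fun s => oint (fun z => w z * oint (F z) 0 s) x y)
    (oint (fun z => w z * F z s) x y).
  apply: is_derive_oint_jcont => //; first exact: jcont_oint.
  by move=> z r; apply: oint_is_derive; exact: jcont_r.
rewrite -(oint_FTC2 0 t c1 d1) [X in _ - X](_ : _ = 0) ?subr0//.
rewrite (eq_oint (g := fun=> 0)) ?oint_cst ?mul0r//.
by move=> z; rewrite oint_xx mulr0.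
Qed.

End joint_continuity.

(** * Products of functions given as integrals *)

Section product_rule.
Context {R : realType}.
Implicit Types (f g h : R -> R) (x y z t s e d M : R).

Definition locbnd f := forall x y, exists M : R, forall z, x <= z <= y -> `|f z| <= M.

Lemma continuous_locbnd f : continuous f -> locbnd f.
Proof. by move=> cf x y; have [M _ h] := continuous_bounded x y cf; exists M. Qed.

Lemma locbndM f g : locbnd f -> locbnd g -> locbnd (fun z => f z * g z).
Proof.
move=> bf bg x y; have [M1 h1] := bf x y; have [M2 h2] := bg x y.
exists (M1 * M2) => z zxy; rewrite normrM.
by apply: ler_pM => //; [exact: h1|exact: h2].
Qed.

Lemma norm_oint_prod g h x y M : locint g -> continuous h ->
  (forall z, (x <= z <= y) || (y <= z <= x) -> `|h z| <= M) ->
  `|oint (fun z => g z * h z) x y| <= M * `|oint (fun z => `|g z|) x y|.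
Proof.
move=> lg ch.
have H a b : a <= b -> (forall z, a <= z <= b -> `|h z| <= M) ->
    `|oint (fun z => g z * h z) a b| <= M * `|oint (fun z => `|g z|) a b|.
  move=> ab hM; have c0 : continuous (fun _ : R => 0 : R) by move=> z; exact: cvg_cst.
  have := @oint_near _ g h (fun=> 0) a b M lg ch c0 ab.
  rewrite (ger0_norm (x := oint (fun z => `|g z|) a b)); last by apply: oint_ge0.
  rewrite [X in `|_ - X|](_ : _ = 0) ?subr0; first apply.
    by move=> z zab; rewrite subr0; exact: hM.
  rewrite (eq_oint (g := fun=> 0)) ?oint_cst ?mul0r//.
  by move=> z; rewrite mulr0.
move=> hM; have [xy|/ltW yx] := leP x y.
  by apply: H => // z zxy; apply: hM; rewrite zxy.
rewrite (ointC _ y x) (ointC (fun z => `|g z|) y x) !normrN.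
by apply: H => // z zxy; apply: hM; rewrite zxy orbT.
Qed.

Lemma primitive_continuous (F f : R -> R) : locint f ->
  (forall x y, F y - F x = oint f x y) -> continuous F.
Proof.
move=> lf hF x.
have -> : F = fun y => F x + oint f x y.
  by apply/funext => y; rewrite -hF addrC subrK.
by apply: cvgD; [exact: cvg_cst|exact: oint_continuous].
Qed.

(* The difference of both sides is o(|y - x|), hence has derivative zero. *)
Lemma oint_product_rule (F G f g : R -> R) x y :
  locint f -> locbnd f -> locint g ->
  (forall x y, F y - F x = oint f x y) ->
  (forall x y, G y - G x = oint g x y) ->
  F y * G y - F x * G x = oint (fun z => f z * G z + g z * F z) x y.
Proof.
move=> lf bf lg hF hG.
have cF := primitive_continuous lf hF; have cG := primitive_continuous lg hG.
have lfG : locint (fun z => f z * G z) by exact: locint_continuousM.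
have lgF : locint (fun z => g z * F z) by exact: locint_continuousM.
have l2 : locint (fun z => f z * G z + g z * F z) by exact: locintD.
pose Phi := fun s => F s * G s - oint (fun z => f z * G z + g z * F z) x s.
suff dPhi t : is_derive t (1 : R) Phi 0.
  have := is_derive_0_is_cst x y dPhi.
  by rewrite /Phi oint_xx subr0 => ->; ring.
apply/is_deriveP => e e0.
have [M fM] := bf (t - 1) (t + 1).
have M0 : 0 <= M by apply: le_trans (fM t _) => //; apply/andP; split; lra.
have M1 : 0 < 3 * (M + 1) by rewrite mulr_gt0// ltr_wpDl.
pose e1 := e / (3 * (M + 1)).
have e10 : 0 < e1 by rewrite divr_gt0.
have /continuous_atE/(_ _ e10)[d1 d10 h1] := cG t.
have cN : continuous (oint (fun z => `|g z|) t) by exact/oint_continuous/locint_norm.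
have /continuous_atE/(_ _ e10)[d2 d20 h2] := cN t.
have e1M : e1 * (3 * M) <= e.
  rewrite /e1 mulrAC ler_pdivrMr// ler_wpM2l//; first exact: ltW.
  by rewrite ler_wpM2l// lerDl.
exists (Num.min 1 (Num.min (d1 / 2) d2)); first by rewrite !lt_min ltr01 d20 divr_gt0.
move=> s; rewrite !lt_min => /and3P[st1 std1 std2].
have btw z : (t <= z <= s) || (s <= z <= t) -> `|f z| <= M.
  move=> /between_dist zt; apply: fM.
  by move: (le_lt_trans zt st1); rewrite ltr_norml => /andP[? ?]; apply/andP; split; lra.
have lfD : locint (fun z => f z * (G s - G z)).
  apply: locint_continuousM => // z; apply: cvgB; [exact: cvg_cst|exact: cG].
have lgD : locint (fun z => g z * (F t - F z)).
  apply: locint_continuousM => // z; apply: cvgB; [exact: cvg_cst|exact: cF].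
(* Freezing [G] at [s] and [F] at [t] splits the increment of the product. In the first integral [f]
   is bounded and [G] continuous. In the second [F] is Lipschitz and the integral of [|g|] from [t]
   to [s] tends to zero, so integrability of [g] suffices. The bounds [2 * M * e1] and [M * e1]
   explain the 3 in [e1]. *)
have -> : Phi s - Phi t - (s - t) * 0 =
    oint (fun z => f z * (G s - G z)) t s + oint (fun z => g z * (F t - F z)) t s.
  rewrite -ointD// mulr0 subr0 /Phi.
  have -> : oint (fun z => f z * (G s - G z) + g z * (F t - F z)) t s =
     oint (fun z => (G s * f z + F t * g z) - (f z * G z + g z * F z)) t s.
    by apply: eq_oint => z; ring.
  have la : locint (fun z => G s * f z) by exact: locintZ.
  have lb : locint (fun z => F t * g z) by exact: locintZ.
  rewrite ointB//; last exact: locintD.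
  rewrite (ointD _ _ la lb) !ointZ// -hF -hG -(oint_cat x t s l2); ring.
rewrite (le_trans (ler_normD _ _))//.
have b1 : `|oint (fun z => f z * (G s - G z)) t s| <= M * e1 * 2 * `|s - t|.
  apply: norm_oint_bound => // z zts; rewrite normrM -mulrA; apply: ler_pM => //.
    exact: btw.
  have zt := between_dist zts.
  have hs : `|G s - G t| < e1 by apply: h1; lra.
  have hz : `|G z - G t| < e1 by apply: h1; lra.
  rewrite (_ : G s - G z = (G s - G t) - (G z - G t)); last by ring.
  by rewrite (le_trans (ler_normB _ _))//; lra.
have b2 : `|oint (fun z => g z * (F t - F z)) t s| <= (M * `|s - t|) * e1.
  apply: (@le_trans _ _ ((M * `|s - t|) * `|oint (fun z => `|g z|) t s|)).
    apply: norm_oint_prod => //.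
      by move=> z; apply: cvgB; [exact: cvg_cst|exact: cF].
    move=> z zts; rewrite distrC hF.
    apply: (@le_trans _ _ (M * `|z - t|)).
      apply: norm_oint_bound => // u utz; apply: btw.
      have := between_dist zts; have := between_dist utz.
      case/orP: zts => /andP[a1 a2]; case/orP: utz => /andP[a3 a4] _ _.
      - by rewrite a3 (le_trans a4 a2).
      - have -> : u = t by apply/eqP; rewrite eq_le a4 (le_trans a1 a3).
        by rewrite lexx (le_trans a1 a2).
      - have -> : u = t by apply/eqP; rewrite eq_le a3 (le_trans a4 a2).
        by rewrite lexx (le_trans a1 a2) orbT.
      - by rewrite a4 (le_trans a1 a3) orbT.
    by rewrite ler_wpM2l//; exact: between_dist.
  rewrite ler_wpM2l//; first by rewrite mulr_ge0.
  by have := h2 s std2; rewrite oint_xx subr0 => /ltW.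
rewrite (le_trans (lerD b1 b2))//.
rewrite (_ : _ + _ = e1 * (3 * M) * `|s - t|); last by ring.
by rewrite ler_wpM2r.
Qed.
End product_rule.

Section derivatives.
Context {R : realType}.
Implicit Types (f g : R -> R) (x t a b c : R).

Lemma is_derive1D f g x a b : is_derive x (1 : R) f a -> is_derive x (1 : R) g b ->
  is_derive x (1 : R) (fun t => f t + g t) (a + b).
Proof. exact: is_deriveD. Qed.

Lemma is_derive1B f g x a b : is_derive x (1 : R) f a -> is_derive x (1 : R) g b ->
  is_derive x (1 : R) (fun t => f t - g t) (a - b).
Proof. exact: is_deriveB. Qed.

Lemma is_derive1M f g x a b : is_derive x (1 : R) f a -> is_derive x (1 : R) g b ->
  is_derive x (1 : R) (fun t => f t * g t) (a * g x + f x * b).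
Proof.
move=> df dg; have := is_deriveM df dg.
by rewrite /GRing.scale/= addrC (mulrC (g x)).
Qed.

Lemma is_derive_affine x a b : is_derive x (1 : R) (fun t => a * t + b) a.
Proof.
apply/is_deriveP => e e0; exists 1 => // s _.
have -> : a * s + b - (a * x + b) - (s - x) * a = 0 by ring.
by rewrite normr0 mulr_ge0// ltW.
Qed.

Lemma is_derive1_continuous (f f' : R -> R) :
  (forall x, is_derive x (1 : R) f (f' x)) -> continuous f.
Proof.
move=> df x; apply: differentiable_continuous; apply/derivable1_diffP.
by have [] := df x.
Qed.

Lemma is_derive_le0_nincr (f f' : R -> R) (a b : R) : a <= b ->
  (forall x, is_derive x (1 : R) f (f' x)) ->
  (forall x, a <= x <= b -> f' x <= 0) -> f b <= f a.
Proof.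
move=> ab df f'0.
have cf : {within `[a, b], continuous f}.
  exact/continuous_subspaceT/(is_derive1_continuous df).
have [c] := MVT_segment ab (fun x _ => df x) cf.
rewrite in_itv/= => cab h; rewrite -subr_le0 h.
by rewrite mulr_le0_ge0 ?subr_ge0// f'0.
Qed.

End derivatives.

(** * Energy estimate in a cone *)

Section energy_weight.
Context {R : realType}.
Implicit Types (c B x t s : R).

Definition sqpos s : R := Num.max s 0 ^+ 2.
Definition dsqpos s : R := 2 * Num.max s 0.

Lemma dsqpos_ge0 s : 0 <= dsqpos s.
Proof. by rewrite /dsqpos mulr_ge0// le_max lexx orbT. Qed.

Lemma sqpos_is_derive s : is_derive s (1 : R) sqpos (dsqpos s).
Proof.
apply/is_deriveP => e e0; exists e => // t te.
apply: (@le_trans _ _ (`|t - s| * `|t - s|)); last by rewrite ler_wpM2r// ltW.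
rewrite -normrM (ger0_norm (x := (t - s) * (t - s))); last first.
  by rewrite -expr2 sqr_ge0.
have sq : 0 <= (t - s) * (t - s) by rewrite -expr2 sqr_ge0.
rewrite /sqpos /dsqpos ler_norml; case: (leP s 0) => hs; case: (leP t 0) => ht;
  apply/andP; split; nra.
Qed.

Lemma sqpos_continuous : continuous sqpos.
Proof. exact: is_derive1_continuous sqpos_is_derive. Qed.

Lemma dsqpos_continuous : continuous dsqpos.
Proof.
move=> s; apply: cvgM; first exact: cvg_cst.
by apply: continuous_max; [exact: cvg_id|exact: cvg_cst].
Qed.

(* The weight is C^1 and vanishes outside the backward cone [|x| <= B - c t],
   so the energy identity has no boundary terms. *)
Definition cone_gauge c B x t : R := (B - c * t) ^+ 2 - x ^+ 2.
Definition cone_weight c B x t : R := sqpos (cone_gauge c B x t).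
Definition cone_weight_t c B x t : R :=
  dsqpos (cone_gauge c B x t) * (- (2 * c * (B - c * t))).
Definition cone_weight_x c B x t : R := dsqpos (cone_gauge c B x t) * (- (2 * x)).

Lemma jcont_cone_gauge c B : jcont (cone_gauge c B).
Proof.
apply: jcontB.
- apply: jcont_snd => t; apply: cvgM; apply: cvgB; (try exact: cvg_cst);
    by apply: cvgM; [exact: cvg_cst|exact: cvg_id].
- by apply: jcont_fst => x; apply: cvgM; exact: cvg_id.
Qed.

Lemma jcont_post (f : R -> R) (F : R -> R -> R) : continuous f -> jcont F ->
  jcont (fun x t => f (F x t)).
Proof. by move=> cf cF p; apply: (continuous_comp (cF p) (cf _)). Qed.

Lemma jcont_cone_weight c B : jcont (cone_weight c B).
Proof. exact/jcont_post/jcont_cone_gauge/sqpos_continuous. Qed.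

Lemma jcont_cone_weight_t c B : jcont (cone_weight_t c B).
Proof.
apply: jcontM; first exact/jcont_post/jcont_cone_gauge/dsqpos_continuous.
apply: jcont_snd => t; apply: cvgN; apply: cvgM; first exact: cvg_cst.
by apply: cvgB; [exact: cvg_cst|apply: cvgM; [exact: cvg_cst|exact: cvg_id]].
Qed.

Lemma jcont_cone_weight_x c B : jcont (cone_weight_x c B).
Proof.
apply: jcontM; first exact/jcont_post/jcont_cone_gauge/dsqpos_continuous.
by apply: jcont_fst => t; apply: cvgN; apply: cvgM; [exact: cvg_cst|exact: cvg_id].
Qed.

Lemma cone_weight_is_derive_t c B x t :
  is_derive t (1 : R) (cone_weight c B x) (cone_weight_t c B x t).
Proof.
apply: (@is_derive1_comp _ sqpos (cone_gauge c B x)); first exact: sqpos_is_derive.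
have h := is_derive_affine t (- c) B.
have h2 := is_derive1B (is_derive1M h h) (is_derive_cst (x ^+ 2) t (1 : R)).
have -> : - (2 * c * (B - c * t)) =
    - c * (- c * t + B) + (- c * t + B) * - c - 0 by ring.
have -> : cone_gauge c B x = fun t => (- c * t + B) * (- c * t + B) - cst (x ^+ 2) t.
  by apply/funext => s; rewrite /cone_gauge /=; ring.
exact: h2.
Qed.

Lemma cone_weight_is_derive_x c B x t :
  is_derive x (1 : R) (fun x => cone_weight c B x t) (cone_weight_x c B x t).
Proof.
apply: (@is_derive1_comp _ sqpos (fun x => cone_gauge c B x t));
  first exact: sqpos_is_derive.
have h := is_derive_affine x 1 0.
have h2 := is_derive1B (is_derive_cst ((B - c * t) ^+ 2) x (1 : R)) (is_derive1M h h).
have -> : - (2 * x) = 0 - (1 * (1 * x + 0) + (1 * x + 0) * 1) by ring.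
have -> : (fun x => cone_gauge c B x t) =
    fun x => cst ((B - c * t) ^+ 2) x - (1 * x + 0) * (1 * x + 0).
  by apply/funext => s; rewrite /cone_gauge /=; ring.
exact: h2.
Qed.

End energy_weight.

Section energy.
Context {R : realType}.
Implicit Types (iA : R -> R) (d P dt Pt : R -> R -> R) (x y z t s c B M r k : R).

(* [d_t = P_x] and [P_t = A d_x] with [iA = 1 / A], where [dt] and [Pt] are the
   time derivatives of [d] and [P] *)
Record wave_pair iA d P dt Pt : Prop := WavePair {
  wave_pair_d : jcont d;
  wave_pair_P : jcont P;
  wave_pair_dt : jcont dt;
  wave_pair_Pt : jcont Pt;
  wave_pair_d_t : forall x t, is_derive t (1 : R) (d x) (dt x t);
  wave_pair_P_t : forall x t, is_derive t (1 : R) (P x) (Pt x t);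
  wave_pair_d_x : forall x y t, d y t - d x t = oint (fun z => iA z * Pt z t) x y;
  wave_pair_P_x : forall x y t, P y t - P x t = oint (fun z => dt z t) x y }.

(** The density is d^2 + P^2 / A: multiplying d_t = P_x by d and P_t / A = d_x by P and adding
    yields the space derivative of d P. *)
Definition wave_energy iA (w d P : R -> R -> R) B t : R :=
  oint (fun z => 1 * (w z t * (d z t * d z t))) (- B) B +
  oint (fun z => iA z * (w z t * (P z t * P z t))) (- B) B.

(** After integration by parts the time derivative is the integral of w_t (d^2 + P^2 / A) - 2 w_x d
    P. For this weight both w_t and w_x are multiples of the same nonnegative factor [dsqpos], and
    inside the cone the term in w_t dominates. *)
Lemma wave_energy_nincr iA d P dt Pt c B k T M :
  measurable_fun [set: R] iA -> (forall x, `|iA x| <= M) ->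
  (forall x, k <= iA x) -> 0 < k -> 0 <= c -> 1 <= c ^+ 2 * k ->
  wave_pair iA d P dt Pt ->
  0 <= B -> 0 <= T -> c * T <= B ->
  wave_energy iA (cone_weight c B) d P B T <= wave_energy iA (cone_weight c B) d P B 0.
Proof.
move=> mA AM kA k0 c0 ck [cd cP cdt cPt dd dP dx Px] B0 T0 cTB.
have liA : locint iA by exact: bounded_locint AM.
have biA : locbnd iA by move=> x y; exists M => z _; exact: AM.
have l1 : locint (fun _ : R => 1 : R) := locint_cst 1.
have cw := @jcont_cone_weight R c B.
have cwt := @jcont_cone_weight_t R c B.
have cwx := @jcont_cone_weight_x R c B.
have jdd : jcont (fun x t => d x t * d x t) by exact: jcontM.
have jPP : jcont (fun x t => P x t * P x t) by exact: jcontM.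
pose w := cone_weight c B; pose wt := cone_weight_t c B; pose wx := cone_weight_x c B.
pose D1 := fun x t => wt x t * (d x t * d x t) + w x t * (dt x t * d x t + d x t * dt x t).
pose D2 := fun x t => wt x t * (P x t * P x t) + w x t * (Pt x t * P x t + P x t * Pt x t).
have jD1 : jcont D1.
  by apply: jcontD; apply: jcontM => //; apply: jcontD; exact: jcontM.
have jD2 : jcont D2.
  by apply: jcontD; apply: jcontM => //; apply: jcontD; exact: jcontM.
pose E' t := oint (fun z => 1 * D1 z t) (- B) B + oint (fun z => iA z * D2 z t) (- B) B.
have dE t : is_derive t (1 : R) (wave_energy iA w d P B) (E' t).
  apply: is_derive1D.
  - apply: (is_derive_oint_jcont (F := D1)) => //; first exact: jcontM.
    move=> z s; apply: is_derive1M; first exact: cone_weight_is_derive_t.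
    by apply: is_derive1M; exact: dd.
  - apply: (is_derive_oint_jcont (F := D2)) => //; first exact: jcontM.
    move=> z s; apply: is_derive1M; first exact: cone_weight_is_derive_t.
    by apply: is_derive1M; exact: dP.
apply: (is_derive_le0_nincr T0 dE) => t /andP[t0 tT].
have ctB : 0 <= B - c * t by rewrite subr_ge0 (le_trans _ cTB)// ler_wpM2l.
have cl F : jcont F -> continuous (F^~ t) by move=> /jcont_l; exact.
have lPt : locint (fun z => iA z * Pt z t) by apply: locint_continuousM => //; exact: cl.
have bPt : locbnd (fun z => iA z * Pt z t).
  by apply: locbndM => //; apply: continuous_locbnd; exact: cl.
have ldt : locint (fun z => dt z t) by apply: continuous_locint; exact: cl.
have dPx x y := oint_product_rule x y lPt bPt ldt (fun x y => dx x y t) (fun x y => Px x y t).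
set g := fun z => _ in dPx.
have lg : locint g.
  apply: locintD; first by apply: locint_continuousM => //; exact: cl.
  by apply: locint_continuousM => //; exact: cl.
have lwx : locint (fun z => wx z t) by apply: continuous_locint; exact: cl.
have bwx : locbnd (fun z => wx z t) by apply: continuous_locbnd; exact: cl.
have wxE x y : w y t - w x t = oint (fun z => wx z t) x y.
  apply: (oint_FTC2 (F := fun z => w z t)); first exact: cl.
  by move=> z; exact: cone_weight_is_derive_x.
(* The weight vanishes at both end points, so the space derivative of w d P integrates to zero.
   Twice this zero is subtracted from the energy derivative below and removes all derivatives of [d]
   and [P]. *)
have := oint_product_rule (- B) B lwx bwx lg wxE dPx.
have gauge_le0 : cone_gauge c B B t <= 0.
  rewrite /cone_gauge subr_le0 ler_sqr ?nnegrE// lerBlDr lerDl mulr_ge0//.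
have wB : w B t = 0 by rewrite /w /cone_weight /sqpos; case: ltgtP gauge_le0 => // [_|->] _; rewrite expr0n.
have wNB : w (- B) t = 0 by rewrite -wB /w /cone_weight /cone_gauge sqrrN.
rewrite wB wNB !mul0r subrr => prod0.
have lg1 : locint (fun z => 1 * D1 z t) by apply: locint_continuousM => //; exact: cl.
have lg2 : locint (fun z => iA z * D2 z t) by apply: locint_continuousM => //; exact: cl.
have lg3 : locint (fun z => wx z t * (d z t * P z t) + g z * w z t).
  apply: locintD; last by apply: locint_continuousM => //; exact: cl.
  by apply: locint_continuousM => //; exact: (cl (fun x t => d x t * P x t) (jcontM cd cP)).
have -> : E' t = oint (fun z => (1 * D1 z t + iA z * D2 z t) -
     2 * (wx z t * (d z t * P z t) + g z * w z t)) (- B) B.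
  rewrite ointB; [|exact: locintD|exact: locintZ].
  by rewrite ointZ// -prod0 mulr0 subr0 ointD.
have -> : 0 = oint (fun _ : R => 0 : R) (- B) B by rewrite oint_cst mul0r.
apply: le_oint; [|exact: locint_cst|lra|].
  by apply: locintB; [exact: locintD|exact: locintZ].
move=> z zB.
have -> : 1 * D1 z t + iA z * D2 z t - 2 * (wx z t * (d z t * P z t) + g z * w z t)
   = wt z t * (d z t * d z t + iA z * (P z t * P z t)) - 2 * (wx z t * (d z t * P z t)).
  by rewrite /D1 /D2 /g; ring.
rewrite /wt /wx /cone_weight_t /cone_weight_x.
set q := cone_gauge c B z t.
set a := d z t; set b := P z t; set u := B - c * t; set i := iA z.
have -> : dsqpos q * (- (2 * c * u)) * (a * a + i * (b * b)) -
    2 * (dsqpos q * (- (2 * z)) * (a * b)) =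
    dsqpos q * (2 * (2 * z * (a * b) - u * (c * (a * a + i * (b * b))))) by ring.
have [q0|q0] := leP q 0.
  by rewrite /dsqpos (max_idPr q0) mulr0 mul0r.
rewrite mulr_ge0_le0 ?dsqpos_ge0// mulr_ge0_le0// subr_le0.
have zu : `|z| <= u.
  move: q0; rewrite /q /cone_gauge subr_gt0 => /ltW.
  by rewrite -ler_sqrt ?sqr_ge0// !sqrtr_sqr (ger0_norm ctB).
have cgt0 : 0 < c.
  rewrite lt_neqAle c0 andbT; apply: contraTneq ck => <-.
  by rewrite expr0n mul0r -ltNge ltr01.
(* Expand the square of [c * |a| - |b|]; the hypothesis [ck] says that the slope [c] is at least the
   wave speed. *)
have amgm : 2 * (`|a| * `|b|) <= c * (a * a + i * (b * b)).
  rewrite -(ler_pM2l cgt0) -subr_ge0.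
  have hi : (c ^+ 2 * k) * (b * b) <= c ^+ 2 * i * (b * b).
    rewrite ler_wpM2r//; first by rewrite -expr2 sqr_ge0.
    by rewrite ler_wpM2l// ?sqr_ge0//; exact: kA.
  have hb : b * b <= (c ^+ 2 * k) * (b * b).
    by rewrite ler_peMl// -expr2 sqr_ge0.
  have hs : 0 <= (c * `|a| - `|b|) ^+ 2 := sqr_ge0 _.
  have ea : `|a| * `|a| = a * a by rewrite -normrM ger0_norm// -expr2 sqr_ge0.
  have eb : `|b| * `|b| = b * b by rewrite -normrM ger0_norm// -expr2 sqr_ge0.
  have e1 : (c * `|a| - `|b|) ^+ 2 = c ^+ 2 * (a * a) - c * (2 * (`|a| * `|b|)) + b * b.
    by rewrite -ea -eb; ring.
  rewrite e1 in hs.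
  have -> : c * (c * (a * a + i * (b * b))) = c ^+ 2 * (a * a) + c ^+ 2 * i * (b * b) by ring.
  lra.
apply: (@le_trans _ _ (`|z| * (2 * (`|a| * `|b|)))).
  have h : z * (a * b) <= `|z| * (`|a| * `|b|) by rewrite -!normrM ler_norm.
  lra.
by apply: ler_pM => //; rewrite mulr_ge0// mulr_ge0.
Qed.

(** Reversing time and the sign of [P] preserves the system; this reduces negative times to positive
    ones. *)
Lemma wave_pair_reverse iA d P dt Pt : wave_pair iA d P dt Pt ->
  wave_pair iA (fun x t => d x (- t)) (fun x t => - P x (- t))
    (fun x t => - dt x (- t)) (fun x t => Pt x (- t)).
Proof.
case=> cd cP cdt cPt dd dP dx Px.
have cid : continuous (fun x : R => x) by move=> x; exact: cvg_id.
have cop : continuous (fun x : R => - x) by move=> x; apply: cvgN; exact: cvg_id.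
have jc F : jcont F -> jcont (fun x t => F x (- t)) by exact: (jcont_comp cid cop).
have jcN F : jcont F -> jcont (fun x t => - F x (- t)).
  by move=> /jc jF p; apply: cvgN; exact: jF.
have dop t : is_derive t (1 : R) (fun t : R => - t) (-1).
  have := is_derive_affine t (-1) 0.
  by under eq_fun do rewrite addr0 mulN1r.
split; [exact: jc|exact: jcN|exact: jcN|exact: jc|..].
- move=> x t; have := is_derive1_comp (dd x (- t)) (dop t).
  by rewrite mulrN1.
- move=> x t; have := is_deriveN (is_derive1_comp (dP x (- t)) (dop t)).
  by rewrite mulrN1 opprK.
- by move=> x y t; exact: dx.
- move=> x y t; rewrite -opprB opprK addrC.
  have ldt : locint (fun z => dt z (- t)) by apply: continuous_locint; exact: jcont_l.
  rewrite (eq_oint (g := fun z => -1 * dt z (- t))); last by move=> z; rewrite mulN1r.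
  by rewrite ointZ// -Px; ring.
Qed.

Lemma oint_subinterval (f : R -> R) x y z s : locint f -> x <= y -> y <= z -> z <= s ->
  (forall u, x <= u <= s -> 0 <= f u) -> oint f y z <= oint f x s.
Proof.
move=> lf xy yz zs f0.
rewrite -(oint_cat x z s lf) -(oint_cat x y z lf).
have h1 : 0 <= oint f x y.
  by apply: oint_ge0 => // u /andP[a b]; apply: f0; rewrite a (le_trans b)// (le_trans yz).
have h2 : 0 <= oint f z s.
  by apply: oint_ge0 => // u /andP[a b]; apply: f0; rewrite b (le_trans _ a)// (le_trans xy).
lra.
Qed.

Lemma wave_energy_bound iA d P dt Pt c k r t M N :
  measurable_fun [set: R] iA -> (forall x, iA x <= N) ->
  (forall x, k <= iA x) -> 0 < k -> 0 <= c -> 1 <= c ^+ 2 * k ->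
  wave_pair iA d P dt Pt -> 0 < r -> `|t| <= r -> 0 <= M ->
  (forall x, `|x| <= (c + 2) * r -> `|d x 0| <= M) ->
  (forall x, `|x| <= (c + 2) * r -> `|P x 0| <= M) ->
  oint (fun z => P z t ^+ 2) (- r) r <=
    k^-1 * (2 * (c + 2) ^+ 5 * (1 + N)) * M ^+ 2 * r.
Proof.
move=> mA AN kA k0 c0 ck + r0 + M0.
wlog t0 : t d P dt Pt / 0 <= t => [hw|].
  have [t0|/ltW t0] := leP 0 t; first exact: hw.
  move=> /wave_pair_reverse wp tr dM PM.
  have := hw (- t) _ _ _ _ _ wp; rewrite oppr_ge0 normrN oppr0 opprK => /(_ t0 tr dM).
  have PM' x : `|x| <= (c + 2) * r -> `|- P x 0| <= M by rewrite normrN; exact: PM.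
  move=> /(_ PM'); rewrite (eq_oint (g := fun z => P z t ^+ 2))//.
  by move=> z; rewrite sqrrN.
rewrite (ger0_norm t0) => wp tr dM PM.
have rge0 : 0 <= r := ltW r0.
have N0 : 0 < N by rewrite (lt_le_trans k0)// (le_trans (kA 0)).
(* For [t <= r] this gives [B - c * t >= 2 * r], so the gauge is at least [3 * r ^+ 2] on [[- r, r]]
   and the weight at least [9 * r ^+ 4]. At time zero the weight is at most [B ^+ 4] on an interval
   of length [2 * B], whence the fifth power of [c + 2] and a single factor [r]. The gain of a
   factor 9 is given away. *)
set B := (c + 2) * r.
have B0 : 0 < B by rewrite mulr_gt0// ltr_wpDl.
have AN' x : `|iA x| <= N by rewrite ger0_norm// (le_trans (ltW k0)).
have ctB : c * t <= B.
  by rewrite /B mulrDl ler_wpDr ?mulr_ge0 ?(ltW r0)// ler_wpM2l.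
have := wave_energy_nincr mA AN' kA k0 c0 ck wp (ltW B0) t0 ctB.
have liA : locint iA by exact: bounded_locint AN'.
have l1 : locint (fun _ : R => 1 : R) := locint_cst 1.
have [cd cP _ _ _ _ _ _] := wp.
have cw := @jcont_cone_weight R c B.
have lint w s F : locint w -> jcont F ->
    locint (fun z => w z * (cone_weight c B z s * (F z s * F z s))).
  move=> lw cF; apply: locint_continuousM => //.
  by apply: (@jcont_l _ (fun z s => cone_weight c B z s * (F z s * F z s))); do 2 apply: jcontM => //.
have w_ge0 z s : 0 <= cone_weight c B z s by rewrite sqr_ge0.
rewrite /wave_energy.
set E1 := oint _ _ _; set E2 := oint _ _ _; set I1 := oint _ _ _; set I2 := oint _ _ _.
have BB : - B <= B by lra.
have E10 : 0 <= E1.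
  by apply: oint_ge0 => // z _; rewrite mul1r mulr_ge0// -expr2 sqr_ge0.
have wB z : `|z| <= B -> cone_weight c B z 0 <= B ^+ 4.
  move=> zB; rewrite /cone_weight /cone_gauge /sqpos mulr0 subr0.
  have h : 0 <= B ^+ 2 - z ^+ 2.
    by rewrite subr_ge0 -ler_sqrt ?sqr_ge0// !sqrtr_sqr (ger0_norm (ltW B0)).
  rewrite (max_idPl h) (_ : B ^+ 4 = (B ^+ 2) ^+ 2); last by rewrite -exprM.
  by rewrite ler_sqr ?nnegrE ?sqr_ge0// lerBlDr lerDl sqr_ge0.
have bnd (F : R -> R -> R) (z : R) : `|z| <= B -> (`|F z 0| <= M) ->
    cone_weight c B z 0 * (F z 0 * F z 0) <= B ^+ 4 * M ^+ 2.
  move=> zB FM; apply: ler_pM => //; [by rewrite -expr2 sqr_ge0|exact: wB|].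
  rewrite -(ger0_norm (_ : 0 <= F z 0 * F z 0)) -?expr2 ?sqr_ge0// normrX.
  by rewrite ler_sqr ?nnegrE.
have I1B : I1 <= B ^+ 4 * M ^+ 2 * (B - - B).
  rewrite -oint_cst; apply: le_oint => //; [exact: lint|exact: locint_cst|].
  by move=> z; rewrite -ler_norml => zB; rewrite mul1r; apply: bnd => //; exact: dM.
have I2B : I2 <= N * (B ^+ 4 * M ^+ 2) * (B - - B).
  rewrite -oint_cst; apply: le_oint => //; [exact: lint|exact: locint_cst|].
  move=> z; rewrite -ler_norml => zB; apply: ler_pM => //.
  - exact: le_trans (ltW k0) (kA z).
  - by rewrite mulr_ge0// -expr2 sqr_ge0.
  - by apply: bnd => //; exact: PM.
have lP : locint (fun z => P z t ^+ 2).
  apply: continuous_locint => z.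
  have cPt : continuous (P^~ t) by exact: jcont_l.
  by under eq_fun do rewrite expr2; apply: cvgM; exact: cPt.
have E2B : k * ((9 * r ^+ 4) * oint (fun z => P z t ^+ 2) (- r) r) <= E2.
  have lE2 : locint (fun z => iA z * (cone_weight c B z t * (P z t * P z t))) by exact: lint.
  apply: (@le_trans _ _ (oint (fun z => iA z * (cone_weight c B z t * (P z t * P z t))) (- r) r)).
    rewrite -ointZ// -ointZ; last exact: locintZ.
    apply: le_oint => //; [exact/locintZ/locintZ|lra|].
    move=> z; rewrite -ler_norml => zr; rewrite expr2.
    have PP0 : 0 <= P z t * P z t by rewrite -expr2 sqr_ge0.
    apply: ler_pM => //; [exact: ltW|by rewrite mulr_ge0// mulr_ge0// exprn_ge0// ltW|].
    rewrite ler_wpM2r//.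
    have h2r : 2 * r <= B - c * t by have := ler_wpM2l c0 tr; rewrite /B mulrDl; lra.
    have hz : z ^+ 2 <= r ^+ 2.
      by rewrite -ler_sqrt ?sqr_ge0// !sqrtr_sqr (ger0_norm (ltW r0)).
    have hg : (2 * r) ^+ 2 <= (B - c * t) ^+ 2.
      by rewrite ler_sqr// nnegrE; [rewrite mulr_ge0// ltW|rewrite (le_trans _ h2r)// mulr_ge0// ltW].
    rewrite exprMn in hg.
    have hp : 0 <= r ^+ 2 := sqr_ge0 r.
    rewrite /cone_weight /sqpos.
    have hq : 3 * r ^+ 2 <= cone_gauge c B z t by rewrite /cone_gauge; lra.
    rewrite (max_idPl (le_trans _ hq)) ?mulr_ge0//.
    rewrite (_ : 9 * r ^+ 4 = (3 * r ^+ 2) ^+ 2); last by ring.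
    by rewrite ler_sqr// nnegrE ?(le_trans _ hq)// mulr_ge0.
  have rB : r <= B by have := mulr_ge0 c0 rge0; rewrite /B mulrDl; lra.
  apply: oint_subinterval => //; [lra|lra|].
  move=> z _; apply: mulr_ge0; first exact: le_trans (ltW k0) (kA z).
  by rewrite mulr_ge0// -expr2 sqr_ge0.
move=> EI.
set I := oint _ _ _ in E2B *.
have Bpow : B ^+ 4 * (B - - B) = 2 * (c + 2) ^+ 5 * r ^+ 5 by rewrite /B; ring.
have r40 : 0 < 9 * r ^+ 4 by rewrite mulr_gt0// exprn_gt0.
rewrite -(ler_pM2l (mulr_gt0 k0 r40)).
have -> : k * (9 * r ^+ 4) * (k^-1 * (2 * (c + 2) ^+ 5 * (1 + N)) * M ^+ 2 * r) =
    9 * (B ^+ 4 * M ^+ 2 * (B - - B) + N * (B ^+ 4 * M ^+ 2) * (B - - B)).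
  have -> : B ^+ 4 * M ^+ 2 * (B - - B) + N * (B ^+ 4 * M ^+ 2) * (B - - B) =
     B ^+ 4 * (B - - B) * (1 + N) * M ^+ 2 by ring.
  rewrite Bpow; field; exact: lt0r_neq0.
have I0 : 0 <= I1 + I2.
  apply: le_trans EI; rewrite addr_ge0// (le_trans _ E2B)//.
  by rewrite !mulr_ge0 ?(ltW k0) ?(ltW r40)// oint_ge0//; [lra|move=> z _; exact: sqr_ge0].
rewrite -mulrA; lra.
Qed.

End energy.

(** * Affine change of variables *)

Section affine_substitution.
Context {R : realType}.
Notation mu := (@lebesgue_measure R).
Variables (k b : R).
Hypothesis k0 : 0 < k.

Let phi (z : measurableTypeR R) : measurableTypeR R := k * z + b.

Let mphi : measurable_fun [set: measurableTypeR R] phi.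
Proof.
apply: (@continuous_measurable_fun R (fun z : R => k * z + b)) => z.
by apply: cvgD; [apply: cvgM; [exact: cvg_cst|exact: cvg_id]|exact: cvg_cst].
Qed.

Let nu : {measure set (measurableTypeR R) -> \bar R} :=
  mscale (NngNum (ltW k0))
    (measure_function_pushforward__canonical__measure_function_Measure mu mphi).

Let phi_preimage (c1 c2 : bool) (x y : R) :
  phi @^-1` [set` Interval (BSide c1 (phi x)) (BSide c2 (phi y))] =
  [set` Interval (BSide c1 x) (BSide c2 y)].
Proof.
apply/seteqP; split => z /=; rewrite !itv_boundlr /=;
  case: c1; case: c2; rewrite !bnd_simp /phi ?lerD2r ?ltrD2r ?(ler_pM2l k0) ?(ltr_pM2l k0)//.
Qed.

(** Both measures give a half-open interval its length, and this determines Lebesgue measure. *)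
Let lebesgue_measure_affine A : measurable A -> mu A = nu A.
Proof.
apply: lebesgue_measure_unique => _ [[x y]] _ <- /=.
rewrite /nu /mscale /= /pushforward.
have ex : x = phi ((x - b) / k) by rewrite /phi mulrC divfK ?subrK// gt_eqF.
have ey : y = phi ((y - b) / k) by rewrite /phi mulrC divfK ?subrK// gt_eqF.
rewrite [in X in _ = (_ * X)%E]ex [in X in _ = (_ * X)%E]ey phi_preimage.
rewrite !lebesgue_measure_itv/= !lte_fin.
rewrite ltr_pM2r ?invr_gt0// ltrD2r; case: ifP => _; last by rewrite mule0.
rewrite -!EFinB -EFinM; congr EFin; field; exact: lt0r_neq0.
Qed.

Lemma oint_affine (f : R -> R) (M x y : R) : measurable_fun [set: R] f -> (forall z, `|f z| <= M) ->
  oint (fun z => f (k * z + b)) x y = k^-1 * oint f (k * x + b) (k * y + b).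
Proof.
move=> mf fM.
wlog xy : x y / x <= y => [H|].
  have [xy|/ltW yx] := leP x y; first exact: H.
  by rewrite ointC H// -mulrN -ointC.
have pxy : phi x <= phi y by rewrite lerD2r ler_pM2l.
(* Adding the bound [M] makes the integrand nonnegative, as the pushforward formula used below
   requires; the added constant contributes equally to both sides. *)
wlog f0 : f M mf fM / forall z, 0 <= f z => [H|].
  have lf : locint f by exact: bounded_locint fM.
  have mc : measurable_fun [set: R] (fun z => f z + M) by apply: measurable_funD => //.
  have lfk : locint (fun z => f (k * z + b)).
    apply: (@bounded_locint _ _ M) => //.
    by apply: measurableT_comp => //; exact: mphi.
  have fM1 z : `|f z + M| <= M + M.
    by rewrite (le_trans (ler_normD _ _))// lerD// ger0_norm// (le_trans _ (fM 0)).
  have fM2 z : 0 <= f z + M by have := fM z; rewrite ler_norml => /andP[h1 _]; lra.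
  have := H _ (M + M) mc fM1 fM2.
  rewrite ointD//; last exact: locint_cst.
  rewrite ointD//; last exact: locint_cst.
  rewrite !oint_cst [k^-1 * _]mulrDr.
  have -> : k^-1 * (M * (k * y + b - (k * x + b))) = M * (y - x).
    by field; exact: lt0r_neq0.
  by move/addIr.
rewrite !oint_le// /Rintegral.
have mfE D : measurable_fun D (EFin \o f).
  by apply/measurable_EFinP; exact: measurable_funTS.
have -> : (\int[mu]_(z in `[phi x, phi y]) (f z)%:E =
    \int[nu]_(z in `[phi x, phi y]) (f z)%:E)%E.
  by apply: eq_measure_integral => A mA _; exact: lebesgue_measure_affine.
rewrite ge0_integral_mscale//; last by move=> z _; rewrite lee_fin.
rewrite ge0_integral_pushforward//; last by move=> z _; rewrite lee_fin.
rewrite (phi_preimage true false) /=.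
have intf : mu.-integrable `[x, y] (EFin \o (f \o phi)).
  apply: (@bounded_locint _ _ M); last by move=> z; exact: fM.
  by apply: measurableT_comp => //; exact: mphi.
rewrite fineM//; last exact: integrable_fin_num intf.
by rewrite mulrA mulVf ?mul1r// gt_eqF.
all: exact: mfE.
Qed.

End affine_substitution.

(** * Periodic primitives of the initial data *)

Section periodic_primitives.
Context {R : realType}.
Implicit Types (f w : R -> R) (x y z e M : R).

Lemma oint_period f e M x : measurable_fun [set: R] f -> (forall z, `|f z| <= M) ->
  periodic f e -> oint f x (x + e) = oint f 0 e.
Proof.
move=> mf fM pf; have lf : locint f by exact: bounded_locint fM.
have := @oint_affine R 1 e ltr01 f M 0 x mf fM.
rewrite invr1 mul1r mulr0 add0r mul1r (eq_oint (g := f)); last first.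
  by move=> z; rewrite mul1r.
rewrite -(oint_cat x 0 (x + e) lf) -(oint_cat 0 e (x + e) lf) (ointC _ 0 x) => ->.
ring.
Qed.

Lemma periodic_reduce f e x : 0 < e -> periodic f e ->
  exists2 z, 0 <= z <= e & f x = f z.
Proof.
move=> e0 pf.
have pn (n : nat) z : f (z + n%:R * e) = f z by rewrite mulr_natl periodicn.
pose n := Num.floor (x / e).
have h1 : n%:~R * e <= x by rewrite -ler_pdivlMr// ge_floor.
have h2 : x < (n + 1)%:~R * e by rewrite -ltr_pdivrMr// floorD1_gt.
rewrite intrD mulrDl mul1r in h2.
exists (x - n%:~R * e); first by apply/andP; split; lra.
move: h1 h2; case: n => [n|n] _ _.
  by rewrite -[in LHS](subrK (n%:~R * e) x) pn.
by rewrite NegzE mulrNz mulNr opprK pn.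
Qed.

(* The constant of integration makes the [w]-weighted mean over [0, e] vanish. *)
Definition mean_primitive w e f x : R :=
  oint f 0 x - oint (fun z => w z * oint f 0 z) 0 e / oint w 0 e.

Lemma mean_primitiveB w e f x y : locint f ->
  mean_primitive w e f y - mean_primitive w e f x = oint f x y.
Proof.
move=> lf; rewrite /mean_primitive -(oint_cat 0 x y lf); ring.
Qed.

Lemma mean_primitive_periodic w e f M : measurable_fun [set: R] f ->
  (forall z, `|f z| <= M) -> periodic f e -> oint f 0 e = 0 ->
  periodic (mean_primitive w e f) e.
Proof.
move=> mf fM pf f0 x; apply: (addIr (- mean_primitive w e f x)).
have lf : locint f by exact: bounded_locint fM.
by rewrite mean_primitiveB// (oint_period x mf fM pf) f0 subrr.
Qed.

Lemma mean_primitive_continuous w e f : locint f -> continuous (mean_primitive w e f).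
Proof. by move=> lf x; apply: cvgB; [exact: oint_continuous|exact: cvg_cst]. Qed.

(** Since the weighted mean of [F] vanishes, [F x] is the [w]-average over [z] of [F x - F z], and
    each such difference is an integral of [f] over part of one period. The weight thus leaves no
    trace in the bound. *)
Lemma mean_primitive_bound w e f M N k : measurable_fun [set: R] f ->
  (forall z, `|f z| <= M) -> periodic f e -> oint f 0 e = 0 ->
  measurable_fun [set: R] w -> (forall z, w z <= N) -> (forall z, k <= w z) ->
  0 < k -> 0 < e ->
  (forall x, `|mean_primitive w e f x| <= e * M) /\
  oint (fun z => w z * mean_primitive w e f z) 0 e = 0.
Proof.
move=> mf fM pf f0 mw wN wk k0 e0.
set F := mean_primitive w e f.
have lf : locint f by exact: bounded_locint fM.
have wN' z : `|w z| <= N by rewrite ger0_norm// (le_trans (ltW k0)).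
have lw : locint w by exact: bounded_locint wN'.
have pF : periodic F e by exact: mean_primitive_periodic fM pf f0.
have cF : continuous F by exact: mean_primitive_continuous.
have FB x y : F y - F x = oint f x y by exact: mean_primitiveB.
have W0 : 0 < oint w 0 e.
  apply: (@lt_le_trans _ _ (oint (fun=> k) 0 e)).
    by rewrite oint_cst subr0 mulr_gt0.
  by apply: le_oint => //; [exact: locint_cst|exact: ltW].
have lwF : locint (fun z => w z * F z) by exact: locint_continuousM.
have mean0 : oint (fun z => w z * F z) 0 e = 0.
  pose c := oint (fun z => w z * oint f 0 z) 0 e / oint w 0 e.
  have -> : oint (fun z => w z * F z) 0 e =
      oint (fun z => w z * oint f 0 z - c * w z) 0 e.
    by apply: eq_oint => z; rewrite /F /mean_primitive -/c mulrBr (mulrC c).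
  rewrite ointB; [|by apply: locint_continuousM => //; exact: oint_continuous|exact: locintZ].
  by rewrite ointZ// /c divfK ?subrr// gt_eqF.
split=> // x; have [{}x xe ->] := periodic_reduce x e0 pF.
have FM z : (0 <= z <= e) || (e <= z <= 0) -> `|F x - F z| <= e * M.
  move=> zb; have ze : 0 <= z <= e.
    by case/orP: zb => // /andP[h1 h2]; have := lt_le_trans e0 (le_trans h1 h2); rewrite ltxx.
  rewrite FB (le_trans (norm_oint_bound (M := M) lf _))//.
  rewrite mulrC ler_wpM2r//; first exact: le_trans (fM 0).
  by rewrite ler_norml; apply/andP; split; lra.
have : oint w 0 e * `|F x| <= oint w 0 e * (e * M).
  have h : oint w 0 e * F x = oint (fun z => w z * (F x - F z)) 0 e.
    rewrite (eq_oint (f := fun z => w z * (F x - F z))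
      (g := fun z => F x * w z - w z * F z)); last by move=> z; ring.
    by rewrite ointB ?ointZ ?mean0 ?subr0 1?mulrC//; exact: locintZ.
  rewrite -{1}(ger0_norm (ltW W0)) -normrM h.
  have cFx : continuous (fun z => F x - F z).
    by move=> z; apply: cvgB; [exact: cvg_cst|exact: cF].
  rewrite (le_trans (norm_oint_prod lw cFx FM))//.
  rewrite (eq_oint (f := fun z => `|w z|) (g := w)); last first.
    by move=> z; rewrite ger0_norm// (le_trans (ltW k0)).
  by rewrite (ger0_norm (ltW W0)) mulrC.
by rewrite ler_pM2l.
Qed.

End periodic_primitives.

Section initial_data.
Context {R : realType}.
Variables (iA A : R -> R) (e abar k N L : R).
Hypothesis (e0 : 0 < e) (k0 : 0 < k).
Hypothesis (miA : measurable_fun [set: R] iA) (mA : measurable_fun [set: R] A).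
Hypothesis (iAN : forall z, iA z <= N) (iAk : forall z, k <= iA z).
Hypothesis (AL : forall z, `|A z - abar| <= L).
Hypothesis (piA : periodic iA e) (pA : periodic A e).
Hypothesis (A_mean : oint (fun z => iA z * (A z - abar)) 0 e = 0).

(* The values at time zero of the [n]-fold space-time primitives of
   [(w_t, A w_x - abar)] *)
Fixpoint init_data n : (R -> R) * (R -> R) :=
  if n is n'.+1 then
    (mean_primitive (fun=> 1) e (fun z => iA z * (init_data n').2 z),
     mean_primitive iA e (init_data n').1)
  else (fun=> 0, fun z => A z - abar).

(** The two zero means are those that keep the next primitives periodic: the first component is
    integrated with weight 1 and the second with weight [iA]. A primitive costs [e], or [N * e] when
    the weight enters, hence the common factor [(1 + N) * e] per level. *)
Let inv n (M : R) :=
  [/\ measurable_fun [set: R] (init_data n).1 /\ measurable_fun [set: R] (init_data n).2,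
      (forall z, `|(init_data n).1 z| <= M) /\ (forall z, `|(init_data n).2 z| <= M),
      periodic (init_data n).1 e /\ periodic (init_data n).2 e,
      oint (init_data n).1 0 e = 0 & oint (fun z => iA z * (init_data n).2 z) 0 e = 0].

Let inv_init n : inv n (L * ((1 + N) * e) ^+ n).
Proof.
have N0 : 0 <= N by rewrite (le_trans (ltW k0))// (le_trans (iAk 0)).
have L0 : 0 <= L by rewrite (le_trans _ (AL 0)).
have iAN' z : `|iA z| <= N by rewrite ger0_norm// (le_trans (ltW k0)).
elim: n => [|n [[mG mF] [GM FM] [pG pF] G0 F0]].
  rewrite expr0 mulr1; split => //=.
  - by split => //; exact: measurable_funB.
  - by split => // z; rewrite normr0.
  - by split => z //; rewrite pA.
  - by rewrite oint_cst mul0r.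
set M := L * _ in GM FM.
have M0 : 0 <= M by rewrite /M mulr_ge0// exprn_ge0// mulr_ge0 ?addr_ge0// ltW.
have mf1 : measurable_fun [set: R] (fun z => iA z * (init_data n).2 z) by exact: measurable_funM.
have f1M z : `|iA z * (init_data n).2 z| <= N * M by rewrite normrM ler_pM.
have pf1 : periodic (fun z => iA z * (init_data n).2 z) e by move=> z; rewrite piA pF.
have lf1 : locint (fun z => iA z * (init_data n).2 z) by exact: bounded_locint f1M.
have lG : locint (init_data n).1 by exact: bounded_locint GM.
have [b1 m1] := mean_primitive_bound mf1 f1M pf1 F0 (@measurable_cst _ _ R R setT 1)
  (fun _ => lexx 1) (fun _ => lexx 1) ltr01 e0.
have [b2 m2] := mean_primitive_bound mG GM pG G0 miA iAN iAk k0 e0.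
have c1 := mean_primitive_continuous (w := fun=> 1) (e := e) lf1.
have c2 := mean_primitive_continuous (w := iA) (e := e) lG.
have -> : L * ((1 + N) * e) ^+ n.+1 = e * (M + N * M) by rewrite exprS /M; ring.
split => /=.
- by split; exact: continuous_measurable_fun.
- split=> z; [apply: le_trans (b1 z) _|apply: le_trans (b2 z) _];
    by rewrite ler_pM2l// (lerDl, lerDr)// mulr_ge0.
- split; [exact: mean_primitive_periodic f1M pf1 F0|exact: mean_primitive_periodic GM pG G0].
- by rewrite -[RHS]m1; apply: eq_oint => z; rewrite mul1r.
- exact: m2.
Qed.

Lemma init_data_continuous n :
  continuous (init_data n.+1).1 /\ continuous (init_data n.+1).2.
Proof.
have iAN' z : `|iA z| <= N by rewrite ger0_norm// (le_trans (ltW k0)).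
have [[mG mF] [GM FM] _ _ _] := inv_init n.
split; apply: mean_primitive_continuous; last exact: bounded_locint GM.
apply: (locintM (M := N)) => //; exact: bounded_locint FM.
Qed.

Lemma init_data_primitive n x y :
  (init_data n.+1).1 y - (init_data n.+1).1 x =
    oint (fun z => iA z * (init_data n).2 z) x y /\
  (init_data n.+1).2 y - (init_data n.+1).2 x = oint (init_data n).1 x y.
Proof.
have iAN' z : `|iA z| <= N by rewrite ger0_norm// (le_trans (ltW k0)).
have [[mG mF] [GM FM] _ _ _] := inv_init n.
split; apply: mean_primitiveB; last exact: bounded_locint GM.
apply: (locintM (M := N)) => //; exact: bounded_locint FM.
Qed.

Lemma init_data_bound n z : `|(init_data n).1 z| <= L * ((1 + N) * e) ^+ n /\
  `|(init_data n).2 z| <= L * ((1 + N) * e) ^+ n.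
Proof. by have [_ [GM FM] _ _ _] := inv_init n. Qed.

(** Agrees with the momentum of the micro problem, which starts from zero because w_t does. *)
Lemma init_data1_2 z : (init_data 1).2 z = 0.
Proof.
rewrite /= /mean_primitive oint_cst mul0r sub0r (eq_oint (g := fun=> 0)).
  by rewrite oint_cst mul0r mul0r oppr0.
by move=> u; rewrite oint_cst mul0r mulr0.
Qed.

End initial_data.

(** * Moments of iterated time primitives *)

Section wave_pair_differences.
Context {R : realType}.
Implicit Types (iA chi : R -> R) (d P dt Pt : R -> R -> R).
Implicit Types (x y z t s c B M r k h e N kappa : R).

(** The coefficient does not depend on time, so the system is invariant under time shifts and linear
    differences. *)
Lemma wave_pair_difference iA d P dt Pt h : locint iA -> wave_pair iA d P dt Pt ->
  wave_pair iA (fun x t => d x (t + h) - d x t) (fun x t => P x (t + h) - P x t)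
    (fun x t => dt x (t + h) - dt x t) (fun x t => Pt x (t + h) - Pt x t).
Proof.
move=> liA [cd cP cdt cPt dd dP dx Px].
have cid : continuous (fun x : R => x) by move=> x; exact: cvg_id.
have csh : continuous (fun x : R => x + h).
  by move=> x; apply: cvgD; [exact: cvg_id|exact: cvg_cst].
have jc F : jcont F -> jcont (fun x t => F x (t + h) - F x t).
  by move=> jF; apply: jcontB => //; exact: (jcont_comp cid csh).
have dsh t : is_derive t (1 : R) (fun t : R => t + h) 1.
  have := is_derive_affine t 1 h.
  by under eq_fun do rewrite mul1r.
have dF (F Ft : R -> R -> R) : (forall x t, is_derive t (1 : R) (F x) (Ft x t)) ->
    forall x t, is_derive t (1 : R) (fun t => F x (t + h) - F x t) (Ft x (t + h) - Ft x t).
  move=> FF x t; apply: is_derive1B => //.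
  by have := @is_derive1_comp R (F x) (fun t => t + h) t _ _ (FF x (t + h)) (dsh t); rewrite mulr1.
split; [exact: jc..|exact: dF|exact: dF| |].
- move=> x y t.
  have l1 s : locint (fun z => iA z * Pt z s).
    by apply: locint_continuousM => //; exact: jcont_l.
  rewrite (eq_oint (g := fun z => iA z * Pt z (t + h) - iA z * Pt z t)); last first.
    by move=> z; rewrite mulrBr.
  by rewrite ointB// -!dx; ring.
- move=> x y t.
  have l1 s : locint (dt^~ s) by apply: continuous_locint; exact: jcont_l.
  by rewrite ointB// -!Px; ring.
Qed.

Variables (iA : R -> R) (c k N r kappa : R) (chi : R -> R).
Hypothesis (miA : measurable_fun [set: R] iA).
Hypothesis (iAN : forall x, iA x <= N) (iAk : forall x, k <= iA x).
Hypothesis (k0 : 0 < k) (c0 : 0 <= c) (ck : 1 <= c ^+ 2 * k) (r0 : 0 < r).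
Hypothesis (mchi : measurable_fun [set: R] chi) (chiB : forall x, `|chi x| <= kappa).

(** The constant of [wave_energy_bound], plus 1 for the term [M] in Young's inequality. *)
Definition energy_constant := 1 + k^-1 * (2 * (c + 2) ^+ 5 * (1 + N)).

Let N0 : 0 <= N. Proof. by rewrite (le_trans (ltW k0))// (le_trans (iAk 0)). Qed.

Let kappa0 : 0 <= kappa. Proof. exact: le_trans (chiB 0). Qed.

Let Ce := k^-1 * (2 * (c + 2) ^+ 5 * (1 + N)).

Let Ce0 : 0 <= Ce.
Proof.
by rewrite mulr_ge0 ?invr_ge0 ?(ltW k0)// mulr_ge0 ?addr_ge0// mulr_ge0// exprn_ge0// addr_ge0.
Qed.

Let liA : locint iA.
Proof.
apply: (@bounded_locint _ _ N) => // z.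
by rewrite ger0_norm// (le_trans (ltW k0)).
Qed.

(* Young's inequality [2 |P| <= M + P^2 / M] turns the energy bound into a
   bound that is linear in [M] *)
Lemma wave_pair_moment d P dt Pt M t : wave_pair iA d P dt Pt -> 0 < M -> `|t| <= r ->
  (forall x, `|x| <= (c + 2) * r -> `|d x 0| <= M) ->
  (forall x, `|x| <= (c + 2) * r -> `|P x 0| <= M) ->
  `|oint (fun z => chi z * P z t) (- r) r| <= kappa * energy_constant * M * r.
Proof.
move=> wp M0 tr dM PM.
have := wave_energy_bound miA iAN iAk k0 c0 ck wp r0 tr (ltW M0) dM PM.
rewrite -/Ce => EB.
have [_ cP _ _ _ _ _ _] := wp.
have cPt : continuous (P^~ t) by exact: jcont_l.
have lP : locint (P^~ t) := continuous_locint cPt.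
have lchi : locint chi by exact: bounded_locint chiB.
have lchiP : locint (fun z => chi z * P z t) by exact: locint_continuousM.
have rr : - r <= r by rewrite (@le_trans _ _ 0)// ?oppr_le0 ltW.
rewrite (le_trans (norm_oint lchiP rr))//.
have lP2 : locint (fun z => P z t ^+ 2).
  by apply: continuous_locint => z; under eq_fun do rewrite expr2; apply: cvgM; exact: cPt.
have lM : locint (fun=> M) := locint_cst M.
have lY : locint (fun z => kappa * (2^-1 * (M + M^-1 * P z t ^+ 2))).
  by apply/locintZ/locintZ/locintD => //; exact: locintZ.
apply: (@le_trans _ _ (oint (fun z => kappa * (2^-1 * (M + M^-1 * P z t ^+ 2))) (- r) r)).
  apply: le_oint => //; first exact: locint_norm.
  move=> z _; rewrite normrM ler_pM//.
  rewrite -(ler_pM2l M0); set p := P z t.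
  have -> : M * (2^-1 * (M + M^-1 * p ^+ 2)) = 2^-1 * (M ^+ 2 + p ^+ 2).
    by field; exact: lt0r_neq0.
  have h := sqr_ge0 (M - `|p|).
  have hp : `|p| ^+ 2 = p ^+ 2 by rewrite real_normK// num_real.
  rewrite -hp; nra.
rewrite ointZ; last by apply/locintZ/locintD => //; exact: locintZ.
rewrite -!mulrA ler_wpM2l// ointZ; last by apply/locintD => //; exact: locintZ.
rewrite ointD//; last exact: locintZ.
rewrite oint_cst ointZ// /energy_constant -/Ce.
set I := oint _ _ _ in EB *.
have : M^-1 * I <= Ce * M * r.
  rewrite mulrC ler_pdivrMr// (le_trans EB)// le_eqVlt; apply/orP; left.
  by apply/eqP; ring.
have h2 : 0 <= Ce * M * r.
  by apply: mulr_ge0 (ltW r0); apply: mulr_ge0 (ltW M0).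
have h4 : 0 <= M * r by exact: mulr_ge0 (ltW M0) (ltW r0).
move=> h3.
have -> : (1 + Ce) * (M * r) = M * r + Ce * M * r by ring.
have -> : M * (r - - r) = 2 * (M * r) by ring.
lra.
Qed.

(** [Pt] has no time derivative of its own here. The energy estimate is applied to the difference
    over a small time [h], whose initial values are at most [(M + e) * h], and the result is divided
    by [h]. *)
Lemma wave_pair_derivative_moment d P dt Pt M t : wave_pair iA d P dt Pt -> 0 <= M ->
  `|t| <= r ->
  (forall x, `|x| <= (c + 2) * r -> `|dt x 0| <= M) ->
  (forall x, `|x| <= (c + 2) * r -> `|Pt x 0| <= M) ->
  `|oint (fun z => chi z * Pt z t) (- r) r| <= kappa * energy_constant * M * r.
Proof.
move=> wp M0 tr dM PM.
have [cd cP cdt cPt dd dP _ _] := wp.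
have lchi : locint chi by exact: bounded_locint chiB.
have dm := is_derive_oint_jcont (- r) r t lchi cP cPt dP.
set m' := oint _ _ _ in dm *.
pose K := kappa * energy_constant * r.
have K0 : 0 <= K.
  apply: mulr_ge0 (ltW r0); apply: mulr_ge0 => //.
  by rewrite /energy_constant -/Ce addr_ge0.
have K1 : 0 < K + 1 by rewrite ltr_wpDl.
(* The share [K * e] comes from the differenced initial data, the remaining [e] from replacing the
   derivative of the moment by a difference quotient. *)
suff H e : 0 < e -> `|m'| <= K * M + (K + 1) * e.
  rewrite -/m' (_ : _ * M * r = K * M); last by rewrite /K; ring.
  apply/ler_addgt0Pr => e e0.
  have := H (e / (K + 1)) (divr_gt0 e0 K1).
  by rewrite (mulrC (K + 1)) divfK// gt_eqF.
move=> e0.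
have [d1 d10 h1] := tube (- ((c + 2) * r)) ((c + 2) * r) 0 cdt e0.
have [d2 d20 h2] := tube (- ((c + 2) * r)) ((c + 2) * r) 0 cPt e0.
have [d3 d30 h3] := (is_deriveP _ _ _).1 dm e e0.
(* Below [d1] and [d2] the initial slopes vary by at most [e]; below [d3] the increment of the
   moment is within [e * h] of its linear part. *)
pose dd0 := Num.min d1 (Num.min d2 d3).
have dd00 : 0 < dd0 by rewrite !lt_min d10 d20.
pose h := dd0 / 2.
have h0 : 0 < h by rewrite divr_gt0.
have : h < dd0 by rewrite /h; lra.
rewrite !lt_min => /and3P[hd1 hd2 hd3].
have Me : 0 < M + e by rewrite ltr_wpDl.
have step (F Ft : R -> R -> R) (d' : R) : jcont Ft -> h < d' ->
    (forall x t, is_derive t (1 : R) (F x) (Ft x t)) ->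
    (forall x, `|x| <= (c + 2) * r -> `|Ft x 0| <= M) ->
    (forall z s, - ((c + 2) * r) <= z <= (c + 2) * r -> `|s - 0| < d' ->
       `|Ft z s - Ft z 0| <= e) ->
    forall x, `|x| <= (c + 2) * r -> `|F x (0 + h) - F x 0| <= (M + e) * h.
  move=> jF hd' dF FM Fe x xB; have cFx : continuous (Ft x) by exact: jcont_r.
  have hE : h = `|h - 0| by rewrite subr0 ger0_norm// ltW.
  rewrite add0r (oint_FTC2 0 h cFx (dF x)) [X in _ <= _ * X]hE.
  apply: norm_oint_bound; first exact: continuous_locint.
  move=> z /orP[/andP[z0 zh]|/andP[hz z0]]; last first.
    by have := lt_le_trans h0 (le_trans hz z0); rewrite ltxx.
  rewrite -(subrK (Ft x 0) (Ft x z)) (le_trans (ler_normD _ _))// addrC lerD//; first exact: FM.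
  apply: Fe; first by rewrite -ler_norml.
  by rewrite subr0 ger0_norm// (le_lt_trans zh).
have Mh : 0 < (M + e) * h by rewrite mulr_gt0.
have b := wave_pair_moment (wave_pair_difference h liA wp) Mh tr
  (step _ _ _ cdt hd1 dd dM h1) (step _ _ _ cPt hd2 dP PM h2).
have := h3 (t + h); rewrite addrAC subrr add0r (ger0_norm (ltW h0)) => /(_ hd3).
have lP s : locint (fun z => chi z * P z s).
  by apply: locint_continuousM => //; exact: jcont_l.
rewrite -ointB// (eq_oint (f := fun z => _ - _) (g := fun z => chi z * (P z (t + h) - P z t))); last first.
  by move=> z; rewrite mulrBr.
set Dm := oint _ _ _ in b * => h4.
have : h * `|m'| <= (K * M + (K + 1) * e) * h.
  have -> : h * `|m'| = `|h * m'| by rewrite normrM (ger0_norm (ltW h0)).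
  have -> : h * m' = Dm - (Dm - h * m') by ring.
  rewrite (le_trans (ler_normB _ _))// (le_trans (lerD b h4))//.
  by rewrite le_eqVlt; apply/orP; left; apply/eqP; rewrite /K; ring.
by rewrite mulrC ler_pM2r.
Qed.

End wave_pair_differences.

(** * Iterated time primitives as space primitives *)

Section primitive_tower.
Context {R : realType}.

(** The constant of integration [G n] depends on [x]. In the tower it is a space primitive of the
    data one level below, which makes the new level a space primitive at every time. *)
Fixpoint time_primitive (G : nat -> R -> R) (H : R -> R -> R) n : R -> R -> R :=
  if n is n'.+1 then fun x t => G n x + oint (time_primitive G H n' x) 0 t else H.

Variables (iA : R -> R) (G F : nat -> R -> R) (d1 P1 : R -> R -> R).
Hypothesis liA : locint iA.
Hypothesis (cG : forall n, continuous (G n)) (cF : forall n, continuous (F n)).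
Hypothesis GE : forall n x y, G n.+1 y - G n.+1 x = oint (fun z => iA z * F n z) x y.
Hypothesis FE : forall n x y, F n.+1 y - F n.+1 x = oint (G n) x y.
Hypothesis (cd1 : jcont d1) (cP1 : jcont P1).
Hypothesis (d1_0 : forall x, d1 x 0 = G 0 x) (P1_0 : forall x, P1 x 0 = F 0 x).
Hypothesis d1_conservation : forall x y t,
  oint (fun z => d1 z t - d1 z 0) x y = oint (fun s => P1 y s - P1 x s) 0 t.
Hypothesis P1_conservation : forall x y t,
  oint (fun z => iA z * (P1 z t - P1 z 0)) x y = oint (fun s => d1 y s - d1 x s) 0 t.

Let d := time_primitive G d1.
Let P := time_primitive F P1.

Let jcont_time_primitive (G' : nat -> R -> R) H n :
  (forall n, continuous (G' n)) -> jcont H -> jcont (time_primitive G' H n).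
Proof.
move=> cG' cd; elim: n => //= n IH.
by apply: jcontD; [exact: jcont_fst|exact: jcont_oint].
Qed.

Let jd n : jcont (d n). Proof. exact: jcont_time_primitive. Qed.
Let jP n : jcont (P n). Proof. exact: jcont_time_primitive. Qed.

Lemma time_primitive0 n x : d n x 0 = G n x /\ P n x 0 = F n x.
Proof. by case: n => [|n]; rewrite /d /P /= ?d1_0 ?P1_0 ?oint_xx ?addr0. Qed.

(** The system integrated over a space-time rectangle. This form asks for no derivative and so makes
    sense at level 0, where [d1] and [P1] are only continuous. *)
Let conservation n := forall x y t,
  oint (fun z => d n z t - d n z 0) x y = oint (fun s => P n y s - P n x s) 0 t /\
  oint (fun z => iA z * (P n z t - P n z 0)) x y = oint (fun s => d n y s - d n x s) 0 t.

Let lslice (H : R -> R -> R) : jcont H ->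
  (forall x, locint (H x)) /\ (forall t, locint (H^~ t)) /\
  (forall t, locint (fun z => iA z * H z t)).
Proof.
move=> jH; split; [|split] => x; first exact/continuous_locint/jcont_r.
  exact/continuous_locint/jcont_l.
by apply: locint_continuousM => //; exact: jcont_l.
Qed.

Let space_primitive n : conservation n -> forall x y t,
  d n.+1 y t - d n.+1 x t = oint (fun z => iA z * P n z t) x y /\
  P n.+1 y t - P n.+1 x t = oint (fun z => d n z t) x y.
Proof.
move=> H x y t; have [H1 H2] := H x y t.
have [ld1 [ld2 ld3]] := lslice (@jd n); have [lP1 [lP2 lP3]] := lslice (@jP n).
split.
  have -> : d n.+1 y t - d n.+1 x t =
      (G n.+1 y - G n.+1 x) + (oint (d n y) 0 t - oint (d n x) 0 t).
    by rewrite /d /=; ring.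
  rewrite GE -ointB// -H2 (eq_oint (f := fun z => _ * (_ - _))
    (g := fun z => iA z * P n z t - iA z * P n z 0)); last by move=> z; rewrite mulrBr.
  rewrite ointB// (eq_oint (f := fun z => _ * F n z) (g := fun z => iA z * P n z 0)).
    by ring.
  by move=> z; rewrite (@time_primitive0 n z).2.
have -> : P n.+1 y t - P n.+1 x t =
    (F n.+1 y - F n.+1 x) + (oint (P n y) 0 t - oint (P n x) 0 t).
  by rewrite /P /=; ring.
rewrite FE -ointB// -H1 ointB// (eq_oint (f := G n) (g := fun z => d n z 0)).
  by ring.
by move=> z; rewrite (@time_primitive0 n z).1.
Qed.

(** Conservation at level [n] makes level [n.+1] a space primitive of level [n]; integrating this in
    time and exchanging the integrals is conservation at level [n.+1]. *)
Let conserved n : conservation n.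
Proof.
elim: n => [|n IH] x y t; first by split; [exact: d1_conservation|exact: P1_conservation].
have X := space_primitive IH.
split.
- rewrite (eq_oint (g := fun z => 1 * oint (d n z) 0 t)); last first.
    by move=> z; rewrite (@time_primitive0 n.+1 z).1 /d /=; ring.
  rewrite -oint_swap//; last exact: locint_cst.
  apply: eq_oint => s; rewrite (X x y s).2.
  by apply: eq_oint => z; rewrite mul1r.
- rewrite (eq_oint (g := fun z => iA z * oint (P n z) 0 t)); last first.
    by move=> z; rewrite (@time_primitive0 n.+1 z).2 /P /=; ring.
  rewrite -oint_swap//.
  by apply: eq_oint => s; rewrite (X x y s).1.
Qed.

Lemma time_primitive_wave_pair n : wave_pair iA (d n.+1) (P n.+1) (d n) (P n).
Proof.
have X := space_primitive (@conserved n).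
have dT (G' : nat -> R -> R) (H : R -> R -> R) : jcont H ->
    forall x t, is_derive t (1 : R) (fun t => G' n.+1 x + oint (H x) 0 t) (H x t).
  move=> jH x t; have dH : is_derive t (1 : R) (oint (H x) 0) (H x t).
    exact/oint_is_derive/jcont_r.
  by have := is_derive1D (is_derive_cst (G' n.+1 x) t (1 : R)) dH; rewrite add0r.
split => //; [exact: dT|exact: dT|..] => x y t; by have [] := X x y t.
Qed.

End primitive_tower.

(** * Local square integrability and limits of integrals *)

Section square_integrable.
Context {R : realType}.
Notation mu := (@lebesgue_measure R).
Implicit Types (f g chi : R -> R) (x y z t s r e l kappa : R).

Lemma locint_symmetric f :
  (forall r, mu.-integrable `[- r, r] (EFin \o f)) -> locint f.
Proof.
move=> H x y; apply: integrableS (H (`|x| + `|y|)) => //.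
apply: subset_itv; rewrite bnd_simp.
- by rewrite lerNl (le_trans (ler_norm _))// normrN lerDl.
- by rewrite (le_trans (ler_norm _))// lerDr.
Qed.

Lemma L2loc_sqr f : L2loc f -> locint (fun z => f z ^+ 2).
Proof. by case=> _ H; exact: locint_symmetric. Qed.

Lemma L2loc_intro f : measurable_fun [set: R] f -> locint (fun z => f z ^+ 2) -> L2loc f.
Proof. by move=> mf lf; split => // r; exact: lf. Qed.

Lemma locint_dominated f g : measurable_fun [set: R] f -> locint g ->
  (forall z, `|f z| <= g z) -> locint f.
Proof.
move=> mf lg fg x y; apply: le_integrable (lg x y) => //.
- by apply/measurable_EFinP; exact: measurable_funTS.
- by move=> z _; rewrite /= lee_fin (le_trans (fg z))// ler_norm.
Qed.

Lemma L2loc_locint f : L2loc f -> locint f.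
Proof.
move=> lf; apply: (@locint_dominated _ (fun z => 1 + f z ^+ 2)).
- by case: lf.
- by apply: locintD; [exact: locint_cst|exact: L2loc_sqr].
- move=> z; have h := sqr_ge0 (1 - `|f z|).
  have hp : `|f z| ^+ 2 = f z ^+ 2 by rewrite real_normK// num_real.
  have := normr_ge0 (f z); rewrite -hp; nra.
Qed.

Lemma L2locB f g : L2loc f -> L2loc g -> L2loc (fun z => f z - g z).
Proof.
move=> lf lg; have mfg : measurable_fun [set: R] (fun z => f z - g z).
  by case: lf => mf _; case: lg => mg _; exact: measurable_funB.
apply: L2loc_intro => //.
apply: (@locint_dominated _ (fun z => 2 * f z ^+ 2 + 2 * g z ^+ 2)).
- exact: measurable_funX.
- by apply: locintD; apply: locintZ; exact: L2loc_sqr.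
- move=> z; rewrite ger0_norm ?sqr_ge0//.
  have := sqr_ge0 (f z + g z); nra.
Qed.

Lemma continuous_L2loc f : continuous f -> L2loc f.
Proof.
move=> cf; apply: L2loc_intro; first exact: continuous_measurable_fun.
by apply: continuous_locint => z; under eq_fun do rewrite expr2; apply: cvgM; exact: cf.
Qed.

(** Stands in for the Cauchy-Schwarz inequality: integrate [|g| <= l / 2 + g^2 / (2 * l)] and leave
    [l] free to be optimised. *)
Lemma oint_young chi g kappa r l x y : measurable_fun [set: R] chi ->
  (forall z, `|chi z| <= kappa) -> L2loc g -> 0 < l -> 0 <= r ->
  `|x| <= r -> `|y| <= r ->
  `|oint (fun z => chi z * g z) x y| <=
    kappa * (l * r + (2 * l)^-1 * \int[mu]_(z in `[- r, r]) g z ^+ 2).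
Proof.
move=> mchi chiB lg l0 r0.
have kappa0 : 0 <= kappa by exact: le_trans (chiB 0).
wlog xy : x y / x <= y => [H xr yr|].
  have [xy|/ltW yx] := leP x y; first exact: H.
  by rewrite ointC normrN; exact: H.
move=> xr yr.
have /andP[x1 x2] : - r <= x <= r by rewrite -ler_norml.
have /andP[y1 y2] : - r <= y <= r by rewrite -ler_norml.
have rr : - r <= r by lra.
have lg1 := L2loc_locint lg; have lg2 := L2loc_sqr lg.
have lcg : locint (fun z => chi z * g z) by exact: locintM chiB.
rewrite (le_trans (norm_oint lcg xy))//.
rewrite (le_trans (oint_subinterval (x := - r) (s := r) (locint_norm lcg) _ xy _ _))//.
have -> : kappa * (l * r + (2 * l)^-1 * \int[mu]_(z in `[- r, r]) g z ^+ 2) =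
    oint (fun z => kappa * (l / 2 + (2 * l)^-1 * g z ^+ 2)) (- r) r.
  rewrite ointZ; last by apply: locintD; [exact: locint_cst|exact: locintZ].
  rewrite ointD; [|exact: locint_cst|exact: locintZ].
  by rewrite oint_cst ointZ// oint_le//; congr (_ * (_ + _)); field.
apply: le_oint => //; first exact: locint_norm.
  by apply/locintZ/locintD; [exact: locint_cst|exact: locintZ].
move=> z _; rewrite normrM ler_pM// -(ler_pM2l (_ : 0 < 2 * l)) ?mulr_gt0//.
have -> : 2 * l * (l / 2 + (2 * l)^-1 * g z ^+ 2) = l ^+ 2 + g z ^+ 2.
  by field; exact: lt0r_neq0.
have h := sqr_ge0 (l - `|g z|).
have hp : `|g z| ^+ 2 = g z ^+ 2 by rewrite real_normK// num_real.
rewrite -hp; nra.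
Qed.

Lemma L2loc_cvg_oint (F : R -> R -> R) (G : set_system R) f chi kappa r e :
  Filter G -> (forall s, L2loc (F s)) -> L2loc f -> L2loc_cvg F G f ->
  measurable_fun [set: R] chi -> (forall z, `|chi z| <= kappa) -> 0 <= r -> 0 < e ->
  \forall s \near G, forall x y, `|x| <= r -> `|y| <= r ->
    `|oint (fun z => chi z * (F s z - f z)) x y| <= e.
Proof.
move=> FG lF lf cvF mchi chiB r0 e0.
have kappa0 : 0 <= kappa by exact: le_trans (chiB 0).
pose K := kappa + 1.
have K0 : 0 < K by rewrite ltr_wpDl.
have chiK z : `|chi z| <= K by rewrite (le_trans (chiB z))// lerDl.
(* Chosen so that the term in [l] takes at most half of [e]; the tolerance [e * l / K] on the
   squared distance takes the other half. The additions of 1 keep the denominators positive. *)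
pose l := e / (2 * K * (r + 1)).
have r1 : 0 < r + 1 by rewrite ltr_wpDl.
have l0 : 0 < l by rewrite divr_gt0// !mulr_gt0.
have el0 : 0 < e * l / K by rewrite divr_gt0// mulr_gt0.
have /cvgr0_norm_le/(_ _ el0) := cvF r.
apply: filterS => s; rewrite ger0_norm => [Is x y xr yr|]; last first.
  by apply: Rintegral_ge0 => z _; exact: sqr_ge0.
rewrite (le_trans (oint_young mchi chiK (L2locB (lF s) lf) l0 r0 xr yr))//.
set I := Rintegral _ _ _ in Is *.
have h1 : K * (l * r) <= e / 2.
  have -> : e / 2 = K * (l * (r + 1)) by rewrite /l; field; rewrite !lt0r_neq0.
  by rewrite ler_pM2l// ler_pM2l// lerDl.
have h2 : K * ((2 * l)^-1 * I) <= e / 2.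
  have -> : e / 2 = K * ((2 * l)^-1 * (e * l / K)) by field; rewrite !lt0r_neq0.
  by rewrite ler_pM2l// ler_pM2l// invr_gt0 mulr_gt0.
rewrite mulrDr; lra.
Qed.

Lemma L2loc_cvg_continuous (f : R -> R -> R) chi kappa x y :
  (forall t, L2loc (f^~ t)) -> (forall t, L2loc_cvg (fun s z => f z s) (nbhs t) (f^~ t)) ->
  measurable_fun [set: R] chi -> (forall z, `|chi z| <= kappa) ->
  continuous (fun t => oint (fun z => chi z * f z t) x y).
Proof.
move=> lf cf mchi chiB t; apply/cvgrPdist_le => e e0.
have r0 : 0 <= `|x| + `|y| by rewrite addr_ge0.
have := L2loc_cvg_oint (nbhs_filter t) lf (lf t) (cf t) mchi chiB r0 e0.
apply: filterS => s /(_ x y); rewrite lerDl lerDr => /(_ (normr_ge0 _) (normr_ge0 _)).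
have lcf u : locint (fun z => chi z * f z u).
  by apply: locintM chiB => //; exact: L2loc_locint.
rewrite (eq_oint (g := fun z => chi z * f z s - chi z * f z t)); last first.
  by move=> z; rewrite mulrBr.
by rewrite ointB// distrC.
Qed.

Lemma L2loc_cvg_jcont (f : R -> R -> R) :
  (forall t, L2loc (f^~ t)) -> (forall t, L2loc_cvg (fun s z => f z s) (nbhs t) (f^~ t)) ->
  jcont (fun x t => oint (fun z => f z t) 0 x).
Proof.
move=> lf cf; apply/jcontP => x t e e0.
have lft u : locint (f^~ u) by exact: L2loc_locint.
have e3 : 0 < e / 3 by rewrite divr_gt0.
have cx : continuous (oint (f^~ t) 0) by exact: oint_continuous.
have /continuous_atE/(_ _ e3)[d1 d10 h1] := cx x.
have r0 : 0 <= `|x| + 1 by rewrite addr_ge0.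
have := L2loc_cvg_oint (nbhs_filter t) lf (lf t) (cf t) (@measurable_cst _ _ R R setT 1)
  (fun _ => le_refl `|1|) r0 e3.
move=> [d2 /= d20 h2].
exists (Num.min 1 (Num.min d1 d2)); first by rewrite !lt_min ltr01 d10.
move=> y s; rewrite !lt_min => /and3P[yx1 yx _] /and3P[_ _ st].
have y1 : `|y| <= `|x| + 1.
  rewrite -(subrK x y) (le_trans (ler_normD _ _))// addrC lerD2l; exact: ltW.
have := h2 s; rewrite /ball_/= distrC => /(_ st 0 y); rewrite normr0 => /(_ r0 y1).
rewrite (eq_oint (g := fun z => f z s - f z t)); last by move=> z; rewrite mul1r.
rewrite ointB// => h3.
have -> : oint (f^~ s) 0 y - oint (f^~ t) 0 x =
   (oint (f^~ s) 0 y - oint (f^~ t) 0 y) + (oint (f^~ t) 0 y - oint (f^~ t) 0 x) by ring.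
rewrite (le_lt_trans (ler_normD _ _))//; have := h1 y yx; lra.
Qed.

End square_integrable.

Lemma oint_indic {R : realType} (g : R -> R) x y r : x <= y -> - r <= x -> y <= r ->
  oint (fun z => \1_(`[x, y]%classic) z * g z) (- r) r = oint g x y.
Proof.
move=> xy rx yr; rewrite !oint_le//; last by rewrite (le_trans rx)// (le_trans xy).
have -> : `[x, y]%classic = `[- r, r]%classic `&` `[x, y]%classic.
  apply/esym/setIidr; apply: subset_itv; rewrite bnd_simp//.
rewrite Rintegral_mkcondr; apply: eq_Rintegral => z zr.
rewrite patchE indicE in_setI zr /=.
by case: ifP; rewrite (mul1r, mul0r).
Qed.

(** * The micro problem *)

Section micro_problem.
Context {R : realType}.
Notation mu := (@lebesgue_measure R).
Variables (A iA : R -> R) (w wx wt : R -> R -> R) (abar Lam N : R) (G : R -> R).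
Hypothesis (mA : measurable_fun [set: R] A) (AL : forall z, `|A z| <= Lam).
Hypothesis (miA : measurable_fun [set: R] iA) (iAN : forall z, `|iA z| <= N).
Hypothesis (iAA : forall z, iA z * A z = 1).
Hypothesis (cG : continuous G).
Hypothesis GE : forall x y, G y - G x = oint (fun z => iA z * (A z - abar)) x y.
Hypothesis sol : micro_solution A w wx wt.

Let sigma z t : R := A z * wx z t - abar.

Let wx_L2 t : L2loc (wx^~ t). Proof. by have [] := micro_H1 sol t. Qed.
Let wt_L2 t : L2loc (wt^~ t). Proof. exact: micro_wt_L2 sol t. Qed.
Let wx_loc t : locint (wx^~ t). Proof. exact/L2loc_locint/wx_L2. Qed.
Let wt_loc t : locint (wt^~ t). Proof. exact/L2loc_locint/wt_L2. Qed.

Let Awx_loc t : locint (fun z => A z * wx z t).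
Proof. by apply: locintM AL => //; exact: wx_loc. Qed.

Let sigma_loc t : locint (sigma^~ t).
Proof. by apply: locintB; [exact: Awx_loc|exact: locint_cst]. Qed.

Let w_x t x y : w y t - w x t = oint (wx^~ t) x y.
Proof.
have [_ H] := micro_H1 sol t.
have [xy|/ltW yx] := leP x y; first by rewrite H// oint_le.
by rewrite ointC oint_le// -H// opprB.
Qed.

Let w_continuous t : continuous (w^~ t).
Proof. exact: primitive_continuous (wx_loc t) (w_x t). Qed.

Let w_loc t : locint (w^~ t). Proof. exact/continuous_locint/w_continuous. Qed.

Let m1 : measurable_fun [set: R] (fun _ : R => 1 : R). Proof. by []. Qed.

Let one_le (z : R) : `|(fun _ : R => 1 : R) z| <= 1. Proof. by rewrite normr1. Qed.

Let w_t x y t : is_derive t (1 : R) (fun t => oint (w^~ t) x y) (oint (wt^~ t) x y).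
Proof.
apply/is_deriveP => e e0.
have lq h : L2loc (fun z => (w z (t + h) - w z t) / h).
  apply: continuous_L2loc => z; apply: cvgM; last exact: cvg_cst.
  by apply: cvgB; exact: w_continuous.
have r0 : 0 <= `|x| + `|y| by rewrite addr_ge0.
have [d /= d0 H] := L2loc_cvg_oint _ lq (wt_L2 t) (micro_wt_derivative sol t) m1 one_le r0 e0.
exists d => // s st.
have [->|st0] := eqVneq s t; first by rewrite !subrr mul0r subrr normr0 mulr0.
have h0 : s - t != 0 by rewrite subr_eq0.
have := H (s - t); rewrite /ball_/= sub0r normrN => /(_ st h0 x y).
rewrite lerDl lerDr => /(_ (normr_ge0 _) (normr_ge0 _)).
rewrite (eq_oint (g := fun z => (s - t)^-1 * (w z s - w z t) - wt z t)); last first.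
  by move=> z; rewrite mul1r (addrC t) subrK mulrC.
rewrite ointB; [|by apply/locintZ/locintB; exact: w_loc|exact: wt_loc].
rewrite ointZ; last by apply: locintB; exact: w_loc.
rewrite ointB; [|exact: w_loc..] => h1.
rewrite -[X in X <= _](_ : `|s - t| *
  `|(s - t)^-1 * (oint (w^~ s) x y - oint (w^~ t) x y) - oint (wt^~ t) x y| = _).
  by rewrite mulrC ler_wpM2r.
by rewrite -normrM mulrBr mulrA divff// mul1r.
Qed.

Let wx_jcont : jcont (fun x t => oint (wx^~ t) 0 x).
Proof. exact: L2loc_cvg_jcont wx_L2 (micro_wx_continuous sol). Qed.

Let wt_jcont : jcont (fun x t => oint (wt^~ t) 0 x).
Proof. exact: L2loc_cvg_jcont wt_L2 (micro_wt_continuous sol). Qed.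

Let w_jcont : jcont w.
Proof.
(* The hypotheses control [w] in time only through integrals, so its values are rebuilt from its
   mean over [[0, 1]] and from w_x. *)
have -> : w = fun x t => (oint (w^~ t) 0 1 - oint (fun z => 1 * oint (wx^~ t) 0 z) 0 1)
    + oint (wx^~ t) 0 x.
  apply/funext => x; apply/funext => t.
  have cx : locint (fun z => oint (wx^~ t) 0 z).
    by apply: continuous_locint; exact/oint_continuous/wx_loc.
  have -> : oint (w^~ t) 0 1 = oint (fun z => w 0 t + 1 * oint (wx^~ t) 0 z) 0 1.
    by apply: eq_oint => z; rewrite -w_x; ring.
  rewrite ointD; [|exact: locint_cst|by apply: locintZ].
  by rewrite oint_cst -w_x; ring.
apply: jcontD => //; apply: jcont_snd => t; apply: cvgB.
  exact: (is_derive1_continuous (w_t 0 1)).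
exact: (oint_jcont (locint_cst 1) wx_jcont).
Qed.

Let q t := oint (sigma^~ t) 0 1.

Let qE t : q t = oint (fun z => A z * wx z t) 0 1 - abar.
Proof.
by rewrite /q ointB ?oint_cst; [rewrite subr0 mulr1|exact: Awx_loc|exact: locint_cst].
Qed.

Let q_continuous : continuous q.
Proof.
have -> : q = fun t => oint (fun z => A z * wx z t) 0 1 - abar by exact/funext/qE.
move=> t; apply: cvgB; last exact: cvg_cst.
exact: (L2loc_cvg_continuous wx_L2 (micro_wx_continuous sol) mA AL).
Qed.

(** As G' = 1 - abar / A, the space derivative is w_x - abar / A = sigma / A, while the time
    derivative is w_t. *)
Definition micro_displacement x t : R := w x t - x + G x.

(* Normalised so that its mean over [0, 1] has derivative [q] *)
Definition micro_momentum x t : R :=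
  oint (wt^~ t) 0 x + (oint q 0 t - oint (fun z => 1 * oint (wt^~ t) 0 z) 0 1).

Let d := micro_displacement.
Let P := micro_momentum.

Lemma micro_displacement_jcont : jcont d.
Proof.
apply: jcontD; last exact: jcont_fst.
by apply: jcontB => //; apply: jcont_fst => x; exact: cvg_id.
Qed.

Lemma micro_momentum_jcont : jcont P.
Proof.
apply: jcontD => //; apply: jcont_snd => t; apply: cvgB.
  exact: oint_continuous (continuous_locint q_continuous) t.
exact: (oint_jcont (locint_cst 1) wt_jcont).
Qed.

Let P_loc t : locint (P^~ t).
Proof. exact/continuous_locint/jcont_l/micro_momentum_jcont. Qed.

Let P_x t x y : P y t - P x t = oint (wt^~ t) x y.
Proof. by rewrite /P /micro_momentum -(oint_cat 0 x y (wt_loc t)); ring. Qed.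

Let P_mean t : oint (P^~ t) 0 1 = oint q 0 t.
Proof.
rewrite /P /micro_momentum ointD; [|exact/continuous_locint/oint_continuous/wt_loc|exact: locint_cst].
rewrite oint_cst (eq_oint (f := fun z => 1 * _) (g := fun z => oint (wt^~ t) 0 z)); last first.
  by move=> z; rewrite mul1r.
by rewrite subr0 mulr1 addrC subrK.
Qed.

Lemma micro_displacement0 x : d x 0 = G x.
Proof. by rewrite /d /micro_displacement (micro_init_w sol) subrr add0r. Qed.

Lemma micro_momentum0 x : P x 0 = 0.
Proof.
have wt0 u v : oint (wt^~ 0) u v = 0.
  have H a b : \int[mu]_(z in `[a, b]) wt z 0 = 0.
    rewrite /Rintegral (ae_eq_integral (cst 0%E))//.
    - by rewrite integral_cst//= mul0e.
    - by apply/measurable_EFinP; apply: measurable_funTS; case: (wt_L2 0).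
    - have [Z [mZ Z0 sub]] := micro_init_wt sol; exists Z; split => // z /= zN.
      by apply: sub => /= wz; apply: zN => _; rewrite wz.
  by rewrite /oint !H subrr.
rewrite /P /micro_momentum wt0 oint_xx (eq_oint (g := fun=> 0)) ?oint_cst; first by ring.
by move=> z; rewrite wt0 mulr0.
Qed.

(** The weak form of P_t = sigma, tested with functions [chi] that need not be differentiable: it is
    a primitive of [chi] that enters the weak equation. *)
Lemma micro_moment_is_derive (chi : R -> R) (kappa : R) x y t : x <= y ->
  measurable_fun [set: R] chi -> (forall z, `|chi z| <= kappa) ->
  is_derive t (1 : R) (fun t => oint (fun z => chi z * P z t) x y)
    (oint (fun z => chi z * sigma z t) x y).
Proof.
move=> xy mchi chiB.
have lchi : locint chi by exact: bounded_locint chiB.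
have kappa0 : 0 <= kappa by exact: le_trans (chiB 0).
pose c := oint chi x y.
(* The subtracted multiple of an indicator makes the total integral zero, so the primitive [phi] of
   [f] has compact support and is an admissible test function. *)
pose f z := \1_(`[x, y]%classic) z * chi z - c * (\1_(`[0, 1]%classic) z * 1).
pose r : R := `|x| + `|y| + 2.
have rx : - r < x.
  by rewrite /r ltrNl (le_lt_trans (ler_norm _))// normrN -addrA ltrDl ltr_wpDl.
have yr : y < r by rewrite /r (le_lt_trans (ler_norm _))// addrAC ltrDr ltr_wpDl.
have r2 : 2 <= r by rewrite /r lerDr addr_ge0.
have rr : - r <= r by lra.
have indB (S : set R) z : `|\1_S z : R| <= 1.
  by rewrite indicE; case: (z \in S); rewrite ?normr1 ?normr0.
have mf : measurable_fun [set: R] f.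
  by apply: measurable_funB; apply: measurable_funM => //; apply: measurable_funM => //.
have fB z : `|f z| <= kappa + `|c|.
  rewrite /f (le_trans (ler_normB _ _))// lerD//.
    by rewrite normrM -[leRHS]mul1r ler_pM.
  by rewrite mulr1 normrM -[leRHS]mulr1 ler_pM.
have lf : locint f by exact: bounded_locint fB.
have bf : locbnd f by move=> u v; exists (kappa + `|c|) => z _; exact: fB.
have f_out z : r <= `|z| -> f z = 0.
  move=> rz; rewrite /f !indicE !memNset ?mul0r ?mulr0 ?subrr//= in_itv/=.
  - apply/negP; apply: contraTN rz => /andP[z0 z1].
    by rewrite -ltNge ger0_norm// (le_lt_trans z1)// (lt_le_trans _ r2)// ltr1n.
  - apply/negP; apply: contraTN rz => /andP[z0 z1]; rewrite -ltNge ltr_norml.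
    by rewrite (lt_le_trans rx z0) (le_lt_trans z1 yr).
have split_f g : locint (fun z => chi z * g z) -> locint g ->
    oint (fun z => f z * g z) (- r) r = oint (fun z => chi z * g z) x y - c * oint g 0 1.
  move=> lcg lg.
  have l1 (S : set R) (h : R -> R) : measurable S -> locint h -> locint (fun z => \1_S z * h z).
    by move=> mS lh; apply: (locintM lh _ (indB S)).
  rewrite (eq_oint (g := fun z => \1_(`[x, y]%classic) z * (chi z * g z) -
    c * (\1_(`[0, 1]%classic) z * g z))); last by move=> z; rewrite /f; ring.
  rewrite ointB; [|exact: l1|by apply: locintZ; exact: l1].
  rewrite ointZ; last exact: l1.
  rewrite (oint_indic _ xy (ltW rx) (ltW yr)) oint_indic//; lra.
pose phi z := oint f (- r) z.
have phiE u v : phi v - phi u = oint f u v.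
  by rewrite /phi -(oint_cat (- r) u v lf); ring.
have f0 : phi r = 0.
  rewrite /phi (eq_oint (g := fun z => f z * 1)); last by move=> z; rewrite mulr1.
  rewrite split_f; [|by under eq_fun do rewrite mulr1|exact: locint_cst].
  rewrite oint_cst (eq_oint (g := chi)); last by move=> z; rewrite mulr1.
  by rewrite /c; ring.
have phiNr : phi (- r) = 0 by rewrite /phi oint_xx.
have H1phi : H1loc phi f.
  split; last by move=> u v uv; rewrite phiE oint_le.
  apply: L2loc_intro => //.
  apply: (@bounded_locint _ _ ((kappa + `|c|) ^+ 2)); first exact: measurable_funX.
  by move=> z; rewrite normrX ler_sqr ?nnegrE// addr_ge0.
have phi_out z : r < `|z| -> phi z = 0.
  rewrite real_ltr_normr ?num_real// => /orP[rz|rz].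
    rewrite -(subrK (phi r) (phi z)) phiE f0 addr0.
    rewrite (eq_oint_in (g := fun=> 0)) ?oint_cst ?mul0r//; first exact: ltW.
    by move=> u /andP[ru _]; apply: f_out; rewrite (le_trans ru)// ler_norm.
  rewrite -(subrK (phi (- r)) (phi z)) phiE phiNr addr0 ointC.
  rewrite (eq_oint_in (g := fun=> 0)) ?oint_cst ?mul0r ?oppr0//; first by rewrite lerNr ltW.
  by move=> u /andP[_ ru]; apply: f_out; rewrite lerNr in ru; rewrite (le_trans ru)// -normrN ler_norm.
(* Integration by parts trades phi' = f against P_x = w_t. The part of [f] on [[0, 1]] sees only the
   mean of [P] there, which the normalisation of the momentum makes equal to the time integral of
   [q]. *)
have ibp s : oint (fun z => chi z * P z s) x y =
    c * oint q 0 s - \int[mu]_(z in `[- r, r]) (wt z s * phi z).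
  have lcP : locint (fun z => chi z * P z s) by exact: locintM chiB.
  have := oint_product_rule (- r) r lf bf (wt_loc s) phiE (P_x s).
  have lfP : locint (fun z => f z * P z s) by exact: locintM fB.
  have lwp : locint (fun z => wt z s * phi z).
    by apply: locint_continuousM => //; exact: oint_continuous.
  rewrite f0 phiNr !mul0r subrr ointD// split_f// P_mean (oint_le _ rr) => h.
  move: h; set X := oint _ x y; set Y := c * _; set I := Rintegral _ _ _ => h.
  by rewrite -[RHS]addr0 {}h; ring.
have weq := micro_weak_equation sol H1phi phi_out t.
have -> : (fun t => oint (fun z => chi z * P z t) x y) =
    fun s => c * oint q 0 s - \int[mu]_(z in `[- r, r]) (wt z s * phi z).
  by apply/funext.
have -> : oint (fun z => chi z * sigma z t) x y =
    (0 * oint q 0 t + c * q t) - - \int[mu]_(z in `[- r, r]) (A z * wx z t * f z).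
  have lcA : locint (fun z => chi z * (A z * wx z t)) by exact: locintM chiB.
  rewrite -(oint_le _ rr) (eq_oint (f := fun z => A z * wx z t * f z)
    (g := fun z => f z * (A z * wx z t))); last by move=> z; rewrite mulrC.
  rewrite split_f// qE.
  rewrite (eq_oint (f := fun z => chi z * sigma z t)
    (g := fun z => chi z * (A z * wx z t) - abar * chi z)); last first.
    by move=> z; rewrite /sigma; ring.
  rewrite ointB//; last exact: locintZ.
  by rewrite ointZ// -/c; ring.
have dq : is_derive t (1 : R) (oint q 0) (q t) by exact: oint_is_derive.
exact: (is_derive1B (is_derive1M (is_derive_cst c t (1 : R)) dq) weq).
Qed.

Lemma micro_displacement_conservation x y t :
  oint (fun z => d z t - d z 0) x y = oint (fun s => P y s - P x s) 0 t.
Proof.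
have cP : continuous (fun s => oint (wt^~ s) x y).
  have -> : (fun s => oint (wt^~ s) x y) = fun s => P y s - P x s.
    by apply/funext => s; rewrite P_x.
  by move=> s; apply: cvgB; apply: (jcont_r micro_momentum_jcont).
rewrite (eq_oint (f := fun s => P y s - P x s) (g := fun s => oint (wt^~ s) x y)); last first.
  by move=> s; rewrite P_x.
rewrite -(oint_FTC2 0 t cP (w_t x y)) -ointB; [|exact: w_loc..].
by apply: eq_oint => z; rewrite /d /micro_displacement; ring.
Qed.

Lemma micro_momentum_conservation x y t :
  oint (fun z => iA z * (P z t - P z 0)) x y = oint (fun s => d y s - d x s) 0 t.
Proof.
wlog xy : x y / x <= y => [H|].
  have [xy|/ltW yx] := leP x y; first exact: H.
  have ld z : locint (d z) by exact/continuous_locint/jcont_r/micro_displacement_jcont.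
  by rewrite ointC H// ointB// ointB// opprB.
have liA : locint iA by exact: bounded_locint iAN.
have d_x s : d y s - d x s = oint (fun z => iA z * sigma z s) x y.
  have -> : d y s - d x s = (w y s - w x s) - 1 * (y - x) + (G y - G x).
    by rewrite /d /micro_displacement; ring.
  have l2 : locint (fun z => iA z * (A z - abar)).
    by apply: (locintM _ miA iAN); apply: locintB; [exact: bounded_locint AL|exact: locint_cst].
  rewrite w_x GE -oint_cst -ointB; [|exact: wx_loc|exact: locint_cst].
  rewrite -ointD//; last by apply: locintB; [exact: wx_loc|exact: locint_cst].
  apply: eq_oint => z; rewrite /sigma !mulrBr mulrA iAA; ring.
have cd : continuous (fun s => oint (fun z => iA z * sigma z s) x y).
  have -> : (fun s => oint (fun z => iA z * sigma z s) x y) = fun s => d y s - d x s.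
    by apply/funext => s; rewrite d_x.
  by move=> s; apply: cvgB; apply: (jcont_r micro_displacement_jcont).
rewrite (eq_oint (f := fun s => d y s - d x s)
  (g := fun s => oint (fun z => iA z * sigma z s) x y)); last exact: d_x.
rewrite -(oint_FTC2 0 t cd (fun s => micro_moment_is_derive s xy miA iAN)).
have lP s : locint (fun z => iA z * P z s) by exact: locintM iAN.
by rewrite -ointB//; apply: eq_oint => z; rewrite mulrBr.
Qed.

Lemma micro_flux_continuous (chi : R -> R) (kappa : R) x y :
  measurable_fun [set: R] chi -> (forall z, `|chi z| <= kappa) ->
  continuous (fun t => oint (fun z => chi z * sigma z t) x y).
Proof.
move=> mchi chiB.
have kappa0 : 0 <= kappa by exact: le_trans (chiB 0).
have cAB z : `|chi z * A z| <= kappa * Lam by rewrite normrM ler_pM.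
have lchi : locint chi by exact: bounded_locint chiB.
have -> : (fun t => oint (fun z => chi z * sigma z t) x y) =
    fun t => oint (fun z => (chi z * A z) * wx z t) x y - abar * oint chi x y.
  apply/funext => t; rewrite -ointZ// -ointB;
    [|by apply: locintM cAB => //; exact: measurable_funM|exact: locintZ].
  by apply: eq_oint => z; rewrite /sigma; ring.
move=> t; apply: cvgB; last exact: cvg_cst.
apply: (L2loc_cvg_continuous wx_L2 (micro_wx_continuous sol) _ cAB).
exact: measurable_funM.
Qed.

End micro_problem.

(** * The averaging kernel and the flux error *)

Section averaging_kernel.
Context {R : realType}.
Notation mu := (@lebesgue_measure R).
Implicit Types (F G f g : R -> R) (x y z t tau : R).

(** Composition with this retraction extends a function from [[-1, 1]] continuously to the line and
    ignores its values elsewhere. *)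
Definition clamp x : R := Num.max (-1) (Num.min x 1).

Lemma clamp_itv x : clamp x \in `[(-1 : R), 1].
Proof.
rewrite in_itv/= /clamp le_max lexx /= ge_max ge_min lexx orbT andbT; lra.
Qed.

Lemma clamp_id x : -1 <= x <= 1 -> clamp x = x.
Proof. by move=> /andP[x0 x1]; rewrite /clamp (min_idPl x1) (max_idPr x0). Qed.

Lemma clamp_lipschitz x y : `|clamp x - clamp y| <= `|x - y|.
Proof.
have h1 := ler_norm (x - y); have h2 := ler_norm (y - x).
rewrite distrC in h2.
rewrite ler_norml /clamp; case: (leP x 1) => a1; case: (leP y 1) => a2;
  rewrite ?(max_idPr (_ : -1 <= 1)) ?lerN10 ?(le_trans (lerN10 _))//;
  (try case: (leP (-1) x) => a3); (try case: (leP (-1) y) => a4);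
  apply/andP; split; lra.
Qed.

Lemma continuous_clamp f : {within `[(-1 : R), 1], continuous f} ->
  continuous (f \o clamp).
Proof.
move=> cf x; apply/continuous_atE => e e0.
have cx : `[(-1 : R), 1]%classic (clamp x) by exact: clamp_itv.
have /cvgrPdist_lt/(_ e e0) := (subspace_continuousP _ _).1 cf _ cx.
move=> [d /= d0 H]; exists d => // y yx /=.
rewrite distrC; apply: H; last exact: clamp_itv.
by rewrite /ball_/= distrC (le_lt_trans (clamp_lipschitz _ _)).
Qed.

Lemma clamp_bounded f : {within `[(-1 : R), 1], continuous f} ->
  exists2 M : R, 0 <= M & forall x, `|(f \o clamp) x| <= M.
Proof.
move=> cf; have cfc := continuous_clamp cf.
have [M M0 fM] := continuous_bounded (-1) 1 cfc.
exists M => // x; have := fM (clamp x) (clamp_itv x).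
by rewrite /= clamp_id//; exact: clamp_itv.
Qed.

(** [F] is differentiable only in the open interval, as the kernel provides; the mean value theorem
    asks for continuity alone at the end points. *)
Lemma oint_by_parts F G f g x y : x <= y -> continuous F -> continuous f ->
  continuous g -> (forall z, x < z < y -> is_derive z (1 : R) F (f z)) ->
  (forall z, is_derive z (1 : R) G (g z)) ->
  oint (fun z => F z * g z) x y = F y * G y - F x * G x - oint (fun z => f z * G z) x y.
Proof.
move=> xy cF cf cg dF dG.
have cG : continuous G by exact: is_derive1_continuous dG.
have cfG : continuous (fun z => f z * G z) by move=> z; apply: cvgM; [exact: cf|exact: cG].
have cFg : continuous (fun z => F z * g z) by move=> z; apply: cvgM; [exact: cF|exact: cg].
have cs : continuous (fun z => f z * G z + F z * g z).
  by move=> z; apply: cvgD; [exact: cfG|exact: cFg].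
pose H z := F z * G z - oint (fun z => f z * G z + F z * g z) x z.
have dH z : x < z < y -> is_derive z (1 : R) H (f z * G z + F z * g z - (f z * G z + F z * g z)).
  move=> zxy; apply: is_derive1B; last exact: oint_is_derive.
  by apply: is_derive1M => //; exact: dF.
have cH : {within `[x, y], continuous H}.
  apply: continuous_subspaceT => z; apply: cvgB.
    by apply: cvgM; [exact: cF|exact: cG].
  exact/oint_continuous/continuous_locint.
have dH' z : z \in `]x, y[ -> is_derive z (1 : R) H (f z * G z + F z * g z - (f z * G z + F z * g z)).
  by rewrite in_itv/=; exact: dH.
have [c _] := MVT_segment xy dH' cH.
rewrite subrr mul0r /H oint_xx subr0 ointD; [|exact: continuous_locint..].
set X := oint (fun z => f z * G z) x y; set Y := oint _ x y => h.
by rewrite -[RHS]subr0 -h; ring.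
Qed.

(** The [+ 0] gives the argument the shape [k * t + b] of [oint_affine] and [is_derive_affine]. *)
Definition scaled_kernel f tau t : R := (f \o clamp) (tau^-1 * t + 0).

Variables (q : nat) (dK : nat -> R -> R).
Hypothesis dK_derive : forall l, (l < q)%N -> {in `](-1 : R), 1[, forall x,
  is_derive x (1 : R) (dK l) (dK l.+1 x)}.
Hypothesis dK_cont : forall l, (l <= q)%N -> {within `[(-1 : R), 1], continuous (dK l)}.
Hypothesis dK_bound : forall l, (l <= q)%N -> dK l (-1) = 0 /\ dK l 1 = 0.

Let kern_continuous l tau : (l <= q)%N -> continuous (scaled_kernel (dK l) tau).
Proof.
move=> lq x; apply: (@continuous_comp _ _ _ (fun t => tau^-1 * t + 0) (dK l \o clamp)).
  by apply: cvgD; [apply: cvgM; [exact: cvg_cst|exact: cvg_id]|exact: cvg_cst].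
exact/continuous_clamp/dK_cont.
Qed.

Let kern_derive l tau t : (l < q)%N -> 0 < tau -> - tau < t < tau ->
  is_derive t (1 : R) (scaled_kernel (dK l) tau) (tau^-1 * scaled_kernel (dK l.+1) tau t).
Proof.
move=> lq tau0 /andP[t1 t2].
have inI s : - tau < s < tau -> -1 < tau^-1 * s + 0 < 1.
  move=> /andP[s1 s2]; rewrite addr0 mulrC ltr_pdivrMr// ltr_pdivlMr//.
  by rewrite mulN1r mul1r s1.
have d1 : is_derive (tau^-1 * t + 0) (1 : R) (dK l) (dK l.+1 (tau^-1 * t + 0)).
  have h := inI t (introT andP (conj t1 t2)).
  by apply: dK_derive => //; rewrite ?inE/= ?in_itv/= h.
have d2 := @is_derive1_comp R (dK l) (fun t => tau^-1 * t + 0) t _ _ d1 (is_derive_affine t tau^-1 0).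
rewrite /scaled_kernel /= clamp_id; last first.
  by have /andP[h1 h2] := inI t (introT andP (conj t1 t2)); rewrite !ltW.
rewrite mulrC; apply: near_eq_is_derive d2.
near=> s; rewrite /= clamp_id//.
suff /inI /andP[h1 h2] : - tau < s < tau by rewrite !ltW.
apply/andP; split; near: s.
- exact: (cvgr_gt t cvg_id).
- exact: (cvgr_lt t cvg_id).
Unshelve. all: by end_near. Qed.

(** Each integration by parts contributes [- tau^-1], and the boundary terms vanish with the kernel
    derivatives at -1 and 1. *)
Lemma kernel_moment_by_parts (m : nat -> R -> R) tau : 0 < tau ->
  (forall n, continuous (m n)) -> (forall n t, is_derive t (1 : R) (m n.+1) (m n t)) ->
  oint (fun t => scaled_kernel (dK 0) tau t * m 0 t) (- tau) tau =
  (- tau^-1) ^+ q * oint (fun t => scaled_kernel (dK q) tau t * m q t) (- tau) tau.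
Proof.
move=> tau0 cm dm.
have kb l : (l <= q)%N -> scaled_kernel (dK l) tau (- tau) = 0 /\ scaled_kernel (dK l) tau tau = 0.
  move=> lq; have [h1 h2] := dK_bound lq.
  by rewrite /scaled_kernel /= !addr0 mulrN mulVf ?gt_eqF// !clamp_id
    ?lexx ?lerN10 ?(le_trans (lerN10 _))//= ler0N1.
suff H l : (l <= q)%N -> oint (fun t => scaled_kernel (dK 0) tau t * m 0 t) (- tau) tau =
  (- tau^-1) ^+ l * oint (fun t => scaled_kernel (dK l) tau t * m l t) (- tau) tau by exact: H.
elim: l => [_|l IH lq]; first by rewrite expr0 mul1r.
rewrite IH ?(ltnW lq)//.
have [h1 h2] := kb l (ltnW lq).
have ck1 : continuous (fun t => tau^-1 * scaled_kernel (dK l.+1) tau t).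
  by move=> t; apply: cvgM; [exact: cvg_cst|exact: kern_continuous].
have tt : - tau <= tau by lra.
rewrite (oint_by_parts tt (kern_continuous (tau := tau) (ltnW lq)) ck1 (cm l)
  (fun z zz => kern_derive lq tau0 zz) (dm l)).
rewrite h1 h2 !mul0r subrr sub0r exprSr -mulrA; congr (_ * _).
rewrite mulNr -ointZ; last first.
  apply: continuous_locint => t; apply: cvgM; [exact: kern_continuous|exact: cm].
by congr (- _); apply: eq_oint => t; rewrite mulrA.
Qed.

End averaging_kernel.

(** * Error of the averaged flux *)

Section flux_error.
Context {R : realType}.
Notation mu := (@lebesgue_measure R).
Variables (a : R -> R) (m Lam : R).
Hypothesis (m0 : 0 < m) (am : forall y, m <= a y) (aLam : forall y, a y <= Lam).
Hypothesis (ma : measurable_fun [set: R] a) (pa : periodic a 1).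

Let abar := homogenized_coef a.
Let ia y := (a y)^-1.

Let a0 y : 0 < a y. Proof. exact: lt_le_trans (am y). Qed.
Let Lam0 : 0 < Lam. Proof. exact: lt_le_trans (a0 0) (aLam 0). Qed.

Let ia_le y : ia y <= m^-1.
Proof. by rewrite lef_pV2// posrE. Qed.

Let ia_ge y : Lam^-1 <= ia y.
Proof. by rewrite lef_pV2// posrE. Qed.

Let ia0 y : 0 < ia y. Proof. by rewrite invr_gt0. Qed.

Let ia_norm y : `|ia y| <= m^-1. Proof. by rewrite ger0_norm// ltW. Qed.

Let mia : measurable_fun [set: R] ia.
Proof.
(* Inversion is continuous away from zero; truncating below at [m] leaves the values of [a]
   unchanged. *)
have -> : ia = (fun s => (Num.max s m)^-1) \o a.
  by apply/funext => y; rewrite /ia /= (max_idPl (am y)).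
apply: measurableT_comp => //; apply: continuous_measurable_fun => s.
apply: cvgV; first by rewrite gt_eqF// lt_max m0 orbT.
by apply: continuous_max; [exact: cvg_id|exact: cvg_cst].
Qed.

Let lia : locint ia. Proof. exact: bounded_locint mia ia_norm. Qed.

Let ia_mean : 0 < oint ia 0 1 /\ abar = (oint ia 0 1)^-1.
Proof.
split; last by rewrite oint_le.
apply: (@lt_le_trans _ _ (oint (fun=> Lam^-1) 0 1)).
  by rewrite oint_cst subr0 mulr1 invr_gt0.
by apply: le_oint => //; exact: locint_cst.
Qed.

Lemma homogenized_coef_gt0 : 0 < abar.
Proof. by have [h ->] := ia_mean; rewrite invr_gt0. Qed.

Variables (K : R -> R) (dK : nat -> R -> R) (q : nat).
Hypothesis dK0 : {in `[(-1 : R), 1], dK 0%N =1 K}.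
Hypothesis dK_derive : forall l, (l < q.+1)%N -> {in `](-1 : R), 1[, forall x,
  is_derive x (1 : R) (dK l) (dK l.+1 x)}.
Hypothesis dK_cont : forall l, (l <= q.+1)%N -> {within `[(-1 : R), 1], continuous (dK l)}.
Hypothesis dK_bound : forall l, (l <= q.+1)%N -> dK l (-1) = 0 /\ dK l 1 = 0.
Hypothesis K_mass : \int[mu]_(x in `[-1, 1]) K x = 1.
Variables (kappa kappa' : R).
Hypothesis kappaB : forall x, `|(dK 0 \o clamp) x| <= kappa.
Hypothesis kappaB' : forall x, `|(dK q.+1 \o clamp) x| <= kappa'.

Let kern_cont l tau : (l <= q.+1)%N -> continuous (scaled_kernel (dK l) tau).
Proof.
move=> lq x; apply: (@continuous_comp _ _ _ (fun t => tau^-1 * t + 0) (dK l \o clamp)).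
  by apply: cvgD; [apply: cvgM; [exact: cvg_cst|exact: cvg_id]|exact: cvg_cst].
exact/continuous_clamp/dK_cont.
Qed.

Let kern_mass tau : 0 < tau -> oint (scaled_kernel (dK 0) tau) (- tau) tau = tau.
Proof.
move=> tau0; rewrite /scaled_kernel.
have mK : measurable_fun [set: R] (dK 0 \o clamp).
  by apply: continuous_measurable_fun; exact/continuous_clamp/dK_cont.
have ti : 0 < tau^-1 by rewrite invr_gt0.
rewrite (@oint_affine R tau^-1 0 ti _ kappa)//.
rewrite !addr0 mulrN mulVf ?gt_eqF// invrK.
suff -> : oint (dK 0 \o clamp) (-1) 1 = 1 by rewrite mulr1.
rewrite -[RHS]K_mass (oint_le _ (le_trans (lerN10 R) ler01)).
apply: eq_Rintegral => x; rewrite inE/= => x1.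
by rewrite /= clamp_id//; apply: dK0; rewrite ?inE/= ?in_itv.
Qed.

Let kernE tau x : 0 < tau -> - tau <= x <= tau -> scaled_kernel (dK 0) tau x = K (x / tau).
Proof.
move=> tau0 /andP[x1 x2].
have h : -1 <= x / tau <= 1.
  by rewrite ler_pdivlMr// ler_pdivrMr// mulN1r mul1r x1.
rewrite /scaled_kernel /= addr0 mulrC clamp_id//.
by apply: dK0; rewrite ?inE/= ?in_itv.
Qed.

(** The factor [2 * kappa'] comes from the time average, [kappa] and the energy constant from the
    space moment, [Lam + abar] bounds the initial flux, and the power is the price of the periodic
    primitives. In this section the kernel has [q.+1] derivatives. *)
Definition flux_constant :=
  2 * kappa' * kappa * energy_constant (Lam + 1) (Lam^-1) (m^-1) * (Lam + abar) *
  (1 + m^-1) ^+ q.+1.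

Variables (eps eta X : R) (A : R -> R) (w wx wt : R -> R -> R).
Hypothesis (eps0 : 0 < eps) (eta0 : 0 < eta) (AE : forall z, A z = a ((X + z) / eps)).
Hypothesis sol : micro_solution A w wx wt.

Let epsi0 : 0 < eps^-1. Proof. by rewrite invr_gt0. Qed.

Let AE' z : A z = a (eps^-1 * z + X / eps).
Proof. by rewrite AE; congr a; rewrite mulrDl addrC (mulrC z). Qed.

Let iA z := (A z)^-1.
Let iAE z : iA z = ia (eps^-1 * z + X / eps). Proof. by rewrite /iA AE'. Qed.

Let maff : measurable_fun [set: R] (fun z => eps^-1 * z + X / eps).
Proof.
apply: continuous_measurable_fun => z.
by apply: cvgD; [apply: cvgM; [exact: cvg_cst|exact: cvg_id]|exact: cvg_cst].
Qed.

Let mA : measurable_fun [set: R] A.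
Proof.
have -> : A = a \o (fun z => eps^-1 * z + X / eps) by apply/funext => z; rewrite AE'.
exact: measurableT_comp.
Qed.

Let miA : measurable_fun [set: R] iA.
Proof.
have -> : iA = ia \o (fun z => eps^-1 * z + X / eps) by apply/funext => z; rewrite iAE.
exact: measurableT_comp.
Qed.

Let iAN z : iA z <= m^-1. Proof. by rewrite iAE. Qed.
Let iAk z : Lam^-1 <= iA z. Proof. by rewrite iAE. Qed.
Let iAn z : `|iA z| <= m^-1. Proof. by rewrite iAE. Qed.
Let iAA z : iA z * A z = 1. Proof. by rewrite /iA mulVf// AE gt_eqF. Qed.
Let An z : `|A z| <= Lam. Proof. by rewrite AE ger0_norm// ltW. Qed.
Let AL z : `|A z - abar| <= Lam + abar.
Proof.
rewrite (le_trans (ler_normB _ _))// lerD// ger0_norm// ltW//.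
exact: homogenized_coef_gt0.
Qed.

Let pA : periodic A eps.
Proof.
move=> z; rewrite !AE' mulrDr mulVf ?gt_eqF// addrAC; exact: pa.
Qed.

Let piA : periodic iA eps. Proof. by move=> z; rewrite /iA pA. Qed.

Let liA : locint iA. Proof. exact: bounded_locint miA iAn. Qed.

(** Here the harmonic mean enters: the integrand is 1 - abar / A, and abar is the value that makes
    its integral over a period vanish. *)
Let A_mean : oint (fun z => iA z * (A z - abar)) 0 eps = 0.
Proof.
rewrite (eq_oint (g := fun z => 1 - abar * iA z)); last first.
  by move=> z; rewrite mulrBr iAA mulrC.
rewrite ointB; [|exact: locint_cst|exact: locintZ].
rewrite oint_cst ointZ// (eq_oint (f := iA) (g := fun z => ia (eps^-1 * z + X / eps)))//.
rewrite (@oint_affine R eps^-1 (X / eps) epsi0 ia m^-1)// invrK mulr0 add0r.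
rewrite mulVf ?gt_eqF// [1 + _]addrC (@oint_period R ia 1 m^-1)//; last first.
  by move=> y; rewrite /ia pa.
have [h ->] := ia_mean.
by field; rewrite gt_eqF.
Qed.

Let idata := init_data iA A eps abar.
(** The shift by one starts the tower at the first primitives: the raw data at level 0 of
    [init_data] are only bounded, the next ones are continuous. *)
Let G n := (idata n.+1).1.
Let F n := (idata n.+1).2.
Let iLam0 : 0 < Lam^-1. Proof. by rewrite invr_gt0. Qed.

Let init_c n := init_data_continuous eps0 iLam0 miA mA iAN iAk AL piA pA A_mean n.
Let init_p n := init_data_primitive eps0 iLam0 miA mA iAN iAk AL piA pA A_mean n.
Let init_b n := init_data_bound eps0 iLam0 miA mA iAN iAk AL piA pA A_mean n.

Let cG n : continuous (G n). Proof. by have [] := init_c n. Qed.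
Let cF n : continuous (F n). Proof. by have [] := init_c n. Qed.
Let G0E x y : G 0 y - G 0 x = oint (fun z => iA z * (A z - abar)) x y.
Proof. by have [] := init_p 0 x y. Qed.
Let GE n x y : G n.+1 y - G n.+1 x = oint (fun z => iA z * F n z) x y.
Proof. by have [] := init_p n.+1 x y. Qed.
Let FE n x y : F n.+1 y - F n.+1 x = oint (G n) x y.
Proof. by have [] := init_p n.+1 x y. Qed.

Let d1 := micro_displacement w (G 0).
Let P1 := micro_momentum A wx wt abar.
Let cd1 : jcont d1. Proof. exact: micro_displacement_jcont (@cG 0%N) sol. Qed.
Let cP1 : jcont P1. Proof. exact: micro_momentum_jcont mA An sol. Qed.
Let d1_0 x : d1 x 0 = G 0 x. Proof. exact: (micro_displacement0 _ sol). Qed.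
Let P1_0 x : P1 x 0 = F 0 x.
Proof. by rewrite /F /idata init_data1_2; exact: (micro_momentum0 _ sol). Qed.

Let d1_cons x y t :
  oint (fun z => d1 z t - d1 z 0) x y = oint (fun s => P1 y s - P1 x s) 0 t.
Proof. exact: (micro_displacement_conservation _ _ mA An sol). Qed.

Let P1_cons x y t :
  oint (fun z => iA z * (P1 z t - P1 z 0)) x y = oint (fun s => d1 y s - d1 x s) 0 t.
Proof. exact: (micro_momentum_conservation mA An miA iAn iAA (@cG 0%N) G0E sol). Qed.

Let dT := time_primitive G d1.
Let PT := time_primitive F P1.

Let pair n : wave_pair iA (dT n.+1) (PT n.+1) (dT n) (PT n).
Proof. exact: (time_primitive_wave_pair liA cG cF GE FE cd1 cP1 d1_0 P1_0 d1_cons P1_cons). Qed.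

Let chi := scaled_kernel (dK 0) eta.
Let chiB z : `|chi z| <= kappa. Proof. exact: kappaB. Qed.
Let mchi : measurable_fun [set: R] chi.
Proof. by apply: continuous_measurable_fun; exact: kern_cont. Qed.
Let lchi : locint chi. Proof. exact: bounded_locint mchi chiB. Qed.

(** Order 0 is the flux itself, which is not a member of the tower of continuous functions; order
    [n.+1] uses level [n] of the tower. *)
Let moment n t : R :=
  if n is n'.+1 then oint (fun z => chi z * PT n' z t) (- eta) eta
  else oint (fun z => chi z * (A z * wx z t - abar)) (- eta) eta.

Let moment_continuous n : continuous (moment n).
Proof.
case: n => [|n]; first exact: (micro_flux_continuous mA An sol mchi chiB).
by apply: oint_jcont => //; have [] := pair n.
Qed.

Let eta_sym : - eta <= eta. Proof. by move: eta0 => h; lra. Qed.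

Let moment_is_derive n t : is_derive t (1 : R) (moment n.+1) (moment n t).
Proof.
case: n => [|n].
  exact: (micro_moment_is_derive _ mA An sol _ eta_sym mchi chiB).
by have [_ cP _ cPt _ dP _ _] := pair n; exact: is_derive_oint_jcont.
Qed.

Let moment_bound t : `|t| <= eta -> `|moment q.+1 t| <=
  kappa * energy_constant (Lam + 1) (Lam^-1) (m^-1) *
  ((Lam + abar) * ((1 + m^-1) * eps) ^+ q.+1) * eta.
Proof.
move=> te.
have c0 : 0 <= Lam + 1 by rewrite addr_ge0// ltW.
(* The wave speed is at most the square root of [Lam], and [Lam + 1] exceeds it without a root in
   the constant. *)
have ck : 1 <= (Lam + 1) ^+ 2 * Lam^-1.
  rewrite ler_pdivlMr// mul1r; have := Lam0; nra.
have init n x : dT n x 0 = G n x /\ PT n x 0 = F n x by exact: time_primitive0.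
(* [PT q] is the time derivative in [pair q], and its initial values are the data of level [q.+1],
   of order [eps ^+ q.+1]. *)
apply: (wave_pair_derivative_moment miA iAN iAk iLam0 c0 ck eta0 mchi chiB (pair q)) => //.
- apply: mulr_ge0; first exact: le_trans (AL 0).
  by rewrite exprn_ge0// mulr_ge0 ?addr_ge0 ?invr_ge0// ltW.
- by move=> x _; rewrite (init q x).1; have [] := init_b q.+1 x.
- by move=> x _; rewrite (init q x).2; have [] := init_b q.+1 x.
Qed.

Lemma hmm_flux_error :
  `|abar - hmm_flux K eta eta A wx| <= flux_constant * (eps / eta) ^+ q.+1.
Proof.
pose J := oint (fun t => scaled_kernel (dK 0) eta t * moment 0 t) (- eta) eta.
(* The scaled kernel has mass [eta] in each variable, so the constant abar is reproduced exactly and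
   only the moment of sigma remains. *)
have fluxE : hmm_flux K eta eta A wx = (eta * eta)^-1 * J + abar.
  have wxL t : locint (wx^~ t) by apply: L2loc_locint; have [] := micro_H1 sol t.
  have AwxL t : locint (fun z => A z * wx z t) by exact: locintM An.
  have chiAwxL t : locint (fun z => chi z * (A z * wx z t)) by exact: locintM chiB.
  have inner t : - eta <= t <= eta ->
      \int[mu]_(x in `[- eta, eta]) (K (x / eta) * K (t / eta) * A x * wx x t) =
      scaled_kernel (dK 0) eta t * (moment 0 t + abar * eta).
    move=> te; rewrite -(oint_le _ eta_sym).
    rewrite (eq_oint_in (g := fun x => scaled_kernel (dK 0) eta t * (chi x * (A x * wx x t))) eta_sym).
      rewrite ointZ//; congr (_ * _).
      rewrite /moment (eq_oint (f := fun z => chi z * (_ - _))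
        (g := fun z => chi z * (A z * wx z t) - abar * chi z)); last by move=> z; ring.
      by rewrite ointB//; [rewrite ointZ// kern_mass// subrK|exact: locintZ].
    by move=> x xe; rewrite /chi !kernE//; ring.
  have ck0 : continuous (scaled_kernel (dK 0) eta) by exact: kern_cont.
  have cm0 := @moment_continuous 0%N.
  have lkm : locint (fun t => scaled_kernel (dK 0) eta t * moment 0 t).
    by apply: continuous_locint => t; apply: cvgM; [exact: ck0|exact: cm0].
  have lk : locint (scaled_kernel (dK 0) eta) by exact: continuous_locint.
  rewrite /hmm_flux -(oint_le _ eta_sym).
  rewrite (eq_oint_in (g := fun t => scaled_kernel (dK 0) eta t * moment 0 t +
     (abar * eta) * scaled_kernel (dK 0) eta t) eta_sym); last first.
    by move=> t te; rewrite inner// mulrDr (mulrC _ (abar * eta)).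
  rewrite ointD//; last exact: locintZ.
  rewrite ointZ// kern_mass// -/J mulrDr; congr (_ + _).
  by field; rewrite gt_eqF.
have JE : J = (- eta^-1) ^+ q.+1 *
    oint (fun t => scaled_kernel (dK q.+1) eta t * moment q.+1 t) (- eta) eta.
  exact: (kernel_moment_by_parts dK_derive dK_cont dK_bound eta0 moment_continuous moment_is_derive).
set M := kappa * energy_constant (Lam + 1) (Lam^-1) (m^-1) *
  ((Lam + abar) * ((1 + m^-1) * eps) ^+ q.+1) * eta.
(* One [eta] sits in [M] and another in the length of the time interval; they cancel the prefactor
   of the flux and leave the powers of [eps / eta]. *)
have JB : `|J| <= (eta^-1) ^+ q.+1 * (kappa' * M * (2 * eta)).
  rewrite JE normrM normrX normrN (ger0_norm (_ : 0 <= eta^-1)) ?invr_ge0 ?(ltW eta0)//.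
  rewrite ler_wpM2l ?exprn_ge0 ?invr_ge0 ?(ltW eta0)//.
  have -> : 2 * eta = `|eta - - eta| by rewrite ger0_norm opprK; [ring|rewrite addr_ge0// ltW].
  apply: norm_oint_bound.
    apply: continuous_locint => t; apply: cvgM; last exact: moment_continuous.
    exact: kern_cont.
  move=> t h; rewrite normrM ler_pM//; first exact: kappaB'.
  apply: moment_bound; rewrite ler_norml.
  case/orP: h => // /andP[h1 h2]; have := eta0; lra.
rewrite fluxE opprD addrCA subrr addr0 normrN normrM ger0_norm; last first.
  by rewrite invr_ge0 mulr_ge0// ltW.
have e2 : 0 <= (eta * eta)^-1 by rewrite invr_ge0 mulr_ge0// ltW.
apply: (le_trans (ler_wpM2l e2 JB)); rewrite le_eqVlt; apply/orP; left; apply/eqP.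
rewrite /M /flux_constant !exprMn.
by field; rewrite gt_eqF.
Qed.

End flux_error.

(** * The discrete Helmholtz equation *)

Section discrete_laplacian_spectrum.
Context {R : realType}.
Variables (M : nat) (H : R).
Hypotheses (M0 : (0 < M)%N) (H0 : 0 < H).

Definition sine_angle (k : nat) : R := pi * k.+1%:R / M.+1%:R.

Definition sine_row (k : 'I_M) : 'rV[R]_M := \row_j sin (sine_angle k * j.+1%:R).

Definition sine_eigenvalue (k : nat) : R := (2 * cos (sine_angle k) - 2) / H ^+ 2.

Let angle_itv k : (k < M)%N -> 0 < sine_angle k < pi.
Proof.
move=> kM; have h : 0 < (M.+1%:R : R) by rewrite ltr0n.
rewrite /sine_angle divr_gt0 ?mulr_gt0 ?pi_gt0 ?ltr0n//=.
by rewrite ltr_pdivrMr// ltr_pM2l ?pi_gt0// ltr_nat.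
Qed.

Lemma sine_eigenvalue_lt0 k : (k < M)%N -> sine_eigenvalue k < 0.
Proof.
move=> /angle_itv /andP[t0 t1]; rewrite /sine_eigenvalue pmulr_llt0 ?invr_gt0 ?exprn_gt0//.
rewrite subr_lt0 -[ltRHS]mulr1 ltr_pM2l// lt_neqAle cos_le1 andbT.
apply/eqP => c1; have := cos2Dsin2 (sine_angle k).
rewrite c1 expr1n -[RHS]addr0 => /addrI/eqP; rewrite sqrf_eq0.
by rewrite gt_eqF// sin_gt0_pi// t0.
Qed.

Lemma sine_eigenvalue_inj (k l : 'I_M) : sine_eigenvalue k = sine_eigenvalue l -> k = l.
Proof.
move=> h; have H2 : (H ^+ 2)^-1 != 0 by rewrite invr_eq0 expf_neq0// gt_eqF.
have /addIr/(mulfI _) := mulIf H2 h.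
rewrite pnatr_eq0 => /(_ isT) c.
have /andP[k0 k1] := angle_itv (ltn_ord k); have /andP[l0 l1] := angle_itv (ltn_ord l).
have /(congr1 (fun x => x * M.+1%:R / pi)) : sine_angle k = sine_angle l.
  by apply: cos_inj => //; rewrite in_itv/= !ltW.
have p0 : (pi : R) != 0 by rewrite gt_eqF// pi_gt0.
rewrite /sine_angle !mulfVK ?pnatr_eq0// ![pi * _]mulrC !mulfK//.
by move=> /eqP; rewrite eqr_nat eqSS => /eqP kl; exact: val_inj.
Qed.

Let sum_delta (g : nat -> R) m :
  \sum_(j < M) (m == j :> nat)%:R * g j = if (m < M)%N then g m else 0.
Proof.
case: ifPn => mM; last first.
  apply: big1 => j _; rewrite (_ : (m == j :> nat) = false) ?mul0r//.
  by apply: contraNF mM => /eqP ->.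
rewrite (bigD1 (Ordinal mM))//= eqxx mul1r big1 ?addr0// => j jm.
rewrite (_ : (m == j :> nat) = false) ?mul0r//.
by apply: contraNF jm => /eqP mj; apply/eqP/val_inj.
Qed.

Let sin_pi_natmul n : sin (pi * n%:R) = 0 :> R.
Proof.
elim: n => [|n IH]; first by rewrite mulr0 sin0.
by rewrite -addn1 natrD mulrDr mulr1 sinDpi IH oppr0.
Qed.

Lemma D2_sym : (D2 M H)^T = D2 M H.
Proof.
apply/matrixP => i j; rewrite !mxE; congr (_ / _).
by rewrite (eq_sym j i) (eq_sym (nat_of_ord i)) (eq_sym i.+1); ring.
Qed.

Lemma sine_row_eigen k : sine_row k *m D2 M H = sine_eigenvalue k *: sine_row k.
Proof.
apply/rowP => i; rewrite !mxE.
set t := sine_angle k; pose g j : R := sin (t * j.+1%:R).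
have gE j : (sine_row k) 0 j = g j by rewrite mxE.
transitivity ((\sum_(j < M) (i.+1 == j :> nat)%:R * g j - 2 * (\sum_(j < M) (i == j :> nat)%:R * g j)
   + \sum_(j < M) (i == j.+1 :> nat)%:R * g j) / H ^+ 2).
  rewrite mulr_sumr -sumrB -big_split /= mulr_suml; apply: eq_bigr => j _.
  by rewrite gE mxE -val_eqE /=; ring.
rewrite !sum_delta ltn_ord.
(* In the last row the missing neighbour is the boundary value, a sine of a multiple of pi; in the
   first row it is sin 0. *)
have up : (if (i.+1 < M)%N then g i.+1 else 0) = g i.+1.
  case: ifPn => //; rewrite -leqNgt => Mi.
  have -> : i.+1 = M by apply/eqP; rewrite eqn_leq ltn_ord Mi.
  by rewrite /g /t /sine_angle divfK ?pnatr_eq0// sin_pi_natmul.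
have down : \sum_(j < M) (i == j.+1 :> nat)%:R * g j = sin (t * i%:R).
  case: (nat_of_ord i) (ltn_ord i) => [_|i' iM].
    by rewrite mulr0 sin0; apply: big1 => j _; rewrite mul0r.
  by under eq_bigr do rewrite eqSS; rewrite sum_delta (ltnW iM).
rewrite up down /sine_eigenvalue -/t /g.
have e1 : t * i.+2%:R = t * i.+1%:R + t by rewrite -addn1 natrD mulrDr mulr1.
have e2 : t * i%:R = t * i.+1%:R - t by rewrite -[in RHS]addn1 natrD mulrDr mulr1 addrK.
rewrite e1 e2 sinD sinB; ring.
Qed.

Definition sine_norm2 k : R := (sine_row k *m (sine_row k)^T) 0 0.

Let norm2_gt0 k : 0 < sine_norm2 k.
Proof.
rewrite /sine_norm2 mxE (bigD1 (Ordinal M0))//= !mxE mulr1.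
rewrite ltr_pwDl//.
  have /andP[t0 t1] := angle_itv (ltn_ord k).
  by rewrite mulr_gt0// sin_gt0_pi// t0.
by apply: sumr_ge0 => j _; rewrite !mxE -expr2 sqr_ge0.
Qed.

(** [D2] is symmetric and the eigenvalues are distinct, so no trigonometric sum has to be
    evaluated. *)
Let orthogonal k l : k != l -> sine_row k *m (sine_row l)^T = 0.
Proof.
move=> kl; apply/eqP.
have : sine_row k *m D2 M H *m (sine_row l)^T = sine_row k *m (sine_row l *m D2 M H)^T.
  by rewrite trmx_mul D2_sym mulmxA.
rewrite !sine_row_eigen -scalemxAl linearZ/= -scalemxAr => /eqP.
rewrite -subr_eq0 -scalerBl scaler_eq0 subr_eq0 => /orP[/eqP/sine_eigenvalue_inj kl'|//].
by rewrite kl' eqxx in kl.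
Qed.

Definition sine_basis : 'M[R]_M :=
  \matrix_(k, j) ((Num.sqrt (sine_norm2 k))^-1 * sine_row k 0 j).

Lemma sine_basis_orthogonal : sine_basis *m sine_basis^T = 1%:M.
Proof.
apply/matrixP => k l; rewrite !mxE.
transitivity ((Num.sqrt (sine_norm2 k))^-1 * (Num.sqrt (sine_norm2 l))^-1 *
   (sine_row k *m (sine_row l)^T) 0 0).
  rewrite [in RHS]mxE mulr_sumr; apply: eq_bigr => j _; rewrite !mxE.
  by ring.
have [->|kl] := eqVneq k l; last by rewrite orthogonal// mxE mulr0.
rewrite -[_ 0 0]/(sine_norm2 l) -invfM -expr2 sqr_sqrtr ?(ltW (norm2_gt0 l))// mulVf//.
by rewrite gt_eqF.
Qed.

Lemma sine_basis_norm (u : 'cV[R]_M) :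
  \sum_k (sine_basis *m u) k 0 ^+ 2 = \sum_k u k 0 ^+ 2.
Proof.
have nrm (x : 'cV[R]_M) : \sum_k x k 0 ^+ 2 = (x^T *m x) 0 0.
  by rewrite mxE; apply: eq_bigr => k _; rewrite mxE expr2.
rewrite !nrm trmx_mul mulmxA -[u^T *m _ *m _]mulmxA.
by rewrite (mulmx1C sine_basis_orthogonal) mulmx1.
Qed.

Lemma sine_basis_D2 (u : 'cV[R]_M) k :
  (sine_basis *m (D2 M H *m u)) k 0 = sine_eigenvalue k * (sine_basis *m u) k 0.
Proof.
have bE (x : 'cV[R]_M) : (sine_basis *m x) k 0 = (Num.sqrt (sine_norm2 k))^-1 * (sine_row k *m x) 0 0.
  by rewrite !mxE mulr_sumr; apply: eq_bigr => j _; rewrite !mxE mulrA.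
by rewrite !bE mulmxA sine_row_eigen -scalemxAl mxE mulrCA.
Qed.

(** Places every sine mode under the infimum that defines [gap_discrete]. *)
Lemma sine_frequency (k : 'I_M) :
  discrete_frequencies M H (Num.sqrt (- sine_eigenvalue k)).
Proof.
have l0 := sine_eigenvalue_lt0 (ltn_ord k).
split; first by rewrite sqrtr_gt0 oppr_gt0.
rewrite sqr_sqrtr ?oppr_ge0 ?ltW// opprK; apply/eigenvalueP.
exists (sine_row k); first exact: sine_row_eigen.
apply/eqP => h; have := norm2_gt0 k.
by rewrite /sine_norm2 h mul0mx mxE ltxx.
Qed.

End discrete_laplacian_spectrum.

(** * Helmholtz errors on one mode and in norm *)

Section helmholtz_modes.
Context {R : realType}.
Implicit Types (omega delta abar alpha l E : R).

Lemma detuning_le omega delta c l : 0 < l -> 0 <= c -> 0 < delta -> 0 < omega ->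
  delta <= `|omega - Num.sqrt c * l| ->
  delta * (omega + Num.sqrt c * l) <= `|omega ^+ 2 - c * l ^+ 2|.
Proof.
move=> l0 c0 d0 w0 dl.
have -> : omega ^+ 2 - c * l ^+ 2 = (omega - Num.sqrt c * l) * (omega + Num.sqrt c * l).
  by rewrite -{1}(sqr_sqrtr c0); ring.
have s0 : 0 <= omega + Num.sqrt c * l.
  by rewrite addr_ge0 ?(ltW w0)// mulr_ge0 ?sqrtr_ge0// ltW.
by rewrite normrM (ger0_norm s0) ler_wpM2r.
Qed.

Lemma helmholtz_mode omega delta abar alpha l E (b u v : R) :
  0 < l -> 0 < delta -> delta <= omega -> 0 < abar -> abar / 2 <= alpha ->
  delta <= `|omega - Num.sqrt abar * l| -> delta <= `|omega - Num.sqrt alpha * l| ->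
  (omega ^+ 2 - abar * l ^+ 2) * u = b -> (omega ^+ 2 - alpha * l ^+ 2) * v = b ->
  `|abar - alpha| <= E ->
  [/\ `|u - v| <= 2 * E / abar / delta ^+ 2 * `|b|,
      `|u - v| <= E / (omega ^+ 2 * delta ^+ 2) * `|- l ^+ 2 * b| &
      `|u - v| <= 4 * E / abar * (omega / delta) * `|u|].
Proof.
move=> l0 d0 dw ab0 ale da dal ub vb dE.
have w0 : 0 < omega := lt_le_trans d0 dw.
have al0 : 0 < alpha by apply: lt_le_trans ale; rewrite divr_gt0.
have E0 : 0 <= E := le_trans (normr_ge0 _) dE.
set s : R := Num.sqrt abar; set r : R := Num.sqrt alpha.
have s0 : 0 < s by rewrite sqrtr_gt0.
have r0 : 0 < r by rewrite sqrtr_gt0.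
have s2 : s ^+ 2 = abar by rewrite sqr_sqrtr// ltW.
have r2 : r ^+ 2 = alpha by rewrite sqr_sqrtr// ltW.
set pa := omega ^+ 2 - abar * l ^+ 2 in ub *.
set pl := omega ^+ 2 - alpha * l ^+ 2 in vb *.
have ha : delta * (omega + s * l) <= `|pa| by exact: detuning_le (ltW ab0) _ _ _.
have hl : delta * (omega + r * l) <= `|pl| by exact: detuning_le (ltW al0) _ _ _.
have sl0 : 0 < s * l by rewrite mulr_gt0.
have rl0 : 0 < r * l by rewrite mulr_gt0.
have pa0 : 0 < `|pa| by apply: lt_le_trans ha; rewrite mulr_gt0// addr_gt0.
have pl0 : 0 < `|pl| by apply: lt_le_trans hl; rewrite mulr_gt0// addr_gt0.
have dif : pl * (u - v) = (abar - alpha) * l ^+ 2 * u.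
  have -> : pl * (u - v) = (pl - pa) * u + (pa * u - pl * v) by ring.
  rewrite ub vb subrr addr0 /pl /pa; ring.
have nd : `|pl| * `|u - v| = `|abar - alpha| * l ^+ 2 * `|u|.
  by rewrite -normrM dif normrM normrM (ger0_norm (sqr_ge0 l)).
have nu : `|pa| * `|u| = `|b| by rewrite -normrM ub.
have l20 : 0 < l ^+ 2 by rewrite exprn_gt0.
set D : R := `|u - v| in nd *; set U : R := `|u| in nd nu *; set B : R := `|b| in nu *.
have U0 : 0 <= U := normr_ge0 _.
have B0 : 0 <= B := normr_ge0 _.
have D0 : 0 <= D := normr_ge0 _.
have nd' : `|pl| * D <= E * l ^+ 2 * U by rewrite nd ler_wpM2r// ler_wpM2r// ltW.
have ndb : `|pl| * `|pa| * D <= E * l ^+ 2 * B.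
  by have h := ler_wpM2l (ltW pa0) nd'; rewrite -nu; lra.
have dd0 : 0 < delta ^+ 2 by rewrite exprn_gt0.
split.
(* Dropping omega from both lower bounds leaves a factor [s * r * l ^+ 2], in which [l ^+ 2]
   cancels. From [alpha >= abar / 2] comes [s * r >= abar / 2], hence the constant [2 / abar]. *)
- have sr : abar / 2 <= s * r.
    have h0 : 0 <= s * r by rewrite mulr_ge0// ltW.
    have h1 : 0 <= abar / 2 by rewrite divr_ge0// ltW.
    rewrite -(ler_sqr (h1 : _ \is Num.nneg) (h0 : _ \is Num.nneg)).
    have -> : (s * r) ^+ 2 = abar * alpha by rewrite exprMn s2 r2.
    by rewrite expr2; move: ab0 ale; nra.
  have hp : delta ^+ 2 * (abar / 2) * l ^+ 2 <= `|pl| * `|pa|.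
    apply: (@le_trans _ _ ((delta * (omega + r * l)) * (delta * (omega + s * l)))).
      rewrite (_ : _ * (delta * (omega + s * l)) =
        delta ^+ 2 * ((omega + r * l) * (omega + s * l))); last by ring.
      rewrite -mulrA ler_pM2l//.
      apply: (@le_trans _ _ ((s * r) * l ^+ 2)); first by rewrite ler_wpM2r// ltW.
      have -> : s * r * l ^+ 2 = (r * l) * (s * l) by ring.
      by apply: ler_pM; rewrite ?ltW// ltrDr.
    by apply: ler_pM => //; rewrite mulr_ge0 ?addr_ge0 // ltW.
  have h3 : delta ^+ 2 * (abar / 2) * D <= E * B.
    have h := ler_wpM2r D0 hp.
    by rewrite -(ler_pM2l l20); lra.
  have -> : 2 * E / abar / delta ^+ 2 * B = (E * B) / (delta ^+ 2 * (abar / 2)).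
    by field; rewrite !gt_eqF.
  by rewrite ler_pdivlMr ?mulr_gt0 ?divr_gt0// mulrC.
(* Here only omega is kept in the lower bounds, and [l ^+ 2] is absorbed into the mode of [D2]
   applied to b. *)
- have hp : omega ^+ 2 * delta ^+ 2 <= `|pl| * `|pa|.
    rewrite -exprMn expr2; apply: ler_pM; rewrite ?mulr_ge0 ?(ltW w0) ?(ltW d0)//.
      by apply: le_trans hl; rewrite mulrC ler_pM2l// lerDl ltW.
    by apply: le_trans ha; rewrite mulrC ler_pM2l// lerDl ltW.
  rewrite normrM normrN (ger0_norm (sqr_ge0 l)) -/B.
  have h := ler_wpM2r D0 hp.
  by rewrite mulrAC ler_pdivlMr ?mulr_gt0 ?exprn_gt0//; lra.
- have hk : l ^+ 2 * abar * delta <= 4 * omega * `|pl|.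
    set y := r * l in hl rl0.
    have hy : l ^+ 2 * abar <= 2 * y ^+ 2.
      rewrite /y exprMn r2 mulrA mulrC ler_wpM2r ?(ltW l20)//; lra.
    suff : y ^+ 2 * delta <= 2 * omega * `|pl|.
      have := ler_wpM2r (ltW d0) hy; lra.
    (* For moderate frequencies one factor [y] is bounded by [2 * omega] and the other by the gap
       estimate [hl]. For high ones [|pl| = y ^+ 2 - omega ^+ 2] is comparable to [y ^+ 2], and
       [delta <= omega] suffices. *)
    have [yw|yw] := leP y (2 * omega).
      apply: (@le_trans _ _ (2 * omega * (delta * y))).
        have h := ler_wpM2r (mulr_ge0 (ltW d0) (ltW rl0)) yw.
        by rewrite expr2; lra.
      apply: ler_wpM2l; first by rewrite mulr_ge0// ltW.
      by apply: le_trans hl; rewrite ler_pM2l// lerDr ltW.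
    have -> : `|pl| = y ^+ 2 - omega ^+ 2.
      rewrite /pl -r2 -exprMn -/y distrC ger0_norm// subr_ge0 ler_sqr ?nnegrE ?(ltW w0) ?(ltW rl0)//.
      by lra.
    have h1 := ler_wpM2l (sqr_ge0 y) dw.
    have h2 : 4 * omega ^+ 2 <= y ^+ 2 by move: w0 yw; rewrite !expr2; nra.
    have h3 := ler_wpM2l (ltW w0) h2.
    have h4 : 0 <= omega * omega ^+ 2 by rewrite mulr_ge0 ?sqr_ge0// ltW.
    by lra.
  rewrite -(ler_pM2l (mulr_gt0 pl0 (mulr_gt0 ab0 d0))).
  apply: (@le_trans _ _ (E * l ^+ 2 * U * (abar * delta))).
    by rewrite mulrAC ler_wpM2r// mulr_ge0 ?ltW.
  apply: (@le_trans _ _ ((E * U) * (4 * omega * `|pl|))).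
    rewrite [leLHS](_ : _ = E * U * (l ^+ 2 * abar * delta)); last by ring.
    by rewrite ler_wpM2l// mulr_ge0.
  rewrite le_eqVlt; apply/orP; left; apply/eqP.
  by field; rewrite !gt_eqF.
Qed.

(** Parseval's identity for [V] turns estimates of single coordinates into an estimate of norms. *)
Lemma normH_le (M : nat) (H c : R) (V : 'M[R]_M) (x y : 'cV[R]_M) : 0 <= H -> 0 <= c ->
  (forall z : 'cV[R]_M, \sum_k (V *m z) k 0 ^+ 2 = \sum_k z k 0 ^+ 2) ->
  (forall k, `|(V *m x) k 0| <= c * `|(V *m y) k 0|) ->
  normH H x <= c * normH H y.
Proof.
move=> H0 c0 VE Vxy.
have cE : c = Num.sqrt (c ^+ 2) by rewrite sqrtr_sqr ger0_norm.
rewrite /normH -!mulr_sumr cE -sqrtrM ?sqr_ge0// ler_wsqrtr//.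
rewrite mulrCA ler_wpM2l// -(VE x) -(VE y) mulr_sumr; apply: ler_sum => k _.
rewrite -[leLHS]real_normK ?num_real// -[X in _ * X]real_normK ?num_real// -exprMn.
by rewrite ler_sqr ?nnegrE// mulr_ge0.
Qed.

End helmholtz_modes.

Section discrete_error.
Context {R : realType}.

Lemma gap_discrete_le (M : nat) (H omega c l : R) : discrete_frequencies M H l ->
  gap_discrete M H omega c <= `|omega - Num.sqrt c * l|.
Proof.
move=> fl; apply: ge_inf; last by exists l.
by exists 0 => _ [x _ <-].
Qed.

Lemma helmholtz_difference (M : nat) (H omega delta abar alpha E : R) (b u v : 'cV[R]_M) :
  (0 < M)%N -> 0 < H -> 0 < delta -> delta <= omega -> 0 < abar ->
  abar / 2 <= alpha -> `|abar - alpha| <= E ->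
  delta <= gap_discrete M H omega abar -> delta <= gap_discrete M H omega alpha ->
  discrete_helmholtz H omega abar b u -> discrete_helmholtz H omega alpha b v ->
  [/\ normH H (u - v) <= 2 * E / abar / delta ^+ 2 * normH H b,
      normH H (u - v) <= E / (omega ^+ 2 * delta ^+ 2) * normH H (D2 M H *m b) &
      normH H (u - v) <= 4 * E / abar * (omega / delta) * normH H u].
Proof.
move=> M0 H0 d0 dw ab0 ale dE ga gl hu hv.
have w0 : 0 < omega := lt_le_trans d0 dw.
have E0 : 0 <= E := le_trans (normr_ge0 _) dE.
pose V := @sine_basis R M.
have VE := sine_basis_norm M0 H0.
pose l (k : 'I_M) : R := Num.sqrt (- sine_eigenvalue M H k).
have l0 k : 0 < l k by have [] := sine_frequency M0 H0 k.
have l2 (k : 'I_M) : sine_eigenvalue M H k = - l k ^+ 2.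
  by rewrite sqr_sqrtr ?opprK// oppr_ge0 ltW// sine_eigenvalue_lt0.
have coord c (x : 'cV[R]_M) k : discrete_helmholtz H omega c b x ->
    (omega ^+ 2 - c * l k ^+ 2) * (V *m x) k 0 = (V *m b) k 0.
  move=> <-; rewrite mulmxDr -!scalemxAr.
  have -> : (c *: (V *m (D2 M H *m x)) + omega ^+ 2 *: (V *m x)) k 0 =
      c * (V *m (D2 M H *m x)) k 0 + omega ^+ 2 * (V *m x) k 0.
    by rewrite mxE; congr (_ + _); rewrite mxE.
  rewrite sine_basis_D2 l2; ring.
have modes k := helmholtz_mode (l0 k) d0 dw ab0 ale
  (le_trans ga (gap_discrete_le _ _ (sine_frequency M0 H0 k)))
  (le_trans gl (gap_discrete_le _ _ (sine_frequency M0 H0 k)))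
  (coord _ _ k hu) (coord _ _ k hv) dE.
have VB k : (V *m (u - v)) k 0 = (V *m u) k 0 - (V *m v) k 0.
  by rewrite mulmxBr mxE; congr (_ + _); rewrite mxE.
split; apply: (normH_le (V := V)) => //; try exact: ltW.
- by rewrite !mulr_ge0 ?invr_ge0 ?exprn_ge0// ltW.
- by move=> k; rewrite VB; have [] := modes k.
- by rewrite !mulr_ge0 ?invr_ge0 ?mulr_ge0 ?exprn_ge0// ltW.
- by move=> k; rewrite VB sine_basis_D2// l2; have [] := modes k.
- by rewrite !mulr_ge0 ?invr_ge0// ltW.
- by move=> k; rewrite VB; have [] := modes k.
Qed.

End discrete_error.

Unset Implicit Arguments.

Theorem theorem3p1 (R : realType) (a : R -> R) (p q : nat) (K : R -> R)
    (a_meas : measurable_fun [set: R] a)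
    (a_per : periodic a 1)
    (a_inf : 0 < inf (range a))
    (a_sup : has_ubound (range a))
    (K_kernel : avg_kernel p q K) :
  exists C1 C2 C3 : R,
  forall (L eps eta tau omega : R) (Mx Mt j : nat)
    (w wx wt : R -> R -> R) (b u v : 'cV[R]_Mx),
  let H := mesh_size L Mx in
  let A := micro_coef a eps H j in
  let abar := homogenized_coef a in
  let alpha := hmm_flux K eta tau A wx in
  let delta := gap Mx L omega abar alpha in
  0 < L -> 0 < eps -> 0 < eta -> 0 < tau -> (1 <= Mx)%N -> (1 <= Mt)%N ->
  (j <= Mx)%N ->
  (exists m : int, H = m%:~R * eps) ->
  eta = tau ->
  micro_solution A w wx wt ->
  0 < delta -> delta <= omega -> 1 <= omega ->
  `|abar - alpha| / abar <= 2^-1 ->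
  stable_time_step Mx H omega Mt alpha ->
  discrete_helmholtz H omega abar b u ->
  whmm_fixed_point H omega Mt alpha b v ->
  [/\ normH H (u - v) <= C1 / delta ^+ 2 * (eps / eta) ^+ q * normH H b,
      normH H (u - v) <=
        C2 / (omega ^+ 2 * delta ^+ 2) * (eps / eta) ^+ q * normH H (D2 Mx H *m b) &
      b != 0 ->
        normH H (u - v) / normH H u <= C3 * (omega / delta) * (eps / eta) ^+ q].
Proof.
have [dK [dK0 dK_derive dK_cont dK_bound]] := avg_kernel_Cq K_kernel.
have K_mass := avg_kernel_mass K_kernel.
(* The infimum of a set without one is 0 by convention, so a positive value guarantees a genuine
   lower bound. *)
have range_inf : has_inf (range a) by apply: contrapT => /inf_out ai; move: a_inf; rewrite ai ltxx.
pose m := inf (range a); have am y : m <= a y.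
  by apply: ge_inf; [exact: range_inf.2|exists y].
have [Lam aLam'] := a_sup; have aLam y : a y <= Lam by apply: aLam'; exists y.
have ab0 := homogenized_coef_gt0 a_inf am aLam a_meas.
set abar0 := homogenized_coef a in ab0.
(* The constant is fixed before the scales and the micro solution are introduced, so it depends on
   the coefficient and the kernel only. *)
have [C [C0 HC]] : exists C : R, 0 <= C /\
    forall (eps eta X : R) (A : R -> R) (w wx wt : R -> R -> R),
    0 < eps -> 0 < eta -> (forall z, A z = a ((X + z) / eps)) ->
    micro_solution A w wx wt ->
    `|abar0 - hmm_flux K eta eta A wx| / abar0 <= 2^-1 ->
    `|abar0 - hmm_flux K eta eta A wx| <= C * (eps / eta) ^+ q.
  case: q dK_derive dK_cont dK_bound {K_kernel} => [|q'] dK_derive dK_cont dK_bound.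
    exists (2^-1 * abar0); split; first by apply: mulr_ge0 => //; exact: ltW.
    by move=> eps eta X A w wx wt _ _ _ _; rewrite expr0 mulr1 ler_pdivrMr.
  have [kappa _ kB] := clamp_bounded (dK_cont 0 isT).
  have [kappa' _ kB'] := clamp_bounded (dK_cont q'.+1 (leqnn _)).
  pose C := flux_constant a m Lam q' kappa kappa'.
  have hC (eps eta X : R) A w wx wt : 0 < eps -> 0 < eta ->
      (forall z, A z = a ((X + z) / eps)) -> micro_solution A w wx wt ->
      `|abar0 - hmm_flux K eta eta A wx| <= C * (eps / eta) ^+ q'.+1.
    exact: (hmm_flux_error a_inf am aLam a_meas a_per dK0 dK_derive dK_cont dK_bound K_mass kB kB').
  (* The absolute value makes the constant nonnegative without an inspection of [flux_constant]. *)
  exists `|C|; split => // eps eta X A w wx wt e0 t0 AE sol _.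
  apply: le_trans (hC _ _ _ _ _ _ _ e0 t0 AE sol) _.
  by rewrite ler_wpM2r ?ler_norm// exprn_ge0// divr_ge0// ltW.
exists (2 * C / abar0), C, (4 * C / abar0).
move=> L eps eta tau omega Mx Mt j w wx wt b u v H A abar alpha delta.
move=> L0 eps0 eta0 tau0 Mx0 Mt0 jM _ etaE sol d0 dw w1 half _ hu [_ hv].
have H0 : 0 < H by rewrite divr_gt0.
have dE : `|abar - alpha| <= C * (eps / eta) ^+ q.
  move: half; rewrite /alpha -etaE => half.
  exact: (HC _ _ (j%:R * H + H / 2) A w wx wt).
have ale : abar / 2 <= alpha.
  move: half; rewrite ler_pdivrMr//= => half.
  by have := ler_norm (abar - alpha); lra.
have ga : delta <= gap_discrete Mx H omega abar by rewrite /delta /gap ge_min lexx.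
have gl : delta <= gap_discrete Mx H omega alpha.
  by rewrite /delta /gap !ge_min lexx orbT.
have [h1 h2 h3] := helmholtz_difference Mx0 H0 d0 dw ab0 ale dE ga gl hu hv.
have r0 : 0 <= (eps / eta) ^+ q by rewrite exprn_ge0// divr_ge0// ltW.
split.
- apply: le_trans h1 _; rewrite le_eqVlt; apply/orP; left; apply/eqP.
  ring.
- apply: le_trans h2 _; rewrite le_eqVlt; apply/orP; left; apply/eqP.
  ring.
- move=> _; have := sqrtr_ge0 (\sum_(i < Mx) H * u i 0 ^+ 2); rewrite -/(normH H u) le_eqVlt.
  have rhs0 : 0 <= 4 * C / abar0 * (omega / delta) * (eps / eta) ^+ q.
    have w0 := le_trans ler01 w1.
    by do !apply: mulr_ge0 => //; rewrite invr_ge0 ltW.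
  (* Division by zero yields zero, so the quotient vanishes when u has norm zero. *)
  case/orP => [/eqP <-|u0]; first by rewrite invr0 mulr0.
  rewrite ler_pdivrMr//; apply: le_trans h3 _; rewrite le_eqVlt; apply/orP; left; apply/eqP.
  rewrite /abar0; ring.
Qed.
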